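(* Let $\{\alpha_k\}_{k\in\mathbb{N}}$ be a sequence of positive reals, put $A_k:=\sum_{i=0}^k\alpha_i$ and $\beta_k:=\dfrac{\sum_{i=0}^k\alpha_i}{\left(\sum_{i=0}^k\alpha_i^2\right)^{1/2}}$, and suppose that $\sum_{k=0}^\infty\alpha_k=+\infty$ and that for some $N,\gamma>0$ $$\frac{\sum_{i=0}^k\alpha_i^2}{\left(\sum_{i=0}^k\alpha_i\right)^2}\le \frac{N}{k^\gamma}\ \text{ for all } k\in\mathbb{N}\setminus\{0\},\qquad \sum_{k=1}^\infty\frac{\alpha_k(1+\sqrt{\ln \beta_{k-1}})}{\beta_{k-1}\sum_{i=0}^k\alpha_i}<+\infty .$$ Assume further that either $\gamma>1/2$ or $$\lim_{k,l\to\infty,\ l/k\to 1}\frac{\sum_{i=0}^l\alpha_i}{\sum_{i=0}^k\alpha_i}=1 .$$ Let $\{x^k\}$ be a sequence generated by either Algorithm 1 or Algorithm 2 (both described in the context) applied to the stochastic DC program $\alpha=\min\{f(x)=\varPhi(x)+r(x): x\in\mathbb{R}^n\}$ of the context. Suppose that assumption (A1) of the context holds in the case of Algorithm 1, that assumption (A2) of the context holds in the case of Algorithm 2, and that $\rho:=\inf_{s\in\Omega}\rho(h(\cdot,s))+\rho(r_2)>0$. Suppose that the optimal value $\alpha$ is finite and that, with probability 1, $\limsup_{k\to\infty}\|x^k\|<\infty$ and $\limsup_{k\to\infty}\|u^k\|<\infty$, where $u^k\in\partial r_2(x^k)$ are the subgradients chosen by the algorithm. Then: (i) There exists a subsequence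 $\{x^{l_k}\}$ such that, with probability 1, every limit point of it is a critical point of the program. (ii) Let $C$ be a compact set containing $\{x^k\}$. Suppose that, in the case of Algorithm 1, the derivative $\nabla r_2$ and the derivatives $\nabla h(\cdot,s)$, $s\in\Omega$, are equi-Lipschitz with the same modulus $L/2$ on $C$; and that, in the case of Algorithm 2, the derivative $\nabla r_2$ and the derivatives $\nabla g(\cdot,s),\nabla h(\cdot,s)$, $s\in\Omega$, are equi-Lipschitz with the same modulus $L/2$ on $C$. Then $$d_k=O\left(\frac{1}{\sqrt{\sum_{i=0}^k\alpha_i/A_i}}\right)\quad\text{as } k\to\infty,$$ where $d_k:=\min_{1\le i\le k}\mathbb{E}\, d\big(0,\ \partial G(x^i)+\partial r_1(x^i)-\partial H(x^i)-\partial r_2(x^i)\big)$.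
   Context: Problem. $(\Omega,\Sigma_\Omega,\mathbb{P})$ is a complete probability space. For each $s\in\Omega$, $g(\cdot,s),h(\cdot,s):\mathbb{R}^n\to\mathbb{R}$ are continuous convex functions; the expectations of $g(x,\cdot)$ and $h(x,\cdot)$ are finite for all $x\in\mathbb{R}^n$, and $G(x):=\mathbb{E}_s[g(x,s)]$, $H(x):=\mathbb{E}_s[h(x,s)]$, $\varPhi(x):=\mathbb{E}_s[g(x,s)-h(x,s)]=G(x)-H(x)$. The function $r:\mathbb{R}^n\to\mathbb{R}\cup\{+\infty\}$ is lower semicontinuous with $r=r_1-r_2$, where $r_1,r_2:\mathbb{R}^n\to\mathbb{R}\cup\{+\infty\}$ are lower semicontinuous convex functions (convention $+\infty-(+\infty)=+\infty$). The stochastic DC program is $\alpha=\min\{f(x):=\varPhi(x)+r(x): x\in\mathbb{R}^n\}$, where $\alpha$ (without index) denotes the optimal value. Notation. $\partial$ of a convex function is the convex subdifferential, with $\partial f(x)=\emptyset$ outside the effective domain $\mathrm{Dom}\, f=\{x: f(x)<+\infty\}$. A function $\psi:\mathbb{R}^n\to\mathbb{R}\cup\{+\infty\}$ is $\rho$-convex ($\rho\ge0$) if $\psi(\lambda x+(1-\lambda)y)\le\lambda \psi(x)+(1-\lambda)\psi(y)-\frac{\rho}{2}\lambda(1-\lambda)\|x-y\|^2$ for all $x,y\in\mathbb{R}^n$, $\lambda\in[0,1]$; $\rho(\psi)$ denotes the supremum of all such $\rho$. For $B\subseteq\mathbb{R}^n$, $d(0,B)=\inf\{\|y\|:y\in B\}$.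 A point $x^*$ is a critical point of the program if $0\in\partial (G+r_1)(x^* )-\partial (H+r_2)(x^* )=\partial G(x^* )+\partial r_1(x^* )-\partial H(x^* )-\partial r_2(x^* )$. A family of maps is equi-Lipschitz on $C$ with modulus $M$ if each map in it is Lipschitz on $C$ with constant $M$. Assumption (A1): for each $x\in\mathbb{R}^n$ the function $h(x,\cdot)$ is bounded on $\Omega$, and the functions $h(\cdot,s)$, $s\in\Omega$, are equi-continuous at each $x\in\mathbb{R}^n$, i.e. for each $x$ and $\varepsilon>0$ there is $\delta>0$ with $|h(z,s)-h(x,s)|\le\varepsilon$ for all $z\in B(x,\delta)$ and all $s\in\Omega$. Assumption (A2): for each $x\in\mathbb{R}^n$ the functions $g(x,\cdot),h(x,\cdot)$ are bounded on $\Omega$, and the functions $g(\cdot,s),h(\cdot,s)$, $s\in\Omega$, are equi-continuous at each $x\in\mathbb{R}^n$. Algorithm 1 (SDCA1). Given positive weights $\{\alpha_k\}$: choose $x^0\in\mathrm{Dom}\, r_1$, draw $s^0\sim\mathbb{P}$, set $k=0$. Repeat: (1) compute $z^k\in\partial h(x^k,s^k)$ (subdifferential in the first variable) and $u^k\in\partial r_2(x^k)$; (2) set $y^k=\frac{1}{\sum_{i=0}^k\alpha_i}\sum_{i=0}^k\alpha_i z^i$ and $w^k=\frac{1}{\sum_{i=0}^k\alpha_i}\sum_{i=0}^k\alpha_i u^i$; (3) compute a solution $x^{k+1}$ of the convex program $\min\{G(x)+r_1(x)-\langle y^k+w^k,x\rangle: x\in\mathbb{R}^n\}$; (4) set $k:=k+1$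 and draw $s^k\sim\mathbb{P}$. The draws $s^0,s^1,\dots$ are independent and identically distributed with law $\mathbb{P}$. Algorithm 2 (SDCA2). Same as Algorithm 1, except that in step (3) $G$ is replaced by $G_k(x):=\frac{1}{\sum_{i=0}^k\alpha_i}\sum_{i=0}^k\alpha_i g(x,s^i)$. *)

(* Defs.v *)
From HB Require Import structures.
From mathcomp Require Export all_boot all_order all_algebra finmap.
From mathcomp Require Export all_classical all_reals all_analysis.
Export Order.TTheory GRing.Theory Num.Theory.
Export numFieldNormedType.Exports.

Set Implicit Arguments.
Unset Strict Implicit.
Unset Printing Implicit Defensive.

Local Open Scope classical_set_scope.
Local Open Scope ring_scope.

Section convex_analysis.
Context {R : realType} {n : nat}.
Local Notation Rn := 'rV[R]_n.
Implicit Types (x y : Rn) (A B C : set Rn) (psi : Rn -> \bar R).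

Definition dotp x y : R := \sum_j x 0 j * y 0 j.

(* The library norm on 'rV[R]_n is the sup norm; it induces the same topology,
   but strong convexity, Lipschitz moduli and distances are Euclidean. *)
Definition enorm x : R := Num.sqrt (dotp x x).

Definition msum A B : set Rn := [set a + b | a in A & b in B].
Definition mdiff A B : set Rn := [set a - b | a in A & b in B].

(* Equals +oo when B is empty. *)
Definition dist0 B : \bar R := ereal_inf [set (enorm y)%:E | y in B].

Definition subdiff psi x : set Rn :=
  [set v | (psi x < +oo /\
    forall y, psi x + (dotp v (y - x))%:E <= psi y)%E].

(* For l = 0 or 1 the convention 0 * +oo = 0 of \bar R applies, so that the
   inequality is trivial there, as it should be. *)
Definition rho_convex (rho : R) psi : Prop :=
  forall x y (l : R), 0 <= l <= 1 ->
    (psi (l *: x + (1 - l) *: y)%R <=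
     l%:E * psi x + (1 - l)%:E * psi y
     - (rho / 2 * l * (1 - l) * enorm (x - y) ^+ 2)%:E)%E.

Definition convex_ext psi : Prop := rho_convex 0 psi.

Definition rho_modulus psi : \bar R :=
  ereal_sup [set rho%:E | rho in [set rho : R | 0 <= rho /\ rho_convex rho psi]].

Definition gradient (f : Rn -> R) x : Rn := \row_j 'D_(delta_mx 0 j) f x.

(* psi is differentiable at every point of C (in particular finite around it)
   and its gradient is M-Lipschitz on C for the Euclidean norm. *)
Definition lipschitz_gradient_on C (M : R) psi : Prop :=
  (forall x, C x -> (\forall y \near x, psi y \is a fin_num) /\
                    differentiable (fine \o psi : Rn -> R^o) x) /\
  (forall x y, C x -> C y ->
     enorm (gradient (fine \o psi) x - gradient (fine \o psi) y)
       <= M * enorm (x - y)).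

Definition minimizer psi x : Prop := forall y, (psi x <= psi y)%E.

End convex_analysis.

Section weights.
Context {R : realType}.
Variable alpha : nat -> R.

Definition weight_sum (k : nat) : R := \sum_(i < k.+1) alpha i.

Definition sq_weight_sum (k : nat) : R := \sum_(i < k.+1) alpha i ^+ 2.

Definition beta (k : nat) : R := weight_sum k / Num.sqrt (sq_weight_sum k).

(* Weighted mean of v_0, ..., v_k. *)
Definition wmean (V : lmodType R) (v : nat -> V) (k : nat) : V :=
  (weight_sum k)^-1 *: \sum_(i < k.+1) alpha i *: v i.

(* A_l / A_k -> 1 as k, l -> oo with l / k -> 1. *)
Definition slowly_growing_weights : Prop :=
  forall e : R, 0 < e -> exists2 d : R, 0 < d & exists K : nat,
    forall k l : nat, (K <= k)%N -> (K <= l)%N ->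
      `|l%:R / k%:R - 1| < d -> `|weight_sum l / weight_sum k - 1| < e.

End weights.

Section dc_program.
Context {R : realType} {n : nat} {d : measure_display} {Omega : measurableType d}.
Local Notation Rn := 'rV[R]_n.
Local Notation integrand := (Rn -> Omega -> R).
Local Notation ext_fun := (Rn -> \bar R).
Variable P : probability Omega R.

Definition mean_fun (g : integrand) (x : Rn) : R := fine 'E_P[g x].

Definition Phi (g h : integrand) (x : Rn) : R :=
  fine 'E_P[(fun s => g x s - h x s)].

(* Dual addition is the one with +oo - +oo = +oo. *)
Definition ext_diff (r1 r2 : ext_fun) (x : Rn) : \bar R := (r1 x - r2 x)%dE.

Definition objective (g h : integrand) (r1 r2 : ext_fun) (x : Rn) : \bar R :=
  ((Phi g h x)%:E + ext_diff r1 r2 x)%E.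

Definition optimal_value (g h : integrand) (r1 r2 : ext_fun) : \bar R :=
  ereal_inf (range (objective g h r1 r2)).

Definition critical_point (g h : integrand) (r1 r2 : ext_fun) (x : Rn) :
    Prop :=
  mdiff (subdiff (fun y => (mean_fun g y)%:E + r1 y)%E x)
        (subdiff (fun y => (mean_fun h y)%:E + r2 y)%E x) 0.

Definition criticality_set (g h : integrand) (r1 r2 : ext_fun) (x : Rn) :
    set Rn :=
  mdiff (mdiff (msum (subdiff (EFin \o mean_fun g) x) (subdiff r1 x))
               (subdiff (EFin \o mean_fun h) x))
        (subdiff r2 x).

Definition bounded_in_s (g : integrand) : Prop :=
  forall x, bounded_fun (g x : Omega -> R^o).

Definition equicontinuous_in_x (g : integrand) : Prop :=
  equicontinuous [set: Omega] (fun s x => g x s).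

End dc_program.

Section draws.
Context {R : realType} {d : measure_display} {Omega : measurableType d}.
Context {d' : measure_display} {T : measurableType d'}.
Variables (P : probability Omega R) (Pr : probability T R).

Record iid_draws (s : nat -> T -> Omega) : Prop := IidDraws {
  draws_measurable : forall k, measurable_fun [set: T] (s k) ;
  draws_law : forall k B, measurable B -> Pr (s k @^-1` B) = P B ;
  draws_independent : forall (J : {fset nat}) (B : nat -> set Omega),
    (forall j, measurable (B j)) ->
    Pr (\bigcap_(j in [set` J]) (s j @^-1` B j)) =
    (\prod_(j <- J) Pr (s j @^-1` B j))%E }.

(* F k is the information available just before the k-th draw; it contains
   the draws 0, ..., k-1 and is independent of the k-th one.  It may be larger
   than the sigma-algebra generated by these draws. *)
Record history (s : nat -> T -> Omega) (F : nat -> set (set T)) : Prop :=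
  History {
  history_sigma_algebra : forall k, sigma_algebra [set: T] (F k) ;
  history_measurable : forall k, F k `<=` measurable ;
  history_mono : forall k, F k `<=` F k.+1 ;
  history_draw : forall k B, measurable B -> F k.+1 (s k @^-1` B) ;
  history_independent : forall k A B, F k A -> measurable B ->
    Pr (A `&` s k @^-1` B) = (Pr A * Pr (s k @^-1` B))%E }.

Definition known (n : nat) (E : set (set T)) (v : T -> 'rV[R]_n) : Prop :=
  forall j (B : set R), measurable B -> E ((fun w => v w 0 j) @^-1` B).

End draws.

Inductive sdca_variant := SDCA1 | SDCA2.

Section algorithm.
Context {R : realType} {n : nat} {d : measure_display} {Omega : measurableType d}.
Context {d' : measure_display} {T : measurableType d'}.
Local Notation Rn := 'rV[R]_n.
Variables (P : probability Omega R) (alpha : nat -> R).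
Variables (g h : Rn -> Omega -> R) (r1 r2 : Rn -> \bar R).

(* The first term of the convex subproblem at step k, the draws being s. *)
Definition sdca_model (alg : sdca_variant) (s : nat -> Omega) (k : nat)
    (x : Rn) : R :=
  match alg with
  | SDCA1 => mean_fun P g x
  | SDCA2 => wmean alpha (fun i => g x (s i) : R^o) k
  end.

Definition sdca_subproblem (alg : sdca_variant) (s : nat -> Omega)
    (z u : nat -> Rn) (k : nat) (x : Rn) : \bar R :=
  ((sdca_model alg s k x)%:E + r1 x
   - (dotp (wmean alpha z k + wmean alpha u k) x)%:E)%E.

(* x^k may depend on the information F k preceding the k-th draw only, while
   z^k and u^k are chosen once the k-th draw is known. *)
Record generated_by_sdca (alg : sdca_variant) (F : nat -> set (set T))
    (s : nat -> T -> Omega) (x z u : nat -> T -> Rn) : Prop := GeneratedBySdca {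
  sdca_start : exists2 x0 : Rn, (r1 x0 < +oo)%E & forall w, x 0 w = x0 ;
  sdca_z : forall k w, subdiff (fun y => (h y (s k w))%:E) (x k w) (z k w) ;
  sdca_u : forall k w, subdiff r2 (x k w) (u k w) ;
  sdca_step : forall k w,
    minimizer (sdca_subproblem alg (s ^~ w) (z ^~ w) (u ^~ w) k) (x k.+1 w) ;
  sdca_x_known : forall k, known (F k) (x k) ;
  sdca_z_known : forall k, known (F k.+1) (z k) ;
  sdca_u_known : forall k, known (F k.+1) (u k) }.

End algorithm.

Section rate.
Context {R : realType} {n : nat} {d : measure_display} {Omega : measurableType d}.
Context {d' : measure_display} {T : measurableType d'}.
Local Notation Rn := 'rV[R]_n.
Variables (P : probability Omega R) (Pr : probability T R).
Variables (g h : Rn -> Omega -> R) (r1 r2 : Rn -> \bar R).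

(* The residuals lie in [0, +oo], hence the integral of an extended-real
   function and a minimum in \bar R (equal to +oo for k = 0). *)
Definition min_residual (x : nat -> T -> Rn) (k : nat) : \bar R :=
  \big[mine/+oo%E]_(1 <= i < k.+1)
    (\int[Pr]_w dist0 (criticality_set P g h r1 r2 (x i w)))%E.

End rate.

(* Main.v *)
(** Both algorithms are the second one for the integrand [g'], where
    [g'(x,s) = G x] for SDCA1 and [g' = g] for SDCA2.  Put [zeta = g' - h],
    [A_k] the sum of the first weights, [a_k = alpha_k / A_k], and let [V_k] be
    the minimal value of the k-th convex model
    [G_k + r1 - mean_i (h(x^i,s^i) + r2(x^i) + <z^i + u^i, . - x^i>)].
    Minimality of [x^(k+1)] gives
    [V_(k+1) <= V_k + a_(k+1) (f(x^(k+1)) + D_(k+1) - V_k)] with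
    [D_(k+1) = zeta(x^(k+1),s^(k+1)) - E zeta(x^(k+1),.)] of conditional mean 0,
    and strong convexity gives
    [V_k >= f(x^(k+1)) + (zeta_k - E zeta)(x^(k+1)) + (rho/2) Q_k], where [Q_k]
    is the weighted mean of [|x^(k+1) - x^i|^2].  A uniform law of large numbers
    (Hoeffding and nets) bounds the expectation of [sup_C |zeta_k - E zeta| ] by
    a constant times [(1 + sqrt (ln beta_k)) / beta_k], so the series of the
    [a_(k+1) E Q_k] converges, after truncation at the exit from a ball.
    Since the series of the [a_k] diverges (Abel-Dini), [Q_k] and all uniform
    errors tend to 0 almost surely along a deterministic subsequence; along it
    the aggregated subgradients [y^k + w^k] converge to common subgradients of
    [G + r1] and [H + r2].  For (ii), the residual at [x^(k+1)] is at most [L]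
    times the weighted mean of [|x^(k+1) - x^i|] plus a uniform error of
    gradients, and averaging over [k] with the weights [a_k] gives the rate. *)

(* The iterates are bounded almost surely, but by a random bound, and the constants of the uniform
   law depend on the radius of the ball. Hence every expectation is taken for a fixed ball, and only
   at the end does the radius run over the integers. The truncation multiplies [D_k] by the
   indicator that [x^0, ..., x^k] lie in the ball: this is known before the k-th draw, so the
   conditional mean stays 0, which may fail for the event that the whole path stays in the ball. The
   finite optimal value bounds [V_k] from below and so closes the telescoping sum. One subsequence
   has to serve all samples. It is therefore selected from expectations, for all radii at once, and
   the levels [2 ^ -(j+1)] are summable so that convergence along it becomes almost sure. Small
   [Q_k] matters because [y^k + w^k] averages subgradients of [h + r2] taken at old iterates; it
   makes them approximate subgradients at [x^(k+1)]. The distance to the criticality set is not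
   known to be a measurable function of the sample; its integral is only bounded from above, through
   a measurable majorant. *)
From HB Require Import structures.
Require Import Defs.
From mathcomp Require Import measurable_realfun ring lra.

Set Implicit Arguments.
Unset Strict Implicit.
Unset Printing Implicit Defensive.

Local Open Scope classical_set_scope.
Local Open Scope ring_scope.

(** * Euclidean structure *)

Section euclidean.
Context {R : realType} {n : nat}.
Local Notation Rn := 'rV[R]_n.
Implicit Types x y : Rn.

Lemma dotpC x y : dotp x y = dotp y x.
Proof. by rewrite /dotp; apply: eq_bigr => j _; rewrite mulrC. Qed.

Lemma dotpDl x y v : dotp (x + y) v = dotp x v + dotp y v.
Proof.
by rewrite /dotp -big_split; apply: eq_bigr => j _; rewrite mxE mulrDl.
Qed.

Lemma dotpZl a x y : dotp (a *: x) y = a * dotp x y.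
Proof.
by rewrite /dotp mulr_sumr; apply: eq_bigr => j _; rewrite mxE mulrA.
Qed.

Lemma dotpDr x y v : dotp v (x + y) = dotp v x + dotp v y.
Proof. by rewrite dotpC dotpDl !(dotpC v). Qed.

Lemma dotpZr a x y : dotp x (a *: y) = a * dotp x y.
Proof. by rewrite dotpC dotpZl dotpC. Qed.

Lemma dotpNl x y : dotp (- x) y = - dotp x y.
Proof. by rewrite -scaleN1r dotpZl mulN1r. Qed.

Lemma dotpNr x y : dotp x (- y) = - dotp x y.
Proof. by rewrite dotpC dotpNl dotpC. Qed.

Lemma dotpBl x y v : dotp (x - y) v = dotp x v - dotp y v.
Proof. by rewrite dotpDl dotpNl. Qed.

Lemma dotpBr x y v : dotp v (x - y) = dotp v x - dotp v y.
Proof. by rewrite dotpDr dotpNr. Qed.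

Lemma dotp0l x : dotp 0 x = 0.
Proof. by rewrite -(scale0r 0) dotpZl mul0r. Qed.

Lemma dotp_suml (I : Type) (r : seq I) (f : I -> Rn) y :
  dotp (\sum_(i <- r) f i) y = \sum_(i <- r) dotp (f i) y.
Proof.
elim/big_ind2 : _ => //; first exact: dotp0l.
by move=> a b c d <- <-; rewrite dotpDl.
Qed.

Lemma dotp_ge0 x : 0 <= dotp x x.
Proof. by apply: sumr_ge0 => j _; rewrite -expr2 sqr_ge0. Qed.

Lemma enorm_ge0 x : 0 <= enorm x.
Proof. exact: sqrtr_ge0. Qed.

Lemma enorm_sqr x : enorm x ^+ 2 = dotp x x.
Proof. by rewrite sqr_sqrtr// dotp_ge0. Qed.

Lemma enormN x : enorm (- x) = enorm x.
Proof. by rewrite /enorm dotpNl dotpNr opprK. Qed.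

Lemma enormB x y : enorm (x - y) = enorm (y - x).
Proof. by rewrite -enormN opprB. Qed.

Lemma enormZ a x : enorm (a *: x) = `|a| * enorm x.
Proof.
by rewrite /enorm dotpZl dotpZr mulrA -expr2 sqrtrM ?sqr_ge0// sqrtr_sqr.
Qed.

Lemma enorm0 : enorm (0 : Rn) = 0.
Proof. by rewrite /enorm dotp0l sqrtr0. Qed.

Lemma enorm_coord x j : `|x 0 j| <= enorm x.
Proof.
rewrite -(@ler_pXn2r _ 2) ?nnegrE ?enorm_ge0// enorm_sqr real_normK ?num_real//.
by rewrite /dotp (bigD1 j)//= expr2 lerDl sumr_ge0// => i _; rewrite -expr2 sqr_ge0.
Qed.

Lemma enorm_eq0 x : enorm x = 0 -> x = 0.
Proof.
move=> x0; apply/rowP => j; rewrite mxE; apply/eqP.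
by rewrite -normr_le0 -x0 enorm_coord.
Qed.

Lemma dotp_le_enorm x y : dotp x y <= enorm x * enorm y.
Proof.
have [y0|yn0] := eqVneq (enorm y) 0.
  by rewrite (enorm_eq0 y0) enorm0 mulr0 dotpC dotp0l.
have y0 : 0 < enorm y by rewrite lt_neqAle eq_sym yn0 enorm_ge0.
rewrite -ler_pdivrMr//.
have [|xy0] := leP (dotp x y / enorm y) 0; first by move/le_trans; apply; exact: enorm_ge0.
rewrite -(@ler_pXn2r _ 2) ?nnegrE ?enorm_ge0 ?(ltW xy0)//.
rewrite enorm_sqr exprMn exprVn.
have := dotp_ge0 (enorm y ^+ 2 *: x - dotp x y *: y).
rewrite dotpBl !dotpBr !dotpZl !dotpZr -enorm_sqr (dotpC y x) -enorm_sqr.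
move=> H.
rewrite ler_pdivrMr ?exprn_gt0//.
have : 0 <= enorm y ^+ 2 * (enorm x ^+ 2 * enorm y ^+ 2 - dotp x y ^+ 2) by lra.
by rewrite pmulr_rge0 ?exprn_gt0// subr_ge0.
Qed.

Lemma normr_dotp_le x y : `|dotp x y| <= enorm x * enorm y.
Proof.
rewrite ler_norml dotp_le_enorm andbT lerNl -dotpNl.
by rewrite -(enormN x) dotp_le_enorm.
Qed.

Lemma enormD x y : enorm (x + y) <= enorm x + enorm y.
Proof.
rewrite -(@ler_pXn2r _ 2) ?nnegrE ?addr_ge0 ?enorm_ge0//.
rewrite enorm_sqr dotpDl !dotpDr (dotpC y x) sqrrD !enorm_sqr.
by have := dotp_le_enorm x y; lra.
Qed.

Lemma enorm_sum (I : Type) (r : seq I) (f : I -> Rn) :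
  enorm (\sum_(i <- r) f i) <= \sum_(i <- r) enorm (f i).
Proof.
elim/big_ind2 : _ => //; first by rewrite enorm0.
by move=> a b c d ab cd; rewrite (le_trans (enormD _ _))// lerD.
Qed.

Lemma enorm_le_sum x : enorm x <= \sum_j `|x 0 j|.
Proof.
have {1}-> : x = \sum_j x 0 j *: delta_mx 0 j by exact: row_sum_delta.
apply: le_trans (enorm_sum _ _) _; apply: ler_sum => j _; rewrite enormZ.
rewrite /enorm /dotp (bigD1 j)//= big1 ?mxE ?eqxx ?mulr1 ?addr0 ?sqrtr1 ?mulr1//.
by move=> i ij; rewrite !mxE (negbTE ij) andbF mulr0.
Qed.

Lemma norm_coord x j : `|x 0 j| <= `|x|.
Proof.
rewrite [leRHS]mx_normrE.
exact: (le_bigmax _ (fun ij => `|x ij.1 ij.2|) (0, j)).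
Qed.

Lemma norm_le_enorm x : `|x| <= enorm x.
Proof.
by rewrite [leLHS]mx_normrE; apply: bigmax_le => [|[i j] _ /=];
  rewrite ?enorm_ge0// ord1 enorm_coord.
Qed.

Lemma enorm_le_norm x : enorm x <= n%:R * `|x|.
Proof.
apply: le_trans (enorm_le_sum x) _.
apply: le_trans (ler_sum _ (fun j _ => norm_coord x j)) _.
by rewrite sumr_const card_ord mulr_natl.
Qed.

End euclidean.

(** * Finite convex functions *)

Section real_convex.
Context {R : realType} {n : nat}.
Local Notation Rn := 'rV[R]_n.
Implicit Types (f : Rn -> R) (x y : Rn).

Definition real_convex f := forall x y (l : R), 0 <= l <= 1 ->
  f (l *: x + (1 - l) *: y) <= l * f x + (1 - l) * f y.

Lemma convex_function_real_convex f :
  convex_function (E := 'rV[R]_n) setT f -> real_convex f.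
Proof.
move=> cf x y l /andP[l0 l1].
by have := cf (Itv01 l0 l1) x y (mem_set Logic.I) (mem_set Logic.I).
Qed.

(** The missing mass is carried by the origin, whence the bound on [f 0]. The strict inequality on
    the weights lets the induction peel off one point and renormalize the others by
    [1 - t i > 0]. *)
Lemma real_convex_sublevel f B (I : Type) (r : seq I) (y : I -> Rn)
    (t : I -> R) : real_convex f -> f 0 <= B -> (forall i, f (y i) <= B) ->
  (forall i, 0 <= t i) -> \sum_(i <- r) t i < 1 ->
  f (\sum_(i <- r) t i *: y i) <= B.
Proof.
move=> cf f0 fy; elim: r t => [|i r IH] t t0; first by rewrite !big_nil.
rewrite !big_cons => ht.
have sum0 : 0 <= \sum_(j <- r) t j by apply: sumr_ge0.
have ti1 : 0 < 1 - t i by lra.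
have tin : 1 - t i != 0 by rewrite gt_eqF.
have -> : \sum_(j <- r) t j *: y j =
    (1 - t i) *: \sum_(j <- r) (t j / (1 - t i)) *: y j.
  rewrite scaler_sumr; apply: eq_bigr => j _.
  by rewrite scalerA; congr (_ *: _); field.
have t1 : 0 <= t i <= 1 by rewrite t0/=; lra.
apply: le_trans (cf _ _ _ t1) _.
have := IH (fun j => t j / (1 - t i)).
move=> /(_ (fun j => divr_ge0 (t0 j) (ltW ti1))).
rewrite -mulr_suml ltr_pdivrMr// mul1r => /(_ ltac:(lra)) H.
have := ler_wpM2l (t0 i) (fy i); have := ler_wpM2l (ltW ti1) H.
lra.
Qed.

(* A point of the ball of radius r lies in the cross-polytope with vertices
   [+- (n r + 1) e_j], on which a convex function is controlled. *)
Lemma real_convex_family_bounded (I : Type) (f : I -> Rn -> R) :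
  (forall i, real_convex (f i)) ->
  (forall x, exists B, forall i, `|f i x| <= B) ->
  forall r, exists2 B, 0 <= B & forall i x, enorm x <= r -> `|f i x| <= B.
Proof.
move=> cf /choice[b fb] r.
pose M : R := n%:R * `|r| + 1.
have M0 : 0 < M by rewrite ltr_wpDl// mulr_ge0.
pose B := `|b 0| + \sum_(j < n)
  (`|b (M *: delta_mx 0 j)| + `|b (- M *: delta_mx 0 j)|).
have bB j : `|b (M *: delta_mx 0 j)| + `|b (- M *: delta_mx 0 j)| <= B.
  rewrite /B (bigD1 j)//=.
  have := normr_ge0 (b 0).
  have : 0 <= \sum_(i < n | i != j)
    (`|b (M *: delta_mx 0 i)| + `|b (- M *: delta_mx 0 i)|).
    by apply: sumr_ge0 => i _; rewrite addr_ge0.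
  lra.
have b0B : `|b 0| <= B.
  by rewrite /B lerDl; apply: sumr_ge0 => i _; rewrite addr_ge0.
have up i x : enorm x <= r -> f i x <= B.
  move=> xr.
  (* The sign goes into the vertex, so the weights are nonnegative; [M > n |r|] makes their sum less
     than 1. *)
  have -> : x = \sum_j (`|x 0 j| / M) *: ((Num.sg (x 0 j) * M) *: delta_mx 0 j).
    rewrite {1}(row_sum_delta x); apply: eq_bigr => j _.
    rewrite scalerA; congr (_ *: _).
    by rewrite {1}[x 0 j]numEsg; field; rewrite gt_eqF.
  apply: real_convex_sublevel => //.
  - by rewrite (le_trans (ler_norm _))// (le_trans (fb _ _))// (le_trans (ler_norm _)).
  - move=> j; case: sgrP => _.
    + rewrite mul0r scale0r.
      by rewrite (le_trans (ler_norm _))// (le_trans (fb _ _))// (le_trans (ler_norm _)).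
    + rewrite mul1r.
      have := ler_norm (f i (M *: delta_mx 0 j)); have := fb (M *: delta_mx 0 j) i.
      have := ler_norm (b (M *: delta_mx 0 j)).
      have := normr_ge0 (b (- M *: delta_mx 0 j)); have := bB j; lra.
    + rewrite mulN1r.
      have := ler_norm (f i (- M *: delta_mx 0 j)); have := fb (- M *: delta_mx 0 j) i.
      have := ler_norm (b (- M *: delta_mx 0 j)).
      have := normr_ge0 (b (M *: delta_mx 0 j)); have := bB j; lra.
  - by move=> j; rewrite divr_ge0// ltW.
  - rewrite -mulr_suml ltr_pdivrMr// mul1r /M.
    have : \sum_(j < n) `|x 0 j| <= \sum_(j < n) `|r|.
      apply: ler_sum => j _; apply: le_trans (enorm_coord _ _) _.
      exact: le_trans xr (ler_norm _).
    rewrite sumr_const card_ord mulr_natl; lra.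
(* The lower bound comes from the midpoint 0 of [x] and [- x]: [f x >= 2 f 0 - f (- x)]. *)
exists (2 * B + B).
  by rewrite addr_ge0 ?mulr_ge0// (le_trans _ b0B).
move=> i x xr; rewrite ler_norml.
have B0 : 0 <= B by rewrite (le_trans _ b0B).
have := up i x xr; have := up i (- x); rewrite enormN => /(_ xr).
have h2 : 0 <= (1 / 2 : R) <= 1 by lra.
have := cf i x (- x) (1 / 2) h2.
have -> : 1 - 1 / 2 = 1 / 2 :> R by lra.
rewrite scalerN subrr => H1 H2 H3.
have := fb 0 i; rewrite ler_norml => /andP[H4 _].
have H5 := ler_norm (b 0).
by apply/andP; split; lra.
Qed.

(** The segment from [x] to [y] is prolonged by the length [r] to a point [z] of the doubled ball.
    Then [y] is the convex combination of [z] and [x] with weight [d / (r + d) <= d / r] on [z], and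
    the increment of [f] from [x] to [z] is at most [2 B]. *)
Lemma real_convex_lipschitz f (r B : R) : real_convex f -> 0 < r ->
  (forall x, enorm x <= 2 * r -> `|f x| <= B) ->
  forall x y, enorm x <= r -> enorm y <= r ->
    `|f x - f y| <= 2 * B / r * enorm (x - y).
Proof.
move=> cf r0 fB.
suff H x y : enorm x <= r -> enorm y <= r ->
    f y - f x <= 2 * B / r * enorm (x - y).
  move=> x y xr yr; rewrite ler_norml; apply/andP; split.
    by rewrite lerNl opprB H.
  by rewrite enormB H.
move=> xr yr; set d := enorm (x - y).
have B0 : 0 <= B by apply: le_trans (normr_ge0 _) (fB x _); lra.
have [d0|dn0] := eqVneq d 0.
  have := enorm_eq0 d0; move/eqP; rewrite subr_eq0 => /eqP ->.
  by rewrite subrr d0 mulr0.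
have d0 : 0 < d by rewrite lt_neqAle eq_sym dn0 enorm_ge0.
pose z := y + (r / d) *: (y - x).
have zr : enorm z <= 2 * r.
  apply: le_trans (enormD _ _) _; rewrite enormZ enormB -/d ger0_norm; last first.
    by rewrite divr_ge0// ltW.
  by rewrite divfK// mulrDl mul1r lerD.
have rd0 : 0 < r + d by lra.
pose l := d / (r + d).
have l01 : 0 <= l <= 1.
  by rewrite /l divr_ge0 ?(ltW d0) ?(ltW rd0)//= ler_pdivrMr// mul1r; lra.
have yE : y = l *: z + (1 - l) *: x.
  apply/rowP => j; rewrite !mxE /l; field.
  by rewrite dn0 gt_eqF.
have fy := cf z x l l01; rewrite -yE in fy.
have := fB _ zr; rewrite ler_norml => /andP[_ fz].
have := fB x ltac:(lra); rewrite ler_norml => /andP[fx _].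
have h1 : f y - f x <= l * (2 * B).
  have := ler_wpM2l (_ : 0 <= l) (_ : f z - f x <= 2 * B); move/(_ ltac:(lra) ltac:(lra)); lra.
apply: le_trans h1 _.
rewrite /l mulrC -[leRHS]mulrA ler_wpM2l ?mulr_ge0//.
rewrite mulrC ler_wpM2r ?(ltW d0)// lef_pV2 ?posrE//; lra.
Qed.

Lemma real_convex_family_lipschitz (I : Type) (f : I -> Rn -> R) :
  (forall i, real_convex (f i)) ->
  (forall x, exists B, forall i, `|f i x| <= B) ->
  forall r, exists2 M, 0 <= M & forall i x y, enorm x <= r -> enorm y <= r ->
    `|f i x - f i y| <= M * enorm (x - y).
Proof.
move=> cf fb r.
pose r' := `|r| + 1; have r'0 : 0 < r' by rewrite ltr_wpDl.
have rr' : r <= r' by rewrite /r'; have := ler_norm r; lra.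
have [B B0 fB] := real_convex_family_bounded cf fb (2 * r').
exists (2 * B / r'); first by rewrite divr_ge0 ?mulr_ge0// ltW.
move=> i x y xr yr; apply: real_convex_lipschitz => //; last 2 first.
- exact: le_trans xr rr'.
- exact: le_trans yr rr'.
by move=> z; exact: fB.
Qed.

Lemma locally_lipschitz_continuous f :
  (forall r, exists2 M, 0 <= M & forall x y, enorm x <= r -> enorm y <= r ->
    `|f x - f y| <= M * enorm (x - y)) -> continuous f.
Proof.
move=> lf x; apply: (@cvgrPdist_le _ _ _ (nbhs x) (nbhs_filter x) f (f x)).2 => e e0.
have [M M0 fM] := lf (enorm x + n%:R).
have k0 : 0 < M * n%:R + 1 by rewrite ltr_wpDl// mulr_ge0.
have m0 : 0 < Num.min 1 (e / (M * n%:R + 1)).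
  by rewrite lt_min ltr01/= divr_gt0.
have := nbhsx_ballx x _ m0; apply: filterS => y.
rewrite -ball_normE/= => /ltW xy.
have xy1 : `|x - y| <= 1 by rewrite (le_trans xy)// ge_min lexx.
have xy2 : `|x - y| <= e / (M * n%:R + 1) by rewrite (le_trans xy)// ge_min lexx orbT.
have n0 : 0 <= n%:R :> R by [].
have xyn := enorm_le_norm (x - y).
have := fM x y; have yE : enorm y <= enorm x + n%:R.
  rewrite -[y](subrK x) addrC (le_trans (enormD _ _))// lerD2l enormB.
  by rewrite (le_trans xyn)// ler_piMr.
move=> /(_ _ yE) H; apply: le_trans (H _) _; first by rewrite lerDl.
apply: le_trans (ler_wpM2l M0 xyn) _.
move: xy2; rewrite ler_pdivlMr// => xy2.
rewrite mulrA (le_trans _ xy2)// mulrC ler_wpM2l//; lra.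
Qed.

Lemma real_convex_continuous f : real_convex f -> continuous f.
Proof.
move=> cf; apply: locally_lipschitz_continuous => r.
have [//|x|M M0 fM] := @real_convex_family_lipschitz unit (fun=> f) _ _ r.
  by exists `|f x|.
by exists M => // x y; exact: (fM tt).
Qed.

End real_convex.

(** * Conditioning on the past and measurability *)

Section freezing.
Context {R : realType} {d : measure_display} {Omega : measurableType d}.
Context {d' : measure_display} {T : measurableType d'}.
Variables (P : probability Omega R) (Pr : probability T R).
Variables (G : set (set T)) (sigma : T -> Omega).
Hypothesis sG : sigma_algebra [set: T] G.
Hypothesis Gm : G `<=` measurable.
Hypothesis msigma : measurable_fun [set: T] sigma.
Hypothesis law : forall B, measurable B -> Pr (sigma @^-1` B) = P B.
Hypothesis ind : forall A B, G A -> measurable B ->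
  Pr (A `&` sigma @^-1` B) = (Pr A * Pr (sigma @^-1` B))%E.

Local Notation TG := (g_sigma_algebraType G).

Let measurableTG : (measurable : set (set TG)) = G.
Proof. exact: sigma_algebra_id sG. Qed.

Let idG : T -> TG := id.

Let measurable_idG : measurable_fun [set: T] idG.
Proof. by move=> _ B; rewrite measurableTG setTI => /Gm. Qed.

Let pairG : T -> TG * Omega := fun w => (w, sigma w).

Let measurable_pairG : measurable_fun [set: T] pairG.
Proof. exact/measurable_fun_pair. Qed.

HB.instance Definition _ := isMeasurableFun.Build _ _ _ _ idG measurable_idG.
HB.instance Definition _ := isMeasurableFun.Build _ _ _ _ pairG measurable_pairG.

(** Independence on rectangles identifies the joint law of the identity into [G] and of [sigma] with
    a product measure, after which Tonelli integrates the draw first. Measurability of [phi] is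
    asked with respect to [G] in the first component: this encodes dependence on the past only. *)
Lemma freezing (phi : TG * Omega -> \bar R) :
  measurable_fun [set: TG * Omega] phi -> (forall p, 0 <= phi p)%E ->
  (\int[Pr]_w phi (w, sigma w) = \int[Pr]_w \int[P]_t phi (w, t))%E.
Proof.
move=> mphi phi0.
pose m1 : probability TG R := distribution Pr idG.
pose m' := distribution Pr pairG.
have E : forall X : set (TG * Omega), measurable X -> (m1 \x P)%E X = m' X.
  apply: product_measure_unique => A B mA mB.
  rewrite /m' /m1 /distribution /pushforward/= -law// -ind//.
  by rewrite measurableTG in mA.
transitivity (\int[m']_p phi p)%E.
  by rewrite ge0_integral_pushforward.
transitivity (\int[(m1 \x P)%E]_p phi p)%E.
  by apply: eq_measure_integral => X mX _; apply/esym/E.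
rewrite fubini_tonelli1// ge0_integral_pushforward//.
  exact: measurable_fun_fubini_tonelli_F.
by move=> w _; exact: integral_ge0.
Qed.

End freezing.

Section caratheodory.
Context {R : realType} {n : nat}.
Context {d0 : measure_display} {W : measurableType d0}.
Context {d : measure_display} {Omega : measurableType d}.
Local Notation Rn := 'rV[R]_n.

Let grid (q : 'rV[int]_n) (k : nat) : Rn := \row_j ((q 0 j)%:~R / k.+1%:R).

Let grid_floor (x : Rn) (k : nat) : 'rV[int]_n :=
  \row_j Num.floor (k.+1%:R * x 0 j).

Let grid_dist (x : Rn) k : `|x - grid (grid_floor x k) k| <= k.+1%:R^-1.
Proof.
rewrite [leLHS]mx_normrE; apply: bigmax_le => [|[i j] _ /=].
  by rewrite invr_ge0.
rewrite !mxE ord1; set y := x 0 j; set c : R := k.+1%:R.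
have c0 : 0 < c by rewrite /c.
have /andP[f1 f2] := real_floor_itv (num_real (c * y)).
rewrite intrD in f2.
have -> : y - (Num.floor (c * y))%:~R / c = (c * y - (Num.floor (c * y))%:~R) / c.
  by field; rewrite gt_eqF.
rewrite ger0_norm ?divr_ge0 ?(ltW c0) ?subr_ge0//.
rewrite ler_pdivrMr// mulVf ?gt_eqF//; lra.
Qed.

(** Rounding [xi] down to the grid of mesh [1 / (k + 1)] leaves countably many values, and for each
    of them only one section of [psi] is involved. Continuity in the first variable gives the limit,
    so joint measurability is a conclusion rather than an assumption. *)
Lemma caratheodory_measurable (psi : Rn -> Omega -> R) (xi : W -> Rn) :
  (forall t, continuous (psi ^~ t)) ->
  (forall x, measurable_fun [set: Omega] (psi x)) ->
  (forall j, measurable_fun [set: W] (fun w => xi w 0 j)) ->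
  measurable_fun [set: W * Omega] (fun p => psi (xi p.1) p.2).
Proof.
move=> cpsi mpsi mxi.
pose h k (p : W * Omega) := psi (grid (grid_floor (xi p.1) k) k) p.2.
apply: (@measurable_fun_cvg _ _ _ _ h) => [k|[w t] _].
- move=> _ B mB; rewrite setTI.
  have -> : h k @^-1` B = \bigcup_(q : 'rV[int]_n)
     ([set w | grid_floor (xi w) k = q] `*` (psi (grid q k) @^-1` B)).
    apply/seteqP; split => [[w t] /= hB|[w t] [q _ /= [<-]]]//.
    by exists (grid_floor (xi w) k).
  apply: countable_bigcupT_measurable => [|q]; first exact: countableP.
  apply: measurableX; last by rewrite -[X in measurable X]setTI; exact: mpsi.
  have -> : [set w | grid_floor (xi w) k = q] = \bigcap_(j in [set: 'I_n])
      ((fun w => k.+1%:R * xi w 0 j) @^-1`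
         `[(q 0 j)%:~R, (q 0 j + 1)%:~R[%classic).
    apply/seteqP; split => [w /= <- j _|w /= H].
      by rewrite mxE /= in_itv/= real_floor_itv// num_real.
    apply/rowP => j; rewrite mxE; apply/floor_def.
    by have := H j Logic.I; rewrite /= in_itv/=.
  apply: fin_bigcap_measurable => // j _.
  have mf : measurable_fun [set: W] (fun w => k.+1%:R * xi w 0 j).
    exact: measurable_funM.
  by rewrite -[X in measurable X]setTI; apply: mf.
- apply: (@cvg_comp _ _ _ (fun k => grid (grid_floor (xi w) k) k) (psi ^~ t)).
    2: exact: (cpsi t (xi w)).
  apply/cvgrPdist_le => e e0; near=> k.
  apply: le_trans (grid_dist _ _) _; apply: ltW.
  by near: k; exact: near_infty_natSinv_lt (PosNum e0).
Unshelve. all: by end_near. Qed.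

End caratheodory.

Section bounded_mean.
Context {R : realType} {d : measure_display} {Omega : measurableType d}.
Variable P : probability Omega R.
Implicit Types (f : Omega -> R) (B : R).

Lemma bounded_integrable f B : measurable_fun [set: Omega] f ->
  (forall t, `|f t| <= B) -> P.-integrable setT (EFin \o f).
Proof.
move=> mf fB; apply: measurable_bounded_integrable => //.
  by rewrite ltey_eq fin_num_measure.
exists B; split; first exact: num_real.
by move=> y By t _; rewrite /= (le_trans (fB t))// ltW.
Qed.

Definition mean f : R := fine (\int[P]_t (f t)%:E)%E.

Lemma mean_funE (n : nat) (g : 'rV[R]_n -> Omega -> R) p :
  mean_fun P g p = mean (g p).
Proof. by rewrite /mean_fun /mean expectation.unlock. Qed.

Lemma meanE f : P.-integrable setT (EFin \o f) ->
  (\int[P]_t (f t)%:E)%E = (mean f)%:E.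
Proof. by move=> If; rewrite /mean fineK//; exact: integrable_fin_num. Qed.

Lemma meanB f g : P.-integrable setT (EFin \o f) ->
  P.-integrable setT (EFin \o g) -> mean (fun t => f t - g t) = mean f - mean g.
Proof.
move=> If Ig; rewrite /mean.
under eq_integral do rewrite EFinB.
by rewrite integralB_EFin// (meanE If) (meanE Ig).
Qed.

Lemma mean_cst B : mean (fun=> B) = B.
Proof. by rewrite /mean integral_cst//= probability_setT mule1. Qed.

Lemma le_mean f g : P.-integrable setT (EFin \o f) ->
  P.-integrable setT (EFin \o g) -> (forall t, f t <= g t) -> mean f <= mean g.
Proof.
move=> If Ig fg; rewrite -lee_fin -!meanE//; apply: le_integral => //.
by move=> t _; rewrite lee_fin.
Qed.

Lemma integrable_cst B : P.-integrable setT (EFin \o (fun=> B) : Omega -> \bar R).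
Proof. exact: (@bounded_integrable _ `|B|). Qed.

Lemma mean_abs_le f B : P.-integrable setT (EFin \o f) ->
  (forall t, `|f t| <= B) -> `|mean f| <= B.
Proof.
move=> If fB; rewrite ler_norml -{2}(mean_cst B) -{1}(mean_cst (- B)).
by rewrite !le_mean ?integrable_cst//;
  move=> t; have := fB t; rewrite ler_norml => /andP[].
Qed.

Lemma mean_sumM (I : Type) (r : seq I) (c : I -> R) (f : I -> Omega -> R) :
  (forall i, P.-integrable setT (EFin \o f i)) ->
  P.-integrable setT (EFin \o (fun t => \sum_(i <- r) c i * f i t)) /\
  mean (fun t => \sum_(i <- r) c i * f i t) = \sum_(i <- r) c i * mean (f i).
Proof.
move=> If.
have E : EFin \o (fun t => \sum_(i <- r) c i * f i t) =
    (fun t => \sum_(i <- r) ((c i)%:E * (f i t)%:E))%E.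
  by apply/funext => t /=; rewrite -sumEFin; apply: eq_bigr => i _; rewrite EFinM.
have Ic i : P.-integrable setT (fun t => (c i)%:E * (f i t)%:E)%E.
  exact: (integrableZl measurableT (c i) (If i)).
split; first by rewrite E; exact: integrable_sum.
rewrite /mean -[X in integral _ _ X]/(EFin \o (fun t => _)) E integral_sum//.
rewrite (eq_bigr (fun i => (c i * mean (f i))%:E)) ?sumEFin// => i _; rewrite EFinM.
by rewrite (integralZl measurableT (If i)) -(meanE (If i)).
Qed.

End bounded_mean.

(** * A uniform law of large numbers *)

Section weights.
Context {R : realType}.
Variable alpha : nat -> R.
Hypothesis alpha_gt0 : forall k, 0 < alpha k.

Lemma weight_sum_gt0 k : 0 < weight_sum alpha k.
Proof.
by rewrite /weight_sum big_ord_recl ltr_pwDl// sumr_ge0// => i _; rewrite ltW.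
Qed.

Lemma sq_weight_sum_gt0 k : 0 < sq_weight_sum alpha k.
Proof.
rewrite /sq_weight_sum big_ord_recl ltr_pwDl ?exprn_gt0//.
by rewrite sumr_ge0// => i _; rewrite sqr_ge0.
Qed.

Lemma weight_sumS k :
  weight_sum alpha k.+1 = weight_sum alpha k + alpha k.+1.
Proof. by rewrite /weight_sum big_ord_recr. Qed.

Lemma sq_weight_sum_le k : sq_weight_sum alpha k <= weight_sum alpha k ^+ 2.
Proof.
elim: k => [|k IH]; first by rewrite /sq_weight_sum /weight_sum !big_ord1.
rewrite weight_sumS /sq_weight_sum big_ord_recr /= -/(sq_weight_sum alpha k).
have := ltW (weight_sum_gt0 k); have := ltW (alpha_gt0 k.+1) => a0 w0.
by have := mulr_ge0 a0 w0; rewrite sqrrD; lra.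
Qed.

Lemma beta_sqr k :
  (beta alpha k) ^- 2 = sq_weight_sum alpha k / weight_sum alpha k ^+ 2.
Proof.
rewrite /beta expr_div_n sqr_sqrtr ?(ltW (sq_weight_sum_gt0 k))//.
by rewrite invf_div.
Qed.

Lemma beta_ge1 k : 1 <= beta alpha k.
Proof.
rewrite /beta ler_pdivlMr ?sqrtr_gt0 ?sq_weight_sum_gt0// mul1r.
rewrite -(ger0_norm (ltW (weight_sum_gt0 k))) -sqrtr_sqr ler_sqrt ?sqr_ge0//.
exact: sq_weight_sum_le.
Qed.

(** Multiplied by [alpha k.+1 / weight_sum alpha k.+1], this is the term of index [k.+1] of the
    series assumed to converge. *)
Definition rate k := (1 + Num.sqrt (ln (beta alpha k))) / beta alpha k.

Lemma wmean_sum (V : lmodType R) (v : nat -> V) k :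
  wmean alpha v k = \sum_(i < k.+1) (alpha i / weight_sum alpha k) *: v i.
Proof.
by rewrite /wmean scaler_sumr; apply: eq_bigr => i _; rewrite scalerA mulrC.
Qed.

Lemma wmean_weights_sum k : \sum_(i < k.+1) alpha i / weight_sum alpha k = 1.
Proof. by rewrite -mulr_suml divff// gt_eqF// weight_sum_gt0. Qed.

Lemma wmean_weight_ge0 k i : 0 <= alpha i / weight_sum alpha k.
Proof. by rewrite divr_ge0 ?ltW// weight_sum_gt0. Qed.

Lemma wmean_cst (V : lmodType R) (v : V) k : wmean alpha (fun=> v) k = v.
Proof. by rewrite wmean_sum -scaler_suml wmean_weights_sum scale1r. Qed.

Lemma ler_wmean (v v' : nat -> R^o) k :
  (forall i, v i <= v' i) -> wmean alpha v k <= wmean alpha v' k.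
Proof.
move=> vv'; rewrite !wmean_sum; apply: ler_sum => i _.
exact: ler_wpM2l (wmean_weight_ge0 _ _) _ _ (vv' _).
Qed.

Lemma wmeanB (V : lmodType R) (v v' : nat -> V) k :
  wmean alpha (fun i => v i - v' i) k = wmean alpha v k - wmean alpha v' k.
Proof.
rewrite !wmean_sum -sumrB; apply: eq_bigr => i _.
by rewrite scalerBr.
Qed.

Lemma wmeanD (V : lmodType R) (v v' : nat -> V) k :
  wmean alpha (fun i => v i + v' i) k = wmean alpha v k + wmean alpha v' k.
Proof.
rewrite !wmean_sum -big_split; apply: eq_bigr => i _.
by rewrite scalerDr.
Qed.

Lemma wmeanZ (V : lmodType R) (c : R) (v : nat -> V) k :
  wmean alpha (fun i => c *: v i) k = c *: wmean alpha v k.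
Proof.
rewrite !wmean_sum scaler_sumr; apply: eq_bigr => i _.
by rewrite !scalerA mulrC.
Qed.

Lemma norm_wmean_le (v v' : nat -> R^o) k : (forall i, `|v i| <= v' i) ->
  `|wmean alpha v k| <= wmean alpha v' k.
Proof.
move=> vv'; rewrite !wmean_sum; apply: le_trans (ler_norm_sum _ _ _) _.
apply: ler_sum => i _; rewrite normrM ger0_norm ?wmean_weight_ge0//.
exact: ler_wpM2l (wmean_weight_ge0 _ _) _ _ (vv' _).
Qed.

Lemma wmeanS (v : nat -> R^o) k :
  weight_sum alpha k.+1 * wmean alpha v k.+1 =
  weight_sum alpha k * wmean alpha v k + alpha k.+1 * v k.+1.
Proof.
rewrite /wmean /GRing.scale/= !mulrA !divff ?mul1r ?gt_eqF ?weight_sum_gt0//.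
by rewrite big_ord_recr.
Qed.

End weights.

(** * Hoeffding's estimate for weighted means of independent draws *)

Section exponential_moments.
Context {R : realType} {d : measure_display} {Omega : measurableType d}.
Context {d' : measure_display} {T : measurableType d'}.
Variables (P : probability Omega R) (Pr : probability T R).
Variables (s : nat -> T -> Omega) (F : nat -> set (set T)).
Hypothesis Hs : iid_draws P Pr s.
Hypothesis HF : history Pr s F.

Lemma history_le i k : (i <= k)%N -> F i `<=` F k.
Proof.
elim: k => [|k IH]; first by rewrite leqn0 => /eqP ->.
rewrite leq_eqVlt ltnS => /predU1P[->//|/IH].
by move=> H; apply: subset_trans H _; exact: history_mono HF k.
Qed.

Lemma history_measurableE k :
  (measurable : set (set (g_sigma_algebraType (F k)))) = F k.
Proof. exact: sigma_algebra_id (history_sigma_algebra HF k). Qed.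

Lemma draw_measurable i k : (i < k)%N ->
  measurable_fun [set: g_sigma_algebraType (F k)] (s i).
Proof.
move=> ik _ B mB; rewrite setTI history_measurableE.
exact: (history_le ik (history_draw HF i mB)).
Qed.

Lemma history_measurable_fun k d0 (U : measurableType d0) (f : T -> U) :
  measurable_fun [set: g_sigma_algebraType (F k)] f ->
  measurable_fun [set: T] f.
Proof.
move=> mf _ B mB; have := mf measurableT B mB.
by rewrite history_measurableE => /(history_measurable HF).
Qed.

Lemma freezing_draw k (phi : g_sigma_algebraType (F k) * Omega -> \bar R) :
  measurable_fun [set: _] phi -> (forall p, 0 <= phi p)%E ->
  (\int[Pr]_w phi (w, s k w) = \int[Pr]_w \int[P]_t phi (w, t))%E.
Proof.
apply: freezing; [exact: history_sigma_algebra HF k|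
  exact: history_measurable HF k|exact: draws_measurable Hs k|
  exact: draws_law Hs k|exact: history_independent HF k].
Qed.

(** The first [k] factors are measurable for the history [F k], so the last draw can be frozen and
    integrated separately at each step of the induction. *)
Lemma integral_prod_draws (f : nat -> Omega -> R) k :
  (forall i, measurable_fun [set: Omega] (f i)) -> (forall i t, 0 <= f i t) ->
  (\int[Pr]_w (\prod_(i < k) f i (s i w))%:E =
   \prod_(i < k) \int[P]_t (f i t)%:E)%E.
Proof.
move=> mf f0; elim: k => [|k IH].
  rewrite big_ord0; under eq_integral do rewrite big_ord0.
  by rewrite integral_cst//= probability_setT mule1.
rewrite big_ord_recr /= -IH.
have mprod : measurable_fun [set: g_sigma_algebraType (F k)]
    (fun w => \prod_(i < k) f i (s i w)).
  apply: measurable_prod => i _.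
  by apply: (@measurableT_comp _ _ _ _ _ _ (f i)) => //; exact: draw_measurable.
have prod0 w : 0 <= \prod_(i < k) f i (s i w) by apply: prodr_ge0.
pose phi (p : g_sigma_algebraType (F k) * Omega) : \bar R :=
  (\prod_(i < k) f i (s i p.1) * f k p.2)%:E.
transitivity (\int[Pr]_w phi (w, s k w))%E.
  by apply: eq_integral => w _; rewrite /phi big_ord_recr.
rewrite freezing_draw; last 2 first.
- apply/measurable_EFinP; apply: measurable_funM.
    exact: (@measurableT_comp _ _ _ _ _ _ _ _ fst mprod).
  exact: measurableT_comp.
- by move=> p; rewrite lee_fin mulr_ge0.
rewrite -ge0_integralZr//.
- apply: eq_integral => w _; rewrite /phi /=.
  under eq_integral do rewrite EFinM.
  by rewrite ge0_integralZl ?lee_fin// => [|t _];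
    [exact/measurable_EFinP|rewrite lee_fin].
- by apply/measurable_EFinP; exact: history_measurable_fun mprod.
- by move=> w _; rewrite lee_fin.
- by apply: integral_ge0 => t _; rewrite lee_fin.
Qed.

(** The linear term disappears under expectation of a centred variable, which leaves a Gaussian
    bound. For [y <= 1/2] one has [exp y <= 1 / (1 - y) <= 1 + y + 2 y ^ 2]; for larger [y] already
    [y <= 2 y ^ 2]. *)
Lemma expR_le_D_expR_sqr (y : R) : expR y <= y + expR (2 * y ^+ 2).
Proof.
have H2 := expR_ge1Dx (2 * y ^+ 2).
have [y12|y12] := leP y (1 / 2); last first.
  have yy : y <= 2 * y ^+ 2.
    by rewrite expr2; have := mulr_gt0 (_ : 0 < y) (_ : 0 < y - 1 / 2);
    move=> /(_ ltac:(lra) ltac:(lra)); lra.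
  have : expR y <= expR (2 * y ^+ 2) by rewrite ler_expR.
  lra.
have y1 : 0 < 1 - y by lra.
have e1 : expR y <= (1 - y)^-1.
  rewrite -[leLHS]invrK -expRN lef_pV2 ?posrE ?expR_gt0//.
  by have := expR_ge1Dx (- y); lra.
apply: le_trans e1 _; rewrite -[leLHS]mul1r ler_pdivrMr//.
have : (1 + y + 2 * y ^+ 2) * (1 - y) <= (y + expR (2 * y ^+ 2)) * (1 - y).
  by rewrite ler_wpM2r ?(ltW y1)//; lra.
suff : 0 <= y ^+ 2 * (1 - 2 * y) by lra.
by rewrite mulr_ge0 ?sqr_ge0//; lra.
Qed.

Lemma hoeffding (Y : Omega -> R) (B c : R) : measurable_fun [set: Omega] Y ->
  (forall t, `|Y t| <= B) -> mean P Y = 0 ->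
  (\int[P]_t (expR (c * Y t))%:E <= (expR (2 * c ^+ 2 * B ^+ 2))%:E)%E.
Proof.
move=> mY YB Y0.
have cY t : `|c * Y t| <= `|c| * B by rewrite normrM ler_wpM2l.
have mcY : measurable_fun [set: Omega] (fun t => c * Y t) by exact: measurable_funM.
pose e := expR (2 * c ^+ 2 * B ^+ 2).
have Ie : P.-integrable setT (EFin \o (fun t => expR (c * Y t))).
  apply: (@bounded_integrable _ _ _ _ _ (expR (`|c| * B))).
    exact: measurableT_comp.
  move=> t; rewrite ger0_norm ?expR_ge0// ler_expR.
  exact: le_trans (ler_norm _) (cY t).
have Ic : P.-integrable setT (EFin \o (fun t => c * Y t)) by exact: bounded_integrable.
have ID : P.-integrable setT (EFin \o (fun t => c * Y t - (- e))).
  have -> : (EFin \o (fun t => c * Y t - (- e)))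
    = ((EFin \o (fun t => c * Y t)%R) \- (EFin \o (fun=> - e)%R))%E.
    by apply/funext => t /=; rewrite EFinB.
  by apply: integrableB => //; exact: integrable_cst.
rewrite meanE// lee_fin.
apply: le_trans (le_mean Ie ID _) _ => [t|].
  apply: le_trans (expR_le_D_expR_sqr _) _; rewrite opprK lerD2l ler_expR.
  rewrite -mulrA ler_wpM2l// exprMn ler_wpM2l ?sqr_ge0//.
  by rewrite -real_normK ?num_real// ler_sqr ?nnegrE// (le_trans _ (YB t)).
rewrite meanB//; last exact: integrable_cst.
rewrite mean_cst.
have [_ H] := @mean_sumM _ _ _ P _ [:: tt] (fun=> c) (fun=> Y)
  (fun=> bounded_integrable P mY YB).
have -> : mean P (fun t => c * Y t) = 0.
  rewrite -[RHS](mulr0 c) -Y0.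
  by move: H; rewrite big_seq1 => <-; congr mean; apply/funext => t; rewrite big_seq1.
by rewrite /e; lra.
Qed.

(** Here [beta] enters: the exponents of the factors add up through the sum of
    [(alpha_i / A_k) ^ 2], which is [beta_k ^ -2]. *)
Lemma hoeffding_wmean (alpha : nat -> R) (Y : Omega -> R) (B l : R) k :
  (forall i, 0 < alpha i) ->
  measurable_fun [set: Omega] Y -> (forall t, `|Y t| <= B) -> mean P Y = 0 ->
  (\int[Pr]_w (expR (l * wmean alpha (fun i => Y (s i w) : R^o) k))%:E
    <= (expR (2 * (l / beta alpha k) ^+ 2 * B ^+ 2))%:E)%E.
Proof.
move=> a0 mY YB Y0.
pose c i := l * (alpha i / weight_sum alpha k).
pose f i t := expR (c i * Y t).
rewrite (eq_integral (fun w => (\prod_(i < k.+1) f i (s i w))%:E)); last first.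
  move=> w _; rewrite wmean_sum mulr_sumr expR_sum; congr EFin.
  by apply: eq_bigr => i _; rewrite /f /c -mulrA.
rewrite integral_prod_draws//.
- apply: (@le_trans _ _ (\prod_(i < k.+1) (expR (2 * c i ^+ 2 * B ^+ 2))%:E)%E).
    have f0 i : (0 <= \int[P]_t (f i t)%:E)%E.
      by apply: integral_ge0 => t _; rewrite lee_fin expR_ge0.
    (* Nonnegativity is carried along because products in [\bar R] are monotone on nonnegative
       factors only. *)
    suff : (0 <= \prod_(i < k.+1) \int[P]_t (f i t)%:E)%E /\
      (\prod_(i < k.+1) \int[P]_t (f i t)%:E <=
       \prod_(i < k.+1) (expR (2 * c i ^+ 2 * B ^+ 2))%:E)%E by case.
    elim/big_ind2 : _ => // [x1 x2 y1 y2 [x0 x12] [y0 y12]|i _].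
      by split; [exact: mule_ge0|exact: lee_pmul].
    by split => //; exact: hoeffding.
  rewrite prodEFin -expR_sum lee_fin ler_expR.
  rewrite -mulr_suml -mulr_sumr ler_wpM2r ?sqr_ge0// ler_wpM2l//.
  rewrite exprMn exprVn beta_sqr// /sq_weight_sum mulr_suml mulr_sumr.
  by apply: ler_sum => i _; rewrite /c exprMn expr_div_n.
- by move=> i; apply: measurableT_comp => //; exact: measurable_funM.
- by move=> i t; exact: expR_ge0.
Qed.

End exponential_moments.

Section net.
Context {R : realType} {n : nat}.
Local Notation Rn := 'rV[R]_n.

(** A cube is cut into [q ^ n] cells. The net has to lie in [C], where alone the integrand is
    controlled: each cell met by [C] contributes one of its points in [C], the other cells an
    arbitrary one. Replacing [r] by [r + 1] keeps the mesh positive and the cell numbers strictly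
    below [q]. *)
Lemma finite_net (C : set Rn) (r : R) (q : nat) : C !=set0 -> 0 <= r ->
  (forall x, C x -> enorm x <= r) -> (0 < q)%N ->
  exists p : {ffun 'I_n -> 'I_q} -> Rn, (forall c, C (p c)) /\
    forall x, C x -> exists c, enorm (x - p c) <= n%:R * (2 * (r + 1) / q%:R).
Proof.
case: q => // q [x0 Cx0] r0 Cr _.
pose r' := r + 1; have r'0 : 0 < r' by rewrite /r'; lra.
have q0 : 0 < q.+1%:R :> R by [].
pose cell (x : Rn) j : R := (x 0 j + r) * q.+1%:R / (2 * r').
have cell0 x j : C x -> 0 <= cell x j.
  move=> /Cr xr; have := le_trans (enorm_coord x j) xr; rewrite ler_norml => /andP[h _].
  by rewrite /cell divr_ge0 ?mulr_ge0// ?(ltW r'0)//; lra.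
have cellq x j : C x -> cell x j < q.+1%:R.
  move=> /Cr xr; have := le_trans (enorm_coord x j) xr; rewrite ler_norml => /andP[_ h].
  rewrite /cell ltr_pdivrMr; last by rewrite mulr_gt0.
  by rewrite mulrC ltr_pM2l// /r'; lra.
pose code (x : Rn) : {ffun 'I_n -> 'I_q.+1} := [ffun j => inord (Num.truncn (cell x j))].
have /choice[p pP] : forall c, exists y, C y /\ forall x, C x -> code x = c -> code y = c.
  move=> c; have [[y [Cy yc]]|nc] := pselect (exists y, C y /\ code y = c).
    by exists y.
  by exists x0; split => // x Cx xc; exfalso; apply: nc; exists x.
exists p; split => [c|x Cx]; first by have [] := pP c.
exists (code x); have [Cy /(_ x Cx erefl)] := pP (code x); set y := p _ in Cy *.
move=> /ffunP yx; apply: le_trans (enorm_le_sum _) _.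
apply: (@le_trans _ _ (\sum_(j < n) (2 * r' / q.+1%:R))); last first.
  by rewrite sumr_const card_ord [leRHS]mulr_natl.
apply: ler_sum => j _; rewrite !mxE.
have := yx j; rewrite !ffunE => /(congr1 val).
have tq v : C v -> (Num.truncn (cell v j) < q.+1)%N.
  move=> Cv; rewrite -(ltr_nat R); apply: le_lt_trans (cellq v j Cv).
  by have /andP[] := truncn_itv (cell0 v j Cv).
rewrite /= !inordK ?tq// => E.
have /andP[y1 y2] := truncn_itv (cell0 y j Cy).
have /andP[x1 x2] := truncn_itv (cell0 x j Cx).
rewrite E -natr1 in y1 y2; rewrite -natr1 in x2.
have H : `|cell x j - cell y j| <= 1 by rewrite ler_norml; apply/andP; split; lra.
have -> : x 0 j - y 0 j = (cell x j - cell y j) * (2 * r' / q.+1%:R).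
  by rewrite /cell; field; rewrite !gt_eqF.
rewrite normrM (ger0_norm (_ : 0 <= 2 * r' / q.+1%:R)); last first.
  by rewrite divr_ge0 ?mulr_ge0 ?ltW.
by rewrite -[leRHS]mul1r ler_wpM2r// divr_ge0 ?mulr_ge0 ?ltW.
Qed.

End net.

Section uniform_law.
Context {R : realType} {n : nat}.
Local Notation Rn := 'rV[R]_n.
Context {d : measure_display} {Omega : measurableType d}.
Context {d' : measure_display} {T : measurableType d'}.
Variables (P : probability Omega R) (Pr : probability T R).
Variables (s : nat -> T -> Omega) (F : nat -> set (set T)).
Hypothesis Hs : iid_draws P Pr s.
Hypothesis HF : history Pr s F.
Variable alpha : nat -> R.
Hypothesis alpha_gt0 : forall k, 0 < alpha k.

Let tau k : R := Num.sqrt (1 + ln (beta alpha k)).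

Let ln_beta_ge0 k : 0 <= ln (beta alpha k).
Proof. by rewrite ln_ge0// beta_ge1. Qed.

Let tau_ge1 k : 1 <= tau k.
Proof. by rewrite -[leLHS]sqrtr1 ler_sqrt ?addr_ge0// lerDl. Qed.

Let tau_le k : tau k <= 1 + Num.sqrt (ln (beta alpha k)).
Proof.
rewrite -(@ler_pXn2r _ 2) ?nnegrE ?addr_ge0 ?sqrtr_ge0// sqr_sqrtr ?addr_ge0//.
rewrite sqrrD sqr_sqrtr// expr1n.
have := sqrtr_ge0 (ln (beta alpha k)); lra.
Qed.

Let beta_gt0 k : 0 < beta alpha k.
Proof. by rewrite (lt_le_trans _ (beta_ge1 alpha_gt0 k)). Qed.

Lemma rate_ge0 k : 0 <= rate alpha k.
Proof. by rewrite divr_ge0 ?addr_ge0 ?sqrtr_ge0 ?(ltW (beta_gt0 _)). Qed.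

Let tau_div_beta k : tau k / beta alpha k <= rate alpha k.
Proof. by rewrite /rate ler_wpM2r// invr_ge0 ltW. Qed.

Let inv_beta k : (beta alpha k)^-1 <= rate alpha k.
Proof.
rewrite /rate -[leLHS]mul1r ler_wpM2r ?invr_ge0 ?(ltW (beta_gt0 _))//.
by rewrite lerDl sqrtr_ge0.
Qed.

(* The expectation of a maximum of [N] deviations is estimated through
   [y <= l - 1 + exp (y - l)] and the exponential moments, with
   [l = ln (2 N) + O(lambda ^ 2 / beta ^ 2)]; the net has mesh of order
   [1 / beta] and [lambda = beta * sqrt (1 + ln beta)]. *)
Lemma uniform_law (C : set Rn) (r B M : R) (psi : Rn -> Omega -> R) :
  (forall x, C x -> enorm x <= r) ->
  (forall x, C x -> measurable_fun [set: Omega] (psi x)) ->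
  0 <= M -> (forall x t, C x -> `|psi x t| <= B) ->
  (forall x y t, C x -> C y -> `|psi x t - psi y t| <= M * enorm (x - y)) ->
  exists2 K : R, 0 <= K & exists err : nat -> T -> R,
    [/\ forall k, measurable_fun [set: T] (err k),
        forall k w, 0 <= err k w,
        forall k, (\int[Pr]_w (err k w)%:E <= (K * rate alpha k)%:E)%E &
        forall k w x, C x ->
          `|wmean alpha (fun i => psi x (s i w) : R^o) k - mean P (psi x)|
            <= err k w].
Proof.
move=> Cr mpsi M0 psiB psiM.
have [C0|/set0P Cn0] := eqVneq C set0.
  exists 0; rewrite ?lexx//; exists (fun _ _ => 0); split => //.
    by move=> k; rewrite mul0r; under eq_integral do rewrite /=; rewrite integral0.
  by move=> k w x; rewrite C0.
have r0 : 0 <= r by have [x Cx] := Cn0; exact: le_trans (enorm_ge0 x) (Cr x Cx).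
have B0 : 0 <= B.
  have [x Cx] := Cn0; exact: le_trans (normr_ge0 _) (psiB x point Cx).
pose q k := (Num.truncn (beta alpha k)).+1.
have qb k : beta alpha k <= (q k)%:R.
  by have /andP[_ /ltW] := truncn_itv (ltW (beta_gt0 k)).
have qb2 k : (q k)%:R <= 2 * beta alpha k.
  have /andP[h _] := truncn_itv (ltW (beta_gt0 k)).
  by rewrite /q -natr1; have := beta_ge1 alpha_gt0 k; lra.
have netP k : exists p : {ffun 'I_n -> 'I_(q k)} -> Rn, (forall c, C (p c)) /\
    forall x, C x -> exists c, enorm (x - p c) <= n%:R * (2 * (r + 1) / (q k)%:R).
  exact: finite_net.
pose p k := sval (cid (netP k)).
have Cp k c : C (p k c) by rewrite /p; case: cid => p0 [] /=.
have pnet k x : C x -> exists c, enorm (x - p k c) <= n%:R * (2 * (r + 1) / (q k)%:R).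
  by move=> Cx; rewrite /p; case: cid => p0 [_ H] /=; exact: H.
pose Y k c t := psi (p k c) t - mean P (psi (p k c)).
have Ipsi x : C x -> P.-integrable setT (EFin \o psi x).
  by move=> Cx; apply: (@bounded_integrable _ _ _ P _ B); [exact: mpsi|move=> t; exact: psiB].
have mY k c : measurable_fun [set: Omega] (Y k c).
  by apply: measurable_funB => //; exact: mpsi.
have YB k c t : `|Y k c t| <= 2 * B.
  rewrite (le_trans (ler_normB _ _))// mulrDl mul1r lerD ?psiB//.
  by apply: mean_abs_le; [exact: Ipsi|move=> ?; exact: psiB].
have Y0 k c : mean P (Y k c) = 0.
  rewrite /Y meanB; [|exact: Ipsi|exact: integrable_cst].
  by rewrite mean_cst subrr.
pose X k c w := wmean alpha (fun i => Y k c (s i w) : R^o) k.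
have XE k c w : X k c w =
    wmean alpha (fun i => psi (p k c) (s i w) : R^o) k - mean P (psi (p k c)).
  by rewrite /X /Y (@wmeanB _ _ R^o) (@wmean_cst _ _ alpha_gt0 R^o).
have mX k c : measurable_fun [set: T] (X k c).
  have -> : X k c = (fun w => \sum_(i < k.+1) alpha i / weight_sum alpha k * Y k c (s i w)).
    by apply/funext => w; rewrite /X wmean_sum.
  apply: measurable_sum => i; apply: measurable_funM => //.
  apply: measurableT_comp => //; exact: draws_measurable Hs i.
(* Chosen so that [exp (l k)] bounds the expectation of [S k] below. The number [2 q ^ n] of terms
   is at most [(e beta) ^ (n+1) = exp ((n+1) tau ^ 2)], since both [2] and [q] are at most [e beta];
   each term contributes [exp (8 B ^ 2 tau ^ 2)], the centred variables being bounded by [2 B]. *)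
pose l k := (n.+1%:R + 8 * B ^+ 2) * tau k ^+ 2.
pose lam k := beta alpha k * tau k.
have tau_gt0 k : 0 < tau k by rewrite (lt_le_trans _ (tau_ge1 k)).
have lam_gt0 k : 0 < lam k by rewrite mulr_gt0.
pose S k w := \sum_(c : {ffun 'I_n -> 'I_(q k)})
   (expR (lam k * X k c w) + expR (- lam k * X k c w)).
have S0 k w : 0 <= S k w by apply: sumr_ge0 => c _; rewrite addr_ge0 ?expR_ge0.
have mS k : measurable_fun [set: T] (S k).
  apply: measurable_sum => c; apply: measurable_funD;
    by apply: measurableT_comp => //; apply: measurable_funM.
pose mesh k := n%:R * (2 * (r + 1) / (q k)%:R) : R.
have mesh0 k : 0 <= mesh k by rewrite mulr_ge0// divr_ge0// mulr_ge0// addr_ge0.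
(* A finite sum is measurable at once, in contrast to a supremum over [C]. The term [2 M mesh] pays
   for moving to the nearest net point, once in the empirical mean and once in the expectation. *)
pose err k w := (l k - 1) / lam k + 2 * M * mesh k + expR (- l k) / lam k * S k w.
have Xerr k c w : `|X k c w| + 2 * M * mesh k <= err k w.
  rewrite /err addrAC lerD2r -mulrA (mulrC _^-1) mulrA -mulrDl.
  rewrite ler_pdivlMr// mulrC.
  have h1 := expR_ge1Dx (lam k * `|X k c w| - l k).
  have : expR (lam k * `|X k c w| - l k) <= expR (- l k) * S k w.
    rewrite addrC expRD ler_wpM2l ?expR_ge0// /S (bigD1 c)//=.
    rewrite -[leLHS]addr0 lerD//; last first.
      by apply: sumr_ge0 => i _; rewrite addr_ge0 ?expR_ge0.
    case: (ger0P (X k c w)) => _; first by rewrite lerDl expR_ge0.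
    by rewrite mulrN mulNr lerDr expR_ge0.
  lra.
exists (n.+1%:R + 8 * B ^+ 2 + 4 * M * n%:R * (r + 1)).
  by rewrite !addr_ge0 ?mulr_ge0 ?sqr_ge0// addr_ge0.
exists err; split.
- move=> k; apply: measurable_funD => //; exact: measurable_funM.
- move=> k w; apply: le_trans (Xerr k [ffun=> ord0] w).
  by apply: addr_ge0 => //; apply: mulr_ge0 => //; apply: mulr_ge0.
- move=> k.
  have lE : expR (tau k ^+ 2) = expR 1 * beta alpha k.
    by rewrite sqr_sqrtr ?addr_ge0// expRD lnK// posrE.
  have e2 : 2 <= expR 1 :> R by have := expR_ge1Dx (1 : R); lra.
  have eS (m : R) c : m ^+ 2 = lam k ^+ 2 ->
      (\int[Pr]_w (expR (m * X k c w))%:E <=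
        (expR (8 * B ^+ 2 * tau k ^+ 2))%:E)%E.
    move=> m2; apply: le_trans (hoeffding_wmean Hs HF _ k alpha_gt0
      (mY k c) (YB k c) (Y0 k c)) _.
    rewrite lee_fin ler_expR exprMn exprVn m2 /lam.
    have -> : (beta alpha k * tau k) ^+ 2 / beta alpha k ^+ 2 = tau k ^+ 2.
      by field; rewrite gt_eqF.
    by rewrite exprMn; lra.
  have l1 : 1 <= l k.
    have t1 : 1 <= tau k ^+ 2 by rewrite exprn_ege1.
    have n1 : 1 <= n.+1%:R :> R by rewrite ler1n.
    have b0 := sqr_ge0 B.
    rewrite /l -[leLHS]mulr1 ler_pM//; lra.
  have IS : (\int[Pr]_w (S k w)%:E <= (expR (l k))%:E)%E.
    under eq_integral do rewrite -sumEFin.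
    rewrite ge0_integral_sum//; last first.
      move=> c; apply/measurable_EFinP; apply: measurable_funD;
      by apply: measurableT_comp => //; apply: measurable_funM.
    apply: (@le_trans _ _ (\sum_(c : {ffun 'I_n -> 'I_(q k)})
       (2 * expR (8 * B ^+ 2 * tau k ^+ 2))%:E)%E).
      apply: lee_sum => c _.
      under eq_integral do rewrite EFinD.
      rewrite ge0_integralD//; last 2 first.
      + by apply/measurable_EFinP; apply: measurableT_comp => //; apply: measurable_funM.
      + by apply/measurable_EFinP; apply: measurableT_comp => //; apply: measurable_funM.
      rewrite mulrDl mul1r EFinD leeD//.
        exact: eS.
      by apply: eS; rewrite sqrrN.
    rewrite sumEFin lee_fin sumr_const card_ffun !card_ord -[leLHS]mulr_natr.
    rewrite /l [in leRHS]mulrDl expRD mulrAC ler_wpM2r ?expR_ge0//.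
    rewrite expRM_natl lE exprS natrX.
    apply: ler_pM => //.
      by have := ler_wpM2l (expR_ge0 (1 : R)) (beta_ge1 alpha_gt0 k); lra.
    have qeb : (q k)%:R <= expR 1 * beta alpha k.
      by rewrite (le_trans (qb2 k))// ler_wpM2r// ltW.
    by rewrite lerXn2r ?nnegrE// (le_trans _ qeb).
  have c20 : 0 <= expR (- l k) / lam k by rewrite divr_ge0 ?expR_ge0 ?ltW.
  have c10 : 0 <= (l k - 1) / lam k + 2 * M * mesh k.
    apply: addr_ge0; last by apply: mulr_ge0 => //; apply: mulr_ge0.
    by apply: divr_ge0; rewrite ?subr_ge0// ltW.
  rewrite /err; under eq_integral do rewrite EFinD EFinM.
  rewrite ge0_integralD//; last 2 first.
  + by move=> w _; rewrite -EFinM lee_fin mulr_ge0.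
  + by apply/measurable_EFinP; apply: measurable_funM.
  rewrite integral_cst//= probability_setT mule1 ge0_integralZl//; last 2 first.
  + exact/measurable_EFinP.
  + by move=> w _; rewrite lee_fin.
  apply: (@le_trans _ _ (((l k - 1) / lam k + 2 * M * mesh k)%:E +
      (expR (- l k) / lam k)%:E * (expR (l k))%:E)%E).
    by rewrite leeD2l// lee_wpmul2l.
  rewrite -EFinM -EFinD lee_fin.
  have -> : (l k - 1) / lam k + 2 * M * mesh k + expR (- l k) / lam k * expR (l k)
     = l k / lam k + 2 * M * mesh k.
    by rewrite [X in _ + X]mulrAC -expRD addNr expR0; lra.
  have -> : l k / lam k = (n.+1%:R + 8 * B ^+ 2) * (tau k / beta alpha k).
    by rewrite /l /lam; field; rewrite !gt_eqF.
  rewrite [leRHS]mulrDl lerD//.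
    by rewrite ler_wpM2l// addr_ge0// mulr_ge0// sqr_ge0.
  have -> : 2 * M * mesh k = 4 * M * n%:R * (r + 1) * (q k)%:R^-1.
    by rewrite /mesh; field; rewrite gt_eqF.
  rewrite ler_wpM2l ?mulr_ge0 ?addr_ge0//.
  by rewrite (le_trans _ (inv_beta k))// lef_pV2 ?posrE.
- move=> k w x Cx; have [c xc] := pnet k x Cx.
  apply: le_trans (Xerr k c w); rewrite XE.
  set a := wmean _ _ _; set b := mean _ _; set a' := wmean _ _ _; set b' := mean _ _.
  have ab : `|a - a'| <= M * mesh k.
    rewrite /a /a' -(@wmeanB _ _ R^o).
    rewrite -[leRHS](@wmean_cst _ _ alpha_gt0 R^o (M * mesh k) k).
    apply: norm_wmean_le => // i; apply: le_trans (psiM _ _ _ Cx (Cp k c)) _.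
    by rewrite ler_wpM2l.
  have bb : `|b - b'| <= M * mesh k.
    rewrite /b /b' -meanB; [|exact: Ipsi..].
    have Ixp : P.-integrable setT (EFin \o (fun t => psi x t - psi (p k c) t)).
      apply: (@bounded_integrable _ _ _ P _ (M * mesh k)).
        by apply: measurable_funB; exact: mpsi.
      by move=> t; rewrite (le_trans (psiM _ _ _ Cx (Cp k c)))// ler_wpM2l.
    apply: mean_abs_le => // t.
    by rewrite (le_trans (psiM _ _ _ Cx (Cp k c)))// ler_wpM2l.
  have -> : a - b = (a' - b') + (a - a') - (b - b') by lra.
  apply: le_trans (ler_normB _ _) _; have := ler_normD (a' - b') (a - a'); lra.
Qed.

End uniform_law.

(** * Descent along a sample path *)

Section subgradients.
Context {R : realType} {n : nat}.
Local Notation Rn := 'rV[R]_n.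

Lemma subdiff_fin_num (psi : Rn -> \bar R) x v : (forall y, psi y != -oo)%E ->
  subdiff psi x v -> psi x \is a fin_num.
Proof. by move=> psiNy [psix _]; rewrite fin_numE psiNy lt_eqF. Qed.

Lemma subdiff_EFin (f : Rn -> R) x v :
  subdiff (fun y => (f y)%:E) x v <-> forall y, f x + dotp v (y - x) <= f y.
Proof.
split => [[_ fv] y|fv]; first by have := fv y; rewrite lee_fin.
by split => [|y]; [rewrite ltry|rewrite lee_fin].
Qed.

Lemma rho_convex_le (rho rho' : R) (psi : Rn -> \bar R) :
  rho' <= rho -> (forall y, psi y != -oo)%E -> rho_convex rho psi ->
  rho_convex rho' psi.
Proof.
move=> rr psiNy H x y l l01; apply: le_trans (H x y l l01) _.
rewrite leeD2l// leeN2 lee_fin -!mulrA.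
case/andP: l01 => l0 l1.
by rewrite ler_wpM2r// mulr_ge0// mulr_ge0// mulr_ge0 ?sqr_ge0 ?subr_ge0.
Qed.

Lemma strong_subgradient (rho : R) (psi : Rn -> \bar R) x y v : 0 <= rho ->
  (forall p, psi p != -oo)%E -> rho_convex rho psi -> subdiff psi x v ->
  psi y \is a fin_num ->
  fine (psi x) + dotp v (y - x) + rho / 2 * enorm (y - x) ^+ 2 <= fine (psi y).
Proof.
move=> rho0 psiNy H sv psiy; have psix := subdiff_fin_num psiNy sv.
set a := fine (psi x); set b := fine (psi y); set e := enorm (y - x) ^+ 2.
set p := dotp v (y - x).
have re0 : 0 <= rho / 2 * e by rewrite mulr_ge0 ?sqr_ge0// divr_ge0.
have key l : 0 < l <= 1 -> p <= b - a - rho / 2 * e + l * (rho / 2 * e).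
  move=> /andP[l0 l1].
  have l01 : 0 <= l <= 1 by rewrite ltW.
  have := H y x l l01.
  have [_ /(_ (l *: y + (1 - l) *: x))] := sv.
  move=> /le_trans/[apply].
  have -> : l *: y + (1 - l) *: x - x = l *: (y - x).
    by apply/rowP => j; rewrite !mxE; ring.
  rewrite dotpZr -(fineK psix) -(fineK psiy) -/a -/b -/p -/e.
  rewrite -!EFinM -!EFinD lee_fin => h.
  have : l * p <= l * (b - a - rho / 2 * e + l * (rho / 2 * e)) by lra.
  by rewrite ler_pM2l.
suff : p <= b - a - rho / 2 * e by lra.
apply/ler_addgt0Pr => c c0.
pose l := Num.min 1 (c / (rho / 2 * e + 1)).
have d0 : 0 < rho / 2 * e + 1 by lra.
have l0 : 0 < l by rewrite lt_min ltr01 divr_gt0.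
have l1 : l <= 1 by rewrite ge_min lexx.
apply: le_trans (key l _) _; first by rewrite l0.
rewrite lerD2l.
have : l <= c / (rho / 2 * e + 1) by rewrite ge_min lexx orbT.
rewrite ler_pdivlMr// => h; lra.
Qed.

End subgradients.

Section path.
Context {R : realType} {n : nat} {Omega : Type}.
Local Notation Rn := 'rV[R]_n.
Variables (alpha : nat -> R) (g h : Rn -> Omega -> R) (r1 r2 : Rn -> \bar R).
Variables (rho1 rho2 : R) (s : nat -> Omega) (x z u : nat -> Rn).
Hypothesis alpha_gt0 : forall k, 0 < alpha k.
Hypothesis r1Ny : forall y, (r1 y != -oo)%E.
Hypothesis r2Ny : forall y, (r2 y != -oo)%E.
Hypothesis rho1_ge0 : 0 <= rho1.
Hypothesis rho2_ge0 : 0 <= rho2.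
Hypothesis h_rho : forall t, rho_convex rho1 (fun y => (h y t)%:E).
Hypothesis r2_rho : rho_convex rho2 r2.
Hypothesis x_start : (r1 (x 0) < +oo)%E.
Hypothesis z_sub : forall k, subdiff (fun y => (h y (s k))%:E) (x k) (z k).
Hypothesis u_sub : forall k, subdiff r2 (x k) (u k).

Let gk k y : R := wmean alpha (fun i => g y (s i) : R^o) k.
Let hk k y : R := wmean alpha (fun i => h y (s i) : R^o) k.

Definition slope k := wmean alpha z k + wmean alpha u k.

Hypothesis x_step : forall k, minimizer
  (fun y => (gk k y)%:E + r1 y - (dotp (slope k) y)%:E)%E (x k.+1).

Lemma path_r1_fin k : r1 (x k) \is a fin_num.
Proof.
rewrite fin_numE r1Ny /=; case: k => [|k]; first by rewrite lt_eqF.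
apply/negP => /eqP r1y.
have := x_step k (x 0); rewrite /= r1y.
have r10 : r1 (x 0) \is a fin_num by rewrite fin_numE r1Ny lt_eqF.
by rewrite -(fineK r10) addey// addye.
Qed.

Lemma path_r2_fin k : r2 (x k) \is a fin_num.
Proof. exact: subdiff_fin_num (u_sub k). Qed.

Let R1 k := fine (r1 (x k)).
Let R2 k := fine (r2 (x k)).

(** The quantity [Q_k] of the overview. *)
Definition spread k : R :=
  wmean alpha (fun i => enorm (x k.+1 - x i) ^+ 2 : R^o) k.

Let lin k (y : Rn) : R := wmean alpha
  (fun i => h (x i) (s i) + R2 i + dotp (z i + u i) (y - x i) : R^o) k.

(** [lin k] averages the linearizations of [h + r2] at the past iterates. Its linear part is
    [slope k], so [x k.+1] minimizes [gk k + r1 - lin k] as well, and [V k] is the minimal value. *)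
Let V k := gk k (x k.+1) + R1 k.+1 - lin k (x k.+1).

Let lin_affine k y y' : lin k y' = lin k y + dotp (slope k) (y' - y).
Proof.
rewrite /lin /slope -wmeanD [in dotp _ _]wmean_sum dotp_suml wmean_sum.
rewrite [X in _ = X + _]wmean_sum -big_split; apply: eq_bigr => i _ /=.
rewrite dotpZl /GRing.scale /= !dotpBr; lra.
Qed.

Let V_le k y : r1 y \is a fin_num -> V k <= gk k y + fine (r1 y) - lin k y.
Proof.
move=> r1y; have := x_step k y; rewrite -(fineK r1y) -(fineK (path_r1_fin k.+1)).
rewrite -!EFinD lee_fin /V (lin_affine k y (x k.+1)) -/(R1 k.+1).
rewrite dotpBr; lra.
Qed.

Let a k := alpha k / weight_sum alpha k.

Lemma weight_ratio_ge0 k : 0 <= a k.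
Proof. exact: wmean_weight_ge0. Qed.

Lemma weight_ratio_le1 k : a k <= 1.
Proof.
rewrite ler_pdivrMr ?weight_sum_gt0// mul1r /weight_sum big_ord_recr /=.
by rewrite lerDr sumr_ge0// => i _; rewrite ltW.
Qed.

Let f k := g (x k) (s k) + R1 k - h (x k) (s k) - R2 k.

(** The model of index [k.+1] is evaluated at the minimizer [x k.+1] of the previous one. The
    linearization added at this step is exact there, so the value is the convex combination of [V k]
    and [f k.+1] with weight [a k.+1]. *)
Let V_step k : V k.+1 <= V k + a k.+1 * (f k.+1 - V k).
Proof.
apply: le_trans (V_le k.+1 (path_r1_fin k.+1)) _; rewrite -/(R1 k.+1).
have wk := weight_sum_gt0 alpha_gt0 k.
have wk1 := weight_sum_gt0 alpha_gt0 k.+1.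
have E1 := wmeanS alpha_gt0 (fun i => g (x k.+1) (s i)) k.
have E2 := wmeanS alpha_gt0
  (fun i => h (x i) (s i) + R2 i + dotp (z i + u i) (x k.+1 - x i)) k.
rewrite -/(gk _ _) -/(gk k _) in E1; rewrite -/(lin _ _) -/(lin k _) in E2.
rewrite subrr dotpC dotp0l addr0 in E2.
rewrite -(ler_pM2l wk1) /V /f.
have -> : weight_sum alpha k.+1 * (gk k (x k.+1) + R1 k.+1 - lin k (x k.+1) +
   a k.+1 * (g (x k.+1) (s k.+1) + R1 k.+1 - h (x k.+1) (s k.+1) - R2 k.+1 -
    (gk k (x k.+1) + R1 k.+1 - lin k (x k.+1)))) =
  (weight_sum alpha k.+1 - alpha k.+1) * (gk k (x k.+1) + R1 k.+1 - lin k (x k.+1))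
   + alpha k.+1 * (g (x k.+1) (s k.+1) + R1 k.+1 - h (x k.+1) (s k.+1) - R2 k.+1).
  by rewrite /a; field; rewrite gt_eqF.
rewrite mulrBr mulrDr E1 E2 weight_sumS; lra.
Qed.

Let rho := rho1 + rho2.

Let V_lower k :
  gk k (x k.+1) + R1 k.+1 - hk k (x k.+1) - R2 k.+1 + rho / 2 * spread k <= V k.
Proof.
rewrite /V -!addrA !lerD2l.
suff : lin k (x k.+1) <= hk k (x k.+1) + R2 k.+1 - rho / 2 * spread k by lra.
rewrite /hk /spread -[R2 k.+1](wmean_cst alpha_gt0 (V := R^o) _ k).
rewrite -[rho / 2 * _](wmeanZ alpha (V := R^o)) -wmeanD -(wmeanB alpha (V := R^o)).
apply: ler_wmean => // i.
have Hh := @strong_subgradient R n rho1 (fun y => (h y (s i))%:E) (x i)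
  (x k.+1) (z i) rho1_ge0 (fun=> isT) (h_rho (s i)) (z_sub i) isT.
have Hr := strong_subgradient rho2_ge0 r2Ny r2_rho (u_sub i) (path_r2_fin k.+1).
rewrite /= in Hh; rewrite dotpDl -/(R2 i) -/(R2 k.+1) /rho /GRing.scale /= in Hr *.
lra.
Qed.

Variables (Z : Rn -> R) (r B al : R) (err : nat -> R) (chi : nat -> R).
Hypothesis Z_bound : forall y, enorm y <= r -> `|Z y| <= B.
Hypothesis gh_bound : forall y t, enorm y <= r -> `|g y t - h y t| <= B.
Hypothesis err_ge0 : forall k, 0 <= err k.
Hypothesis err_bound : forall k y, enorm y <= r ->
  `|gk k y - hk k y - Z y| <= err k.
Hypothesis al_le : forall k, al <= Z (x k) + R1 k - R2 k.
Hypothesis chi_in : forall k, (forall i, (i <= k)%N -> enorm (x i) <= r) ->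
  chi k = 1.
Hypothesis chi_out : forall k, ~ (forall i, (i <= k)%N -> enorm (x i) <= r) ->
  chi k = 0.

Let D k := g (x k) (s k) - h (x k) (s k) - Z (x k).

(** Of the five [B], one bounds [V 0] from above, two bound the last [V] from below, and two pay for
    the term [a D] of the dropped step. *)
Let c := `|R1 0 - R2 0| + `|al| + 5 * B.

Let sum_spread m : (forall i, (i <= m)%N -> enorm (x i) <= r) ->
  \sum_(k < m) a k.+1 * (rho / 2 * spread k) <=
  V 0 - V m + \sum_(k < m) a k.+1 * (D k.+1 + err k).
Proof.
elim: m => [_|m IH xr]; first by rewrite !big_ord0; lra.
rewrite !big_ord_recr /=.
have {}IH := IH (fun i im => xr i (leqW im)).
suff : a m.+1 * (rho / 2 * spread m) <= V m - V m.+1 + a m.+1 * (D m.+1 + err m).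
  by lra.
have H1 := V_step m; have H2 := V_lower m.
have := err_bound m (xr m.+1 (leqnn _)); rewrite ler_norml => /andP[H3 _].
have : a m.+1 * (f m.+1 - V m) <=
  a m.+1 * (D m.+1 + err m - rho / 2 * spread m).
  by rewrite ler_wpM2l ?weight_ratio_ge0// /f /D; lra.
lra.
Qed.

Let V_ge m : enorm (x m.+1) <= r -> 0 <= rho / 2 * spread m -> al - 2 * B <= V m.
Proof.
move=> xr s0; have H1 := V_lower m; have H2 := al_le m.+1.
have := Z_bound xr; rewrite ler_norml => /andP[_ H3].
have : `|gk m (x m.+1) - hk m (x m.+1)| <= B.
  rewrite /gk /hk -(wmeanB alpha (V := R^o)).
  rewrite -[leRHS](wmean_cst alpha_gt0 (V := R^o) B m).
  by apply: norm_wmean_le => // i; exact: gh_bound.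
rewrite ler_norml => /andP[H4 _]; lra.
Qed.

Lemma spread_ge0 k : 0 <= spread k.
Proof.
rewrite -[leLHS](wmean_cst alpha_gt0 (V := R^o) 0 k).
by apply: ler_wmean => // i; exact: sqr_ge0.
Qed.

Let T K := \sum_(k < K) chi k.+1 * (a k.+1 * D k.+1) + \sum_(k < K) a k.+1 * err k.

Let T_in K : (forall i, (i <= K)%N -> enorm (x i) <= r) ->
  \sum_(k < K.-1) a k.+1 * (rho / 2 * spread k) <= c + T K.
Proof.
have rho0 k : 0 <= rho / 2 * spread k.
  by rewrite mulr_ge0 ?spread_ge0// divr_ge0// addr_ge0.
case: K => [xr|K xr]; rewrite /T.
  rewrite !big_ord0 /c.
  have B0 : 0 <= B by rewrite (le_trans _ (Z_bound (xr 0 isT))).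
  by rewrite !addr0 !addr_ge0 ?mulr_ge0.
have B0 : 0 <= B by rewrite (le_trans _ (Z_bound (xr 0 isT))).
have H1 := sum_spread (fun i iK => xr i (leqW iK)).
have H2 := V_ge (xr K.+1 (leqnn _)) (rho0 K).
have H3 : V 0 <= R1 0 - R2 0 + B.
  apply: le_trans (V_le 0 (path_r1_fin 0)) _.
  rewrite /gk /lin !wmean_sum !big_ord1 /= -/(R1 0) /weight_sum !big_ord1.
  rewrite divff ?gt_eqF// !scale1r subrr dotpC dotp0l.
  have := gh_bound (s 0) (xr 0 isT); rewrite ler_norml => /andP[_]; lra.
rewrite /= !big_ord_recr /=.
have -> : \sum_(k < K) chi k.+1 * (a k.+1 * D k.+1) = \sum_(k < K) a k.+1 * D k.+1.
  apply: eq_bigr => i _; rewrite chi_in ?mul1r// => j ji.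
  by apply: xr; apply: leq_trans ji _; rewrite ltnS ltnW.
rewrite chi_in// mul1r.
have H4 : - (2 * B) <= a K.+1 * D K.+1.
  have : `|a K.+1 * D K.+1| <= 1 * (2 * B).
    rewrite normrM ler_pM//.
      by rewrite ger0_norm ?weight_ratio_ge0 ?weight_ratio_le1.
    rewrite (le_trans (ler_normB _ _))// mulrDl mul1r lerD ?gh_bound ?Z_bound ?xr//.
  by rewrite mul1r ler_norml => /andP[].
have H5 : 0 <= a K.+1 * err K by rewrite mulr_ge0 ?weight_ratio_ge0.
have H6 := ler_norm (R1 0 - R2 0); have H7 := ler_norm (- al).
rewrite normrN in H7; rewrite /c.
have : \sum_(k < K) a k.+1 * (D k.+1 + err k) =
  \sum_(k < K) a k.+1 * D k.+1 + \sum_(k < K) a k.+1 * err k.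
  by rewrite -big_split; apply: eq_bigr => i _; rewrite mulrDr.
lra.
Qed.

Hypothesis B_ge0 : 0 <= B.

(* Summing the descent inequality up to the last index before the exit from
   the ball would involve an iterate outside of it; hence one step is dropped
   on the left-hand side, at the bounded price [|a D| <= 2 B]. *)
Lemma truncated_descent K :
  chi K * \sum_(k < K.-1) a k.+1 * (rho / 2 * spread k) <= c + T K.
Proof.
(* Outside the ball the left-hand side vanishes, so the right-hand side must be shown nonnegative.
   Up to the exit this follows from the descent inequality; afterwards [chi] is 0 and only error
   terms are added. *)
have T0 : 0 <= c + T K.
  elim: K => [|K IH].
    by rewrite /T !big_ord0 /c !addr0 !addr_ge0 ?mulr_ge0.
  have [xr|xr] := pselect (forall i, (i <= K.+1)%N -> enorm (x i) <= r).
    apply: le_trans (T_in xr); apply: sumr_ge0 => i _.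
    by rewrite mulr_ge0 ?weight_ratio_ge0// mulr_ge0 ?spread_ge0// divr_ge0// addr_ge0.
  move: IH; rewrite /T !big_ord_recr /= (chi_out xr) mul0r.
  have := mulr_ge0 (weight_ratio_ge0 K.+1) (err_ge0 K); lra.
have [xr|xr] := pselect (forall i, (i <= K)%N -> enorm (x i) <= r).
  by rewrite chi_in// mul1r T_in.
by rewrite chi_out// mul0r.
Qed.

End path.

Section integral_affine.
Context {R : realType} {d : measure_display} {Omega : measurableType d}.
Variable P : probability Omega R.

Lemma integral_affine (f : Omega -> R) (c b : R) :
  P.-integrable setT (EFin \o f) ->
  (\int[P]_t (c * f t + b)%:E = (c * mean P f + b)%:E)%E.
Proof.
move=> If; under eq_integral do rewrite EFinD EFinM.
rewrite integralD//.
- by rewrite (integralZl measurableT If) (meanE If) integral_cst//= probability_setT mule1.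
- exact: (integrableZl measurableT c If).
- exact: (integrable_cst P b).
Qed.

End integral_affine.

Section measurable_coordinates.
Context {R : realType} {n : nat} {d : measure_display} {W : measurableType d}.
Local Notation Rn := 'rV[R]_n.

(** Measurability of a random vector is expressed by coordinates, as in [known], so that no
    sigma-algebra on row vectors is involved. *)
Definition measurable_coord (xi : W -> Rn) :=
  forall j, measurable_fun [set: W] (fun w => xi w 0 j).

Lemma measurable_coordB (xi xi' : W -> Rn) : measurable_coord xi ->
  measurable_coord xi' -> measurable_coord (fun w => xi w - xi' w).
Proof.
move=> m m' j.
have -> : (fun w => (xi w - xi' w) 0 j) = (fun w => xi w 0 j - xi' w 0 j).
  by apply/funext => w; rewrite !mxE.
exact: measurable_funB.
Qed.

Lemma continuous_measurable_coord (f : Rn -> R) (xi : W -> Rn) :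
  continuous f -> measurable_coord xi -> measurable_fun [set: W] (f \o xi).
Proof.
move=> cf mxi.
have H := @caratheodory_measurable R n _ W _ W (fun x _ => f x) xi (fun=> cf)
  (fun x => measurable_cst _) mxi.
have -> : f \o xi = (fun p : W * W => f (xi p.1)) \o (fun w => (w, w)) by [].
exact: measurableT_comp H (measurable_fun_pair _ _).
Qed.

Lemma continuous_subr (f f' : Rn -> R) : continuous f -> continuous f' ->
  continuous (fun y => f y - f' y).
Proof. by move=> cf cf' y; exact: (@continuousB R R^o _ f f' y (cf y) (cf' y)). Qed.

Lemma continuous_enorm : continuous (@enorm R n).
Proof.
apply: locally_lipschitz_continuous => r; exists 1 => // x y _ _.
rewrite mul1r ler_norml.
have h3 := enormD (x - y) y; have h4 := enormD (y - x) x.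
rewrite !subrK in h3 h4; rewrite (enormB y) in h4.
by apply/andP; split; lra.
Qed.

Lemma measurable_enorm (xi : W -> Rn) : measurable_coord xi ->
  measurable_fun [set: W] (fun w => enorm (xi w)).
Proof. exact: continuous_measurable_coord continuous_enorm. Qed.

End measurable_coordinates.

(** * Subsequences and limits *)

Section selection.
Context {R : realType}.
Variable alpha : nat -> R.
Hypothesis alpha_gt0 : forall k, 0 < alpha k.
Hypothesis alpha_div : (\sum_(0 <= k <oo) (alpha k)%:E = +oo)%E.

Let a k := alpha k / weight_sum alpha k.

Let a_ge0 k : 0 <= a k.
Proof. exact: wmean_weight_ge0. Qed.

Lemma weight_sum_unbounded M : exists k, M <= weight_sum alpha k.
Proof.
apply: contrapT => /forallNP H.
have : (\sum_(0 <= k <oo) (alpha k)%:E <= M%:E)%E.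
  apply: lime_le; first by apply: is_cvg_nneseries => k _ _; rewrite lee_fin ltW.
  near=> k; rewrite big_mkord sumEFin lee_fin.
  have /negP := H k; rewrite -ltNge => /ltW; apply: le_trans.
  by rewrite /weight_sum big_ord_recr lerDl ltW.
by rewrite alpha_div.
Unshelve. all: by end_near. Qed.

(* Abel-Dini: the block of indices over which [weight_sum] doubles contributes
   at least 1/2. *)
Lemma weight_ratio_unbounded M : exists K, M <= \sum_(k < K) a k.+1.
Proof.
have block p : exists q, \sum_(k < p) a k.+1 + 1 / 2 <= \sum_(k < q) a k.+1.
  have [q qp] := weight_sum_unbounded (2 * weight_sum alpha p).
  have mono i j : weight_sum alpha i <= weight_sum alpha (i + j).
    elim: j => [|j IH]; first by rewrite addn0.
    by rewrite addnS weight_sumS (le_trans IH)// lerDl ltW.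
  have [pq|qp'] := leqP p q; last first.
    have := mono q (p - q)%N; rewrite subnKC ?(ltnW qp')// => h.
    have := weight_sum_gt0 alpha_gt0 p; lra.
  exists q; rewrite -!(big_mkord xpredT (fun k => a k.+1)) [leRHS](big_cat_nat (n := p))//=.
  rewrite lerD2l.
  have Aq := weight_sum_gt0 alpha_gt0 q.
  apply: (@le_trans _ _ (\sum_(p <= k < q) alpha k.+1 / weight_sum alpha q)).
    rewrite -mulr_suml.
    have -> : \sum_(p <= k < q) alpha k.+1 = weight_sum alpha q - weight_sum alpha p.
      by rewrite -telescope_sumr//; apply: eq_big_nat => k _; rewrite weight_sumS; lra.
    by rewrite ler_pdivlMr//; lra.
  rewrite !big_nat; apply: ler_sum => k /andP[_ kq].
  rewrite /a ler_wpM2l ?(ltW (alpha_gt0 _))// lef_pV2 ?posrE ?weight_sum_gt0//.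
  by rewrite -(subnKC kq).
have step j : exists K, j%:R / 2 <= \sum_(k < K) a k.+1.
  elim: j => [|j [p jp]]; first by exists 0%N; rewrite mul0r big_ord0.
  have [q pq] := block p; exists q.
  by rewrite -natr1; lra.
have [K HK] := step (Num.truncn (2 * `|M|)).+1.
exists K; apply: le_trans HK.
have M0 : 0 <= 2 * `|M| by rewrite mulr_ge0.
have /andP[_ /ltW h] := truncn_itv M0; have := ler_norm M; lra.
Qed.

(** Since the sum of the [a k.+1] diverges, the sum of the first [j + 1] sequences cannot stay above
    a positive level from some index on. Treating one more sequence at each stage is a diagonal
    choice that serves countably many sequences. *)
Lemma select_subsequence (b : nat -> nat -> R) : (forall m k, 0 <= b m k) ->
  (forall m, exists c, forall K, \sum_(k < K) a k.+1 * b m k <= c) ->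
  exists2 l : nat -> nat, {homo l : i j / (i < j)%N} &
    forall j m, (m <= j)%N -> b m (l j) <= 1 / (2 ^ j.+1)%:R.
Proof.
move=> b0 /choice[c bc].
have pick j N : exists k, (N <= k)%N /\
    \sum_(m < j.+1) b m k <= 1 / (2 ^ j.+1)%:R.
  set e : R := 1 / _; have e0 : 0 < e by rewrite divr_gt0// ltr0n expn_gt0.
  apply: contrapT => /forallNP H.
  pose C := \sum_(m < j.+1) c m; pose S0 := \sum_(k < N) a k.+1.
  (* [K] is taken so large that the indices from [N] on, each weighted by at least [e], would
     contribute more than the total bound [C]. *)
  have [K HK] := weight_ratio_unbounded ((C + 1) / e + S0).
  have NK : (N <= K)%N.
    rewrite leqNgt; apply/negP => KN.
    have : \sum_(k < K) a k.+1 <= S0.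
      rewrite /S0 -!(big_mkord xpredT (fun k => a k.+1)).
      by rewrite [leRHS](big_cat_nat (n := K)) ?(ltnW KN)//= lerDl sumr_ge0.
    have C0 : 0 <= C.
      by apply: sumr_ge0 => m _; have := bc m 0%N; rewrite big_ord0.
    have : 0 < (C + 1) / e by rewrite divr_gt0// ltr_wpDl.
    lra.
  have : \sum_(k < K) a k.+1 * (\sum_(m < j.+1) b m k) <= C.
    under eq_bigr do rewrite mulr_sumr.
    by rewrite exchange_big /=; apply: ler_sum => m _; exact: bc.
  apply/negP; rewrite -ltNge.
  apply: (@lt_le_trans _ _ (e * (\sum_(k < K) a k.+1 - S0))).
    have : e * ((C + 1) / e) <= e * (\sum_(k < K) a k.+1 - S0).
      by rewrite ler_wpM2l ?(ltW e0)//; lra.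
    rewrite mulrC divfK ?gt_eqF//; lra.
  rewrite /S0 -!(big_mkord xpredT (fun k => a k.+1)).
  rewrite -(big_mkord xpredT (fun k => a k.+1 * (\sum_(m < j.+1) b m k))).
  rewrite [X in e * (X - _)](big_cat_nat (n := N))//= addrAC subrr add0r.
  rewrite [leRHS](big_cat_nat (n := N))//=.
  apply: (@le_trans _ _ (\sum_(N <= k < K) a k.+1 * (\sum_(m < j.+1) b m k))).
    rewrite mulr_sumr !big_nat; apply: ler_sum => k /andP[Nk _].
    rewrite mulrC ler_wpM2l//.
    by have := H k => /not_andP[//|/negP]; rewrite -ltNge => /ltW.
  by rewrite lerDr sumr_ge0// => k _; rewrite mulr_ge0// sumr_ge0.
pose next j N := sval (cid (pick j N)).
have nextP j N : (N <= next j N)%N /\ \sum_(m < j.+1) b m (next j N) <= 1 / (2 ^ j.+1)%:R.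
  by rewrite /next; case: cid.
pose l := fix l j := if j is j'.+1 then next j (l j').+1 else next 0%N 0%N.
exists l.
  apply: homo_ltn => [|j]; first exact: ltn_trans.
  by have [] := nextP j.+1 (l j).+1.
move=> j m mj.
have : \sum_(m < j.+1) b m (l j) <= 1 / (2 ^ j.+1)%:R.
  by case: j {mj} => [|j] /=; [have [] := nextP 0%N 0%N|have [] := nextP j.+1 (l j).+1].
apply: le_trans; rewrite (bigD1 (Ordinal (mj : (m < j.+1)%N)))//= lerDl.
by rewrite sumr_ge0.
Qed.

End selection.

Section almost_sure.
Context {R : realType} {d : measure_display} {T : measurableType d}.
Variable Pr : probability T R.

(** The expectation of the series is finite by monotone convergence, so the series converges almost
    surely and its terms tend to 0. *)
Lemma ae_cvg0 (f : nat -> T -> R) :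
  (forall j, measurable_fun [set: T] (f j)) -> (forall j w, 0 <= f j w) ->
  (forall j, \int[Pr]_w (f j w)%:E <= (1 / (2 ^ j.+1)%:R)%:E)%E ->
  {ae Pr, forall w, f ^~ w @ \oo --> (0 : R)}.
Proof.
move=> mf f0 If.
pose S w := (\sum_(j <oo) (f j w)%:E)%E.
have mS : measurable_fun [set: T] S.
  apply: ge0_emeasurable_sum => // j; first by move=> w _ _; rewrite lee_fin.
  by move=> _; exact/measurable_EFinP.
have S0 w : (0 <= S w)%E by apply: nneseries_ge0 => j _ _; rewrite lee_fin.
have IS : Pr.-integrable setT S.
  apply/integrableP; split => //.
  under eq_integral do rewrite gee0_abs//.
  rewrite integral_nneseries//; last 2 first.
  - by move=> j; exact/measurable_EFinP.
  - by move=> j w _; rewrite lee_fin.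
  apply: (@le_lt_trans _ _ 1%:E); last exact: ltry.
  apply: le_trans (@epsilon_trick0 R 1 xpredT ler01).
  apply: lee_nneseries => [j _ _|j _]; last exact: If.
  by apply: integral_ge0 => w _; rewrite lee_fin.
have := integrable_ae measurableT IS; apply: filterS => w /(_ Logic.I) Sfin.
apply: cvg_series_cvg_0.
apply: nondecreasing_is_cvgn.
  by apply/nondecreasing_series => j _ _; exact: f0.
exists (fine (S w)) => _ [k _ <-].
rewrite -lee_fin fineK// /series/= -sumEFin.
by apply: nneseries_lim_ge => j _ _; rewrite lee_fin.
Qed.

End almost_sure.

Section limits.
Context {R : realType} {n : nat}.
Local Notation Rn := 'rV[R]_n.

(** The subgradient inequality is tested one unit away from [x] in the direction of [v], hence the
    Lipschitz bound on the ball of radius [r + 1]. *)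
Lemma subgradient_enorm_le (f : Rn -> R) (x v : Rn) (r M : R) : 0 <= M ->
  (forall y y', enorm y <= r + 1 -> enorm y' <= r + 1 ->
    `|f y - f y'| <= M * enorm (y - y')) ->
  enorm x <= r -> subdiff (fun y => (f y)%:E) x v -> enorm v <= M.
Proof.
move=> M0 fM xr /subdiff_EFin fv.
have [->//|vn0] := eqVneq (enorm v) 0.
have v0 : 0 < enorm v by rewrite lt_neqAle eq_sym vn0 enorm_ge0.
pose e := (enorm v)^-1 *: v.
have e1 : enorm e = 1 by rewrite enormZ ger0_norm ?invr_ge0 ?enorm_ge0// mulVf.
have := fv (e + x); rewrite addrK dotpZr -enorm_sqr => h.
have ex : enorm (e + x) <= r + 1.
  by rewrite (le_trans (enormD _ _))// e1 addrC lerD2r.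
have := fM (e + x) x ex; rewrite addrK e1 mulr1 => /(_ ltac:(lra)).
rewrite expr2 mulrA mulVf// mul1r in h.
by move=> /(le_trans (ler_norm _)); lra.
Qed.

Lemma cvg_dotp (U : set_system nat) (FU : Filter U) (v y : nat -> Rn) v0 y0 :
  v @ U --> v0 -> y @ U --> y0 ->
  (fun j => dotp (v j) (y j)) @ U --> dotp v0 y0.
Proof.
move=> cv cy; rewrite /dotp.
elim: (index_enum _) => [|i r IH].
  by rewrite big_nil; under eq_fun do rewrite big_nil; exact: cvg_cst.
rewrite big_cons; under eq_fun do rewrite big_cons.
apply: cvgD IH; apply: cvgM.
  exact: (cvg_comp _ _ cv (@coord_continuous R 1 n 0 i v0)).
exact: (cvg_comp _ _ cy (@coord_continuous R 1 n 0 i y0)).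
Qed.

Lemma lsc_limit (f : Rn -> \bar R) (U : set_system nat) (FU : ProperFilter U)
    (y : nat -> Rn) p (c : nat -> R) c0 : lower_semicontinuous f ->
  y @ U --> p -> c @ U --> c0 -> (\forall j \near U, (f (y j) <= (c j)%:E)%E) ->
  (f p <= c0%:E)%E.
Proof.
move=> lf yp cc fc; rewrite leNgt; apply/negP => cf.
have [m cm mf] : exists2 m : R, c0 < m & (m%:E < f p)%E.
  case: (f p) cf => [t||]//; last by exists (c0 + 1); rewrite ?ltry// ltrDl.
  rewrite lte_fin => ct; exists ((c0 + t) / 2); rewrite ?lte_fin; lra.
have [V Vp Vf] := lf _ _ mf.
have [j [[fj Vj] cj]] := filter_ex
  (filterI (filterI fc (yp V Vp)) (cvgr_lt c0 cc m cm)).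
have := Vf _ Vj; rewrite ltNge => /negP; apply.
by apply: le_trans fj _; rewrite lee_fin ltW.
Qed.

(** Lower semicontinuity bounds [r p] by the limit of the inequalities. The point [q0] provides one
    finite bound, which makes [r p] finite before the inequalities can be rearranged. *)
Lemma subdiff_limit (f : Rn -> R) (r : Rn -> \bar R) (U : set_system nat)
    (FU : ProperFilter U) (y v : nat -> Rn) p v0 q0 :
  continuous f -> (forall q, r q != -oo)%E -> lower_semicontinuous r ->
  y @ U --> p -> v @ U --> v0 -> (forall j, r (y j) \is a fin_num) ->
  r q0 \is a fin_num ->
  (forall q e, r q \is a fin_num -> 0 < e -> \forall j \near U,
    f (y j) + fine (r (y j)) + dotp (v j) (q - y j) - e <= f q + fine (r q)) ->
  subdiff (fun q => (f q)%:E + r q)%E p v0.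
Proof.
move=> cf rNy lr yp vv0 ry rq0 H.
have key q : r q \is a fin_num ->
    (r p <= (f q + fine (r q) - f p - dotp v0 (q - p))%:E)%E.
  move=> rq; apply/lee_addgt0Pr => e e0; rewrite -EFinD.
  apply: (@lsc_limit r U _ y p (fun j => f q + fine (r q) - f (y j) -
    dotp (v j) (q - y j) + e)) => //.
    apply: cvgD; last exact: cvg_cst.
    apply: cvgB; last by apply: cvg_dotp => //; apply: cvgB => //; exact: cvg_cst.
    by apply: cvgB; [exact: cvg_cst|exact: (cvg_comp _ _ yp (cf p))].
  apply: filterS (H q e rq e0) => j; rewrite -{2}(fineK (ry j)) lee_fin; lra.
have rp : r p \is a fin_num.
  by rewrite fin_numE rNy lt_eqF// (le_lt_trans (key _ rq0))// ltry.
split => [|q].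
  by rewrite -(fineK rp) -EFinD ltry.
have := rNy q; case rqE : (r q) => [t||]// _; last by rewrite addey// leey.
have := key q; rewrite rqE => /(_ isT) /=.
rewrite -(fineK rp) -!EFinD !lee_fin; lra.
Qed.

(** Along an ultrafilter the bounded sequence of aggregated subgradients converges as well, so no
    further subsequence has to be extracted. The filter [W] is generated by the preimages of
    neighbourhoods of [p] and by the tails. *)
Lemma cluster_ultra (y : nat -> Rn) p : cluster (y @ \oo) p ->
  exists2 U : set_system nat, UltraFilter U &
    (forall A, (\forall j \near \oo, A j) -> U A) /\ y @ U --> p.
Proof.
move=> yp.
pose W : set_system nat := [set C | exists B A, [/\ nbhs p B,
  (\forall j \near \oo, A j) & forall j, B (y j) -> A j -> C j]].
have PW : ProperFilter W.
  split.
    move=> [B [A [Bp Aoo H]]].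
    have yA : (y @ \oo) (y @` A).
      by apply: filterS Aoo => j Aj; exists j.
    by have [_ [[j Aj <-] Bj]] := yp _ _ yA Bp; exact: H j Bj Aj.
  split.
  - by exists setT, setT; split => //; exact: filterT.
  - move=> C C' [B [A [Bp Aoo H]]] [B' [A' [Bp' Aoo' H']]].
    exists (B `&` B'), (A `&` A'); split; [exact: filterI|exact: filterI|].
    by move=> j [b b'] [c c']; split; [exact: H|exact: H'].
  - move=> C C' CC' [B [A [Bp Aoo H]]]; exists B, A; split => // j b c.
    exact/CC'/H.
have [U [uU WU]] := ultraFilterLemma PW.
exists U => //; split.
  by move=> A Aoo; apply: WU; exists setT, A; split => //; exact: filterT.
move=> B Bp; apply: WU; exists B, setT; split => //; exact: filterT.
Qed.

Lemma bounded_ultra_cvg (v : nat -> Rn) (M : R) (U : set_system nat) :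
  UltraFilter U -> (forall j, enorm (v j) <= M) -> exists v0 : Rn, v @ U --> v0.
Proof.
move=> uU vM.
pose A := [set w : Rn | enorm w <= M].
have cA : compact A.
  apply: bounded_closed_compact.
    exists M; split; first exact: num_real.
    move=> y My w Aw; apply: le_trans (norm_le_enorm w) _.
    by apply: le_trans Aw _; exact: ltW.
  have -> : A = (@enorm R n) @^-1` [set t | t <= M] by [].
  by apply: closed_comp; [move=> ? _; exact: continuous_enorm|exact: closed_le].
have vA : (v @ U) A by apply: (@filterE _ U) => j; exact: vM.
have [v0 [_ cv0]] := cA (v @ U) _ vA.
exists v0 => B Bv0.
have [//|UB] := in_ultra_setVsetC (v @^-1` B) uU.
by have [w [nB Bw]] := cv0 (~` B) B UB Bv0.
Qed.

Lemma limn_esup_lty_bounded (v : nat -> Rn) :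
  (limn_esup (fun k => (enorm (v k))%:E) < +oo)%E ->
  exists M, forall k, enorm (v k) <= M.
Proof.
move=> /ereal_inf_lt[_ [A [N _ NA] <-] supA].
have [M HM] : exists M : R, forall k, (N <= k)%N -> enorm (v k) <= M.
  have ub k : (N <= k)%N ->
      ((enorm (v k))%:E <= ereal_sup ((fun k => (enorm (v k))%:E) @` A))%E.
    by move=> Nk; apply: ereal_sup_ubound; exists k => //; exact: NA.
  case: (ereal_sup _) supA ub => [t||]// _ ub.
    by exists t => k Nk; rewrite -lee_fin ub.
  by exists 0 => k Nk; have := ub k Nk; rewrite leeNy_eq.
exists (Num.max M (\sum_(i < N) enorm (v i))) => k.
have [Nk|kN] := leqP N k; first by rewrite le_max HM.
rewrite le_max; apply/orP; right; rewrite (bigD1 (Ordinal kN))//= lerDl.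
by rewrite sumr_ge0// => i _; exact: enorm_ge0.
Qed.

End limits.

(** * Limit points along one sample path *)

Section path_limit.
Context {R : realType} {n : nat} {Omega : Type}.
Local Notation Rn := 'rV[R]_n.
Variables (alpha : nat -> R).
Hypothesis alpha_gt0 : forall k, 0 < alpha k.

Lemma enorm_wmean_le (v : nat -> Rn) (c : nat -> R) k :
  (forall i, enorm (v i) <= c i) ->
  enorm (wmean alpha v k) <= wmean alpha (c : nat -> R^o) k.
Proof.
move=> vc; rewrite !wmean_sum; apply: le_trans (enorm_sum _ _) _.
apply: ler_sum => i _; rewrite enormZ ger0_norm ?wmean_weight_ge0//.
exact: ler_wpM2l (wmean_weight_ge0 alpha_gt0 _ _) _ _ (vc _).
Qed.

Definition mean_dist (x : nat -> Rn) k : R :=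
  wmean alpha (fun i => enorm (x k.+1 - x i) : R^o) k.

Lemma mean_dist_ge0 (x : nat -> Rn) k : 0 <= mean_dist x k.
Proof.
rewrite -[leLHS](wmean_cst alpha_gt0 (V := R^o) 0 k).
by apply: ler_wmean => // i; exact: enorm_ge0.
Qed.

(** Young's inequality, from [(t - e) ^ 2 >= 0]. The free parameter keeps the bound linear in the
    spread. *)
Lemma mean_dist_le (x : nat -> Rn) k (e : R) : 0 < e ->
  mean_dist x k <= e / 2 + spread alpha x k / (2 * e).
Proof.
move=> e0; rewrite -[e / 2](wmean_cst alpha_gt0 (V := R^o) _ k).
rewrite /spread [_ / (2 * e)]mulrC -[(2 * e)^-1 * _](wmeanZ alpha (V := R^o)) -wmeanD.
apply: ler_wmean => // i; set t := enorm _.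
have : 0 <= (t - e) ^+ 2 / (2 * e) by rewrite divr_ge0 ?sqr_ge0// mulr_ge0// ltW.
have -> : (t - e) ^+ 2 / (2 * e) = t ^+ 2 / (2 * e) - t + e / 2.
  by field; rewrite gt_eqF.
by rewrite /GRing.scale /= [_^-1 * _]mulrC; lra.
Qed.

Variables (g h : Rn -> Omega -> R) (r1 r2 : Rn -> \bar R).
Variables (s : nat -> Omega) (x z u : nat -> Rn).
Hypothesis r1Ny : forall y, (r1 y != -oo)%E.
Hypothesis r2Ny : forall y, (r2 y != -oo)%E.
Hypothesis x_start : (r1 (x 0) < +oo)%E.
Hypothesis z_sub : forall k, subdiff (fun y => (h y (s k))%:E) (x k) (z k).
Hypothesis u_sub : forall k, subdiff r2 (x k) (u k).

Let gk k y : R := wmean alpha (fun i => g y (s i) : R^o) k.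
Let hk k y : R := wmean alpha (fun i => h y (s i) : R^o) k.
Let sl := slope alpha z u.

Hypothesis x_step : forall k, minimizer
  (fun y => (gk k y)%:E + r1 y - (dotp (sl k) y)%:E)%E (x k.+1).

Let r1x k : r1 (x k) \is a fin_num.
Proof. exact: (@path_r1_fin R n Omega alpha g r1 s x z u r1Ny x_start x_step). Qed.

Let r2x k : r2 (x k) \is a fin_num.
Proof. exact: (@path_r2_fin R n r2 x u r2Ny u_sub). Qed.

Lemma step_subgradient k q : r1 q \is a fin_num ->
  gk k (x k.+1) + fine (r1 (x k.+1)) + dotp (sl k) (q - x k.+1)
    <= gk k q + fine (r1 q).
Proof.
move=> r1q; have := x_step k q; rewrite -(fineK r1q) -(fineK (r1x k.+1)).
rewrite -!EFinD lee_fin dotpBr /=; lra.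
Qed.

Variables (r M Mu : R).
Hypothesis M_ge0 : 0 <= M.
Hypothesis x_ball : forall k, enorm (x k) <= r.
Hypothesis h_lip : forall y y' t, enorm y <= r + 1 -> enorm y' <= r + 1 ->
  `|h y t - h y' t| <= M * enorm (y - y').
Hypothesis u_bound : forall k, enorm (u k) <= Mu.

Let x_ball1 k : enorm (x k) <= r + 1.
Proof. by rewrite (le_trans (x_ball k))// lerDl. Qed.

Let z_bound k : enorm (z k) <= M.
Proof.
apply: (@subgradient_enorm_le _ _ (h ^~ (s k)) (x k) (z k) r M M_ge0) => //.
by move=> y y'; exact: h_lip.
Qed.

Lemma slope_bound k : enorm (sl k) <= M + Mu.
Proof.
rewrite /sl /slope; apply: le_trans (enormD _ _) _; apply: lerD.
  apply: le_trans (enorm_wmean_le k z_bound) _.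
  by rewrite (wmean_cst alpha_gt0 (V := R^o)).
apply: le_trans (enorm_wmean_le k u_bound) _.
by rewrite (wmean_cst alpha_gt0 (V := R^o)).
Qed.

(** [sl k] averages subgradients taken at [x i], and the base point is moved to [x k.+1]. Four
    increments over [x k.+1 - x i] are paid for: those of [h] and of the product with [z i] cost [M]
    each, those of [r2] and of the product with [u i] cost [Mu] each. *)
Lemma second_component_subgradient k q : r2 q \is a fin_num ->
  hk k (x k.+1) + fine (r2 (x k.+1)) + dotp (sl k) (q - x k.+1)
    - 2 * (M + Mu) * mean_dist x k <= hk k q + fine (r2 q).
Proof.
move=> r2q.
have -> : hk k (x k.+1) + fine (r2 (x k.+1)) + dotp (sl k) (q - x k.+1) -
    2 * (M + Mu) * mean_dist x k = wmean alpha (fun i =>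
      h (x k.+1) (s i) + fine (r2 (x k.+1)) + dotp (z i + u i) (q - x k.+1)
      - 2 * (M + Mu) * enorm (x k.+1 - x i) : R^o) k.
  rewrite (wmeanB alpha (V := R^o)) !(wmeanD alpha (V := R^o)).
  rewrite (wmeanZ alpha (V := R^o)) (wmean_cst alpha_gt0 (V := R^o)).
  congr (_ + _ - _); rewrite /sl /slope -wmeanD !wmean_sum dotp_suml.
  by apply: eq_bigr => i _; rewrite dotpZl.
have -> : hk k q + fine (r2 q) = wmean alpha (fun i => h q (s i) + fine (r2 q) : R^o) k.
  by rewrite (wmeanD alpha (V := R^o)) (wmean_cst alpha_gt0 (V := R^o)).
apply: ler_wmean => // i.
have /subdiff_EFin/(_ q) H1 := z_sub i.
have H2 := h_lip (s i) (x_ball1 k.+1) (x_ball1 i).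
have [_ /(_ q)] := u_sub i.
rewrite -(fineK r2q) -(fineK (r2x i)) -EFinD lee_fin => H3.
(* No Lipschitz bound is available for [r2]. The increment from [x i] to [x k.+1] is controlled by
   the bounded subgradient at the new point. *)
have [_ /(_ (x i))] := u_sub k.+1.
rewrite -(fineK (r2x i)) -(fineK (r2x k.+1)) -EFinD lee_fin => H4.
move: H2; rewrite ler_norml => /andP[_ H2].
have Z : - (M * enorm (x k.+1 - x i)) <= dotp (z i) (x k.+1 - x i).
  have := normr_dotp_le (z i) (x k.+1 - x i); rewrite ler_norml => /andP[+ _].
  apply: le_trans; rewrite lerN2 ler_wpM2r ?enorm_ge0//.
have U v : enorm v <= Mu -> - (Mu * enorm (x k.+1 - x i)) <= dotp v (x k.+1 - x i).
  move=> vMu; have := normr_dotp_le v (x k.+1 - x i); rewrite ler_norml => /andP[+ _].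
  apply: le_trans; rewrite lerN2 ler_wpM2r ?enorm_ge0//.
have U1 := U _ (u_bound i).
have U2 := U (- u k.+1); rewrite enormN dotpNl in U2; have {}U2 := U2 (u_bound _).
have E y v : dotp v (q - y) = dotp v q - dotp v y by rewrite dotpBr.
rewrite /= !dotpDl !dotpBr in H1 H3 H4 Z U1 U2 *.
lra.
Qed.

Variables (G H : Rn -> R) (l : nat -> nat) (errg errh : nat -> nat -> R).
Hypothesis cG : continuous G.
Hypothesis cH : continuous H.
Hypothesis lr1 : lower_semicontinuous r1.
Hypothesis lr2 : lower_semicontinuous r2.
Hypothesis errgP : forall (m : nat) k y, enorm y <= m%:R ->
  `|gk k y - G y| <= errg m k.
Hypothesis errhP : forall (m : nat) k y, enorm y <= m%:R ->
  `|hk k y - H y| <= errh m k.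
Hypothesis errg0 : forall m, errg m \o l @ \oo --> (0 : R).
Hypothesis errh0 : forall m, errh m \o l @ \oo --> (0 : R).
Hypothesis spread0 : spread alpha x \o l @ \oo --> (0 : R).

Lemma cluster_critical p : cluster ((fun j => x (l j).+1) @ \oo) p ->
  exists2 v, subdiff (fun y => (G y)%:E + r1 y)%E p v &
    subdiff (fun y => (H y)%:E + r2 y)%E p v.
Proof.
move=> /cluster_ultra[U uU [Uoo yp]].
have [v vv] := bounded_ultra_cvg uU (fun j => slope_bound (l j)).
(* The uniform errors are available on balls of integer radius only; each test point [q] selects a
   ball that contains it and the whole path. *)
have large (q : Rn) : exists m : nat, enorm q <= m%:R /\ forall k, enorm (x k) <= m%:R.
  exists (Num.truncn (enorm q + `|r|)).+1.
  have qr : 0 <= enorm q + `|r| by rewrite addr_ge0 ?enorm_ge0.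
  have /andP[_ /ltW hm] := truncn_itv qr.
  split=> [|k]; first by rewrite (le_trans _ hm)// lerDl.
  rewrite (le_trans _ hm)// (le_trans (x_ball k))// (le_trans (ler_norm _))// lerDr.
  exact: enorm_ge0.
exists v.
- apply: (@subdiff_limit _ _ G r1 U _ (fun j => x (l j).+1) (sl \o l) p v (x 0)) => //.
  move=> q e r1q e0; have [m [qm xm]] := large q.
  have e20 : 0 < e / 2 by rewrite divr_gt0.
  apply: Uoo; apply: filterS (cvgr_lt _ (errg0 m) _ e20) => j /= ej.
  have := step_subgradient (l j) r1q.
  have := errgP (l j) qm; have := errgP (l j) (xm (l j).+1).
  rewrite !ler_norml => /andP[h1 h2] /andP[h3 h4]; lra.
- apply: (@subdiff_limit _ _ H r2 U _ (fun j => x (l j).+1) (sl \o l) p v (x 0)) => //.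
  move=> q e r2q e0; have [m [qm xm]] := large q.
  have e40 : 0 < e / 4 by rewrite divr_gt0.
  (* The budget [e] receives a quarter from each of two errors of the law and a quarter from the
     displacement term; the added 1 makes [M'] positive. A spread below [e1 ^ 2] gives a mean
     distance of at most [e1]. *)
  pose M' := 2 * (M + Mu) + 1.
  have MMu : 0 <= M + Mu by rewrite (le_trans _ (slope_bound 0%N))// enorm_ge0.
  have M'0 : 0 < M' by rewrite /M'; lra.
  pose e1 := e / (4 * M').
  have e10 : 0 < e1 by rewrite divr_gt0// mulr_gt0.
  have e12 : 0 < e1 ^+ 2 by rewrite exprn_gt0.
  apply: Uoo; apply: filterS2 (cvgr_lt _ (errh0 m) _ e40)
    (cvgr_lt _ spread0 _ e12) => j /= ej sj.
  have := second_component_subgradient (l j) r2q.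
  have := errhP (l j) qm; have := errhP (l j) (xm (l j).+1).
  rewrite !ler_norml => /andP[h1 h2] /andP[h3 h4].
  have d1 : mean_dist x (l j) <= e1.
    apply: le_trans (mean_dist_le x (l j) e10) _.
    have : spread alpha x (l j) / (2 * e1) <= e1 ^+ 2 / (2 * e1).
      by rewrite ler_wpM2r ?(ltW sj)// invr_ge0 mulr_ge0// ltW.
    have -> : e1 ^+ 2 / (2 * e1) = e1 / 2 by field; rewrite gt_eqF.
    lra.
  have d2 : 2 * (M + Mu) * mean_dist x (l j) <= e / 4.
    apply: (@le_trans _ _ (M' * e1)).
      by rewrite ler_pM ?mean_dist_ge0 ?mulr_ge0// /M'; lra.
    by rewrite /e1 le_eqVlt; apply/orP; left; apply/eqP; field; rewrite gt_eqF.
  lra.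
Qed.

End path_limit.

(** * Sum rules and gradients *)

Section sum_rule.
Context {R : realType} {n : nat}.
Local Notation Rn := 'rV[R]_n.

(* Hahn-Banach, one coordinate at a time: the slope along the k-th axis is a
   supremum of lower difference quotients. *)
Lemma real_convex_subgradient (f : Rn -> R) x : real_convex f ->
  exists v, forall y, f x + dotp v (y - x) <= f y.
Proof.
move=> cf.
pose V k : set Rn := [set d | forall j : 'I_n, (k <= j)%N -> d 0 j = 0].
have ext k : (k <= n)%N ->
    exists v, forall e, V k e -> f x + dotp v e <= f (x + e).
  elim: k => [_|k IH kn].
    exists 0 => e Ve; have -> : e = 0 by apply/rowP => j; rewrite mxE Ve.
    by rewrite dotp0l !addr0.
  have [v Hv] := IH (ltnW kn).
  pose ek : Rn := delta_mx 0 (Ordinal kn).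
  pose low := [set q | exists e t, [/\ V k e, 0 < t &
    q = (f x + dotp v e - f (x + e - t *: ek)) / t]].
  (* Lower quotients lie below upper ones: with weight [t' / (t + t')] the components along the new
     axis cancel, and the bound already known on [V k] applies to the combination. *)
  have sep e e' t t' : V k e -> V k e' -> 0 < t -> 0 < t' ->
      (f x + dotp v e - f (x + e - t *: ek)) / t <=
      (f (x + e' + t' *: ek) - f x - dotp v e') / t'.
    move=> Ve Ve' t0 t'0; have tt0 : 0 < t + t' by rewrite addr_gt0.
    pose l := t' / (t + t').
    have l01 : 0 <= l <= 1.
      rewrite divr_ge0 ?(ltW t'0) ?(ltW tt0)//= ler_pdivrMr// mul1r; lra.
    have := cf (x + e - t *: ek) (x + e' + t' *: ek) l l01.
    have -> : l *: (x + e - t *: ek) + (1 - l) *: (x + e' + t' *: ek) =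
        x + (l *: e + (1 - l) *: e').
      by apply/rowP => j; rewrite !mxE /l; field; rewrite gt_eqF.
    have : V k (l *: e + (1 - l) *: e').
      by move=> j kj; rewrite !mxE Ve// Ve'// !mulr0 addr0.
    move=> /Hv/le_trans/[apply]; rewrite dotpDr !dotpZr => H.
    rewrite ler_pdivrMr// mulrAC ler_pdivlMr//.
    have H' : (f x + (l * dotp v e + (1 - l) * dotp v e')) * (t + t') <=
       (l * f (x + e - t *: ek) + (1 - l) * f (x + e' + t' *: ek)) * (t + t').
      by rewrite ler_wpM2r// ltW.
    have E1 : l * (t + t') = t' by rewrite /l divfK// gt_eqF.
    have E2 (q q' : R) : (l * q + (1 - l) * q') * (t + t') = t' * q + t * q'.
      have -> : (l * q + (1 - l) * q') * (t + t') =
        q * (l * (t + t')) + q' * (t + t' - l * (t + t')) by ring.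
      by rewrite E1; ring.
    move: H'; rewrite mulrDl !E2; lra.
  have V0 : V k 0 by move=> j _; rewrite mxE.
  have low_ub e' t' : V k e' -> 0 < t' ->
      ubound low ((f (x + e' + t' *: ek) - f x - dotp v e') / t').
    by move=> Ve' t'0 _ [e [t [Ve t0 ->]]]; exact: sep.
  have hs : has_sup low.
    split; first by exists ((f x + dotp v 0 - f (x + 0 - 1 *: ek)) / 1), 0, 1.
    by exists ((f (x + 0 + 1 *: ek) - f x - dotp v 0) / 1); exact: low_ub.
  (* The coordinate of [v] along the new axis is unconstrained so far, so it is subtracted to make
     the total slope there equal to [sup low]. *)
  pose al := sup low - v 0 (Ordinal kn).
  exists (v + al *: ek) => e Ve.
  pose c := e 0 (Ordinal kn); pose e' := e - c *: ek.
  have Ve' : V k e'.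
    move=> j kj; rewrite !mxE; have [->|jk] := eqVneq j (Ordinal kn).
      by rewrite mulr1 subrr.
    rewrite mulr0 subr0 Ve// ltn_neqAle kj andbT; apply: contra jk => /eqP jk.
    by apply/eqP/val_inj.
  have eE : e = e' + c *: ek by rewrite /e' subrK.
  have fe : x + e' + c *: ek = x + e by rewrite -addrA -eE.
  have dek (p : Rn) : dotp p ek = p 0 (Ordinal kn).
    rewrite /dotp (bigD1 (Ordinal kn))//= big1 ?mxE ?eqxx ?mulr1 ?addr0// => j jk.
    by rewrite mxE (negbTE jk) andbF mulr0.
  have -> : dotp (v + al *: ek) e = dotp v e' + c * sup low.
    rewrite dotpDl dotpZl (dotpC ek) dek {1}eE dotpDr dotpZr dek -/c /al; ring.
  have [c0|c0|c0] := ltrgtP c 0.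
  - have Nc : 0 < - c by rewrite oppr_gt0.
    have : (f x + dotp v e' - f (x + e' - (- c) *: ek)) / (- c) <= sup low.
      by apply: sup_upper_bound => //; exists e', (- c).
    rewrite scaleNr opprK fe ler_pdivrMr//; lra.
  - have : sup low <= (f (x + e' + c *: ek) - f x - dotp v e') / c.
      by apply: sup_le_ub; [case: hs|exact: low_ub].
    rewrite fe ler_pdivlMr//; lra.
  - by rewrite -fe c0 mul0r scale0r !addr0; exact: Hv.
have [v Hv] := ext n (leqnn n); exists v => y.
rewrite -[y in leRHS](subrK x) [y - x + x]addrC; apply: Hv.
by move=> j; rewrite leqNgt ltn_ord.
Qed.

Lemma convex_ext_fine (r : Rn -> \bar R) x y (l : R) :
  (forall q, r q != -oo)%E -> convex_ext r -> r x \is a fin_num ->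
  r y \is a fin_num -> 0 <= l <= 1 ->
  r (l *: x + (1 - l) *: y) \is a fin_num /\
  fine (r (l *: x + (1 - l) *: y)) <= l * fine (r x) + (1 - l) * fine (r y).
Proof.
move=> rNy cr rx ry l01; have := cr x y l l01.
rewrite -{1}(fineK rx) -{1}(fineK ry) -!EFinM -!EFinD !mul0r subr0 => H.
have rf : r (l *: x + (1 - l) *: y) \is a fin_num.
  by rewrite fin_numE rNy lt_eqF// (le_lt_trans H)// ltry.
by split => //; rewrite -lee_fin fineK.
Qed.

(* [f d = inf_y (G (y + d) + r y - <v, y>)] is a finite convex function, with
   value at 0 attained at [x]; any subgradient of [f] at 0 splits [v]. *)
Lemma subgradient_sum_rule (G : Rn -> R) (r : Rn -> \bar R) x v :
  real_convex G -> (forall q, r q != -oo)%E -> convex_ext r ->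
  r x \is a fin_num ->
  (forall y, r y \is a fin_num ->
    G x + fine (r x) + dotp v (y - x) <= G y + fine (r y)) ->
  exists a, subdiff (EFin \o G) x a /\ subdiff r x (v - a).
Proof.
move=> cG rNy cr rx Hv.
pose val d y := G (y + d) + fine (r y) - dotp v y.
pose S d := [set val d y | y in [set y | r y \is a fin_num]].
have Hv' y : r y \is a fin_num -> val 0 x <= val 0 y.
  by move=> ry; have := Hv y ry; rewrite /val !addr0 dotpBr; lra.
have h2 : 0 <= (1 / 2 : R) <= 1 by lra.
(* Finiteness of the infimum: the shifts of [y + d] and [x - d] cancel at the midpoint, where the
   assumed inequality holds. *)
have lb d y : r y \is a fin_num -> 2 * val 0 x - val (- d) x <= val d y.
  move=> ry; have [rp Hp] := convex_ext_fine rNy cr ry rx h2.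
  have := Hv' _ rp; have := cG (y + d) (x - d) (1 / 2) h2.
  have -> : 1 / 2 *: (y + d) + (1 - 1 / 2) *: (x - d) =
      1 / 2 *: y + (1 - 1 / 2) *: x.
    by apply/rowP => j; rewrite !mxE; field.
  rewrite /val !addr0 dotpDr !dotpZr; lra.
have hi d : has_inf (S d).
  split; first by exists (val d x), x.
  by exists (2 * val 0 x - val (- d) x) => _ [y ry <-]; exact: lb.
pose f d := inf (S d).
have f_le d y : r y \is a fin_num -> f d <= val d y.
  by move=> ry; apply: ge_inf; [case: (hi d)|exists y].
have f0 : f 0 = val 0 x.
  apply/eqP; rewrite eq_le f_le//=; apply: lb_le_inf; first by case: (hi 0).
  by move=> _ [y ry <-]; exact: Hv'.
have cf : real_convex f.
  move=> d1 d2 l l01; apply/ler_addgt0Pr => e e0.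
  have [_ [y1 ry1 <-] H1] := inf_adherent e0 (hi d1).
  have [_ [y2 ry2 <-] H2] := inf_adherent e0 (hi d2).
  have [rp Hp] := convex_ext_fine rNy cr ry1 ry2 l01.
  apply: le_trans (f_le _ _ rp) _; rewrite /val.
  have := cG (y1 + d1) (y2 + d2) l l01.
  have -> : l *: (y1 + d1) + (1 - l) *: (y2 + d2) =
     l *: y1 + (1 - l) *: y2 + (l *: d1 + (1 - l) *: d2).
    by apply/rowP => j; rewrite !mxE; ring.
  case/andP: l01 => l0 l1; have l1' : 0 <= 1 - l by rewrite subr_ge0.
  have := ler_wpM2l l0 (ltW H1); have := ler_wpM2l l1' (ltW H2).
  rewrite -/(f d1) -/(f d2) /val dotpDr !dotpZr; lra.
(* The shift [y - x] tested at the point [x] isolates [G]; the shift [x - y] tested at the point [y]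
   isolates [r]. *)
have [a Ha] := real_convex_subgradient 0 cf.
exists a; split.
  apply/subdiff_EFin => y.
  have := Ha (y - x); have := f_le (y - x) x rx.
  by rewrite f0 subr0 /val addr0 (addrC x) subrK; lra.
split => [|y]; first by rewrite -(fineK rx) ltry.
have := rNy y; case ryE : (r y) => [q||]// _; last by rewrite leey.
have ry : r y \is a fin_num by rewrite ryE.
rewrite -(fineK rx) -EFinD lee_fin.
have := Ha (x - y); have := f_le (x - y) y ry.
rewrite f0 subr0 /val addr0 (addrC y) subrK ryE /= dotpBl !dotpBr; lra.
Qed.

End sum_rule.

(** * Gradients as limits of difference quotients *)

Section gradients.
Context {R : realType} {n : nat}.
Local Notation Rn := 'rV[R]_n.
Implicit Types (f : Rn -> R) (x v w : Rn).

(** A sequence of steps, so that partial derivatives depend measurably on a parameter as limits of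
    sequences. *)
Definition diff_quotient f x w (k : nat) : R :=
  k.+1%:R * (f (x + k.+1%:R^-1 *: w) - f x).

Lemma diff_quotient_cvg f x w : differentiable (f : Rn -> R^o) x ->
  diff_quotient f x w @ \oo --> dotp (gradient f x) w.
Proof.
move=> df.
have Dw : 'D_w (f : Rn -> R^o) x = dotp (gradient f x) w.
  rewrite deriveE// {1}(row_sum_delta w) linear_sum; apply: eq_bigr => j _.
  by rewrite linearZ /= mxE deriveE// [RHS]mulrC.
have : (fun t : R => t^-1 *: (((f : Rn -> R^o) \o shift x) (t *: w) - f x)) @ 0^' -->
    'D_w (f : Rn -> R^o) x by exact: (diff_derivable df).
rewrite Dw => H.
have c0 : (fun k : nat => k.+1%:R^-1 : R) @ \oo --> 0^'.
  move=> A /= [e e0 Ae]; have := near_infty_natSinv_lt (PosNum e0).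
  apply: filterS => k /= ke; apply: Ae => /=; last by rewrite invr_eq0.
  by rewrite sub0r normrN ger0_norm.
have -> : diff_quotient f x w =
    (fun t : R => t^-1 *: (((f : Rn -> R^o) \o shift x) (t *: w) - f x)) \o
    (fun k : nat => k.+1%:R^-1 : R).
  by apply/funext => k; rewrite /diff_quotient /= invrK [_ *: w + x]addrC.
exact: cvg_comp c0 H.
Qed.

(** The inequality is required near [x] only: for [fine \o r2] it would be meaningless at points of
    infinite value. Directions [w] and [- w] together give equality. *)
Lemma gradient_unique f x v : differentiable (f : Rn -> R^o) x ->
  (\forall y \near x, f x + dotp v (y - x) <= f y) -> v = gradient f x.
Proof.
move=> df fv.
have le w : dotp v w <= dotp (gradient f x) w.
  have cw := @diff_quotient_cvg f x w df.
  apply: (cvgr_to_ge cw).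
  have : (fun k : nat => x + k.+1%:R^-1 *: w) @ \oo --> x.
    have H1 : (fun k : nat => k.+1%:R^-1 *: w) @ \oo --> (0 : R) *: w.
      exact: cvgZr_tmp (@cvg_harmonic R).
    have := cvgD (cvg_cst x) H1; rewrite scale0r addr0; exact.
  move=> /(_ _ fv)[N _ HN]; exists N => // k /HN /=.
  rewrite [x + _ - x]addrAC subrr add0r dotpZr /diff_quotient => h.
  have k0 : 0 < k.+1%:R :> R by [].
  by rewrite -ler_pdivrMl// lerBrDl.
have eq w : dotp v w = dotp (gradient f x) w.
  apply/eqP; rewrite eq_le le /=; have := le (- w); rewrite !dotpNr; lra.
apply/rowP => j; have := eq (delta_mx 0 j).
have dd (p : Rn) : dotp p (delta_mx 0 j) = p 0 j.
  rewrite /dotp (bigD1 j)//= big1 ?mxE ?eqxx ?mulr1 ?addr0// => i ij.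
  by rewrite mxE (negbTE ij) andbF mulr0.
by rewrite !dd.
Qed.

Lemma diff_quotient_le f x y k : real_convex f ->
  diff_quotient f x (y - x) k <= f y - f x.
Proof.
move=> cf; have k0 : 0 < k.+1%:R :> R by [].
have l01 : 0 <= (k.+1%:R^-1 : R) <= 1.
  by rewrite invr_ge0 ltW//= invf_le1// ler1n.
have := cf y x _ l01; set l := _^-1.
have -> : l *: y + (1 - l) *: x = x + l *: (y - x).
  by apply/rowP => j; rewrite !mxE; ring.
move=> h; rewrite /diff_quotient -/l -ler_pdivlMl// -/l; lra.
Qed.

Lemma gradient_subdiff f x : real_convex f -> differentiable (f : Rn -> R^o) x ->
  subdiff (EFin \o f) x (gradient f x).
Proof.
move=> cf df; apply/subdiff_EFin => y.
have := @diff_quotient_cvg f x (y - x) df => H.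
have : dotp (gradient f x) (y - x) <= f y - f x.
  by apply: (cvgr_to_le H); near=> k; exact: diff_quotient_le.
lra.
Unshelve. all: by end_near. Qed.

Lemma gradient_coord_cvg f x j : differentiable (f : Rn -> R^o) x ->
  diff_quotient f x (delta_mx 0 j) @ \oo --> gradient f x 0 j.
Proof.
move=> df; have := @diff_quotient_cvg f x (delta_mx 0 j) df.
suff -> : dotp (gradient f x) (delta_mx 0 j) = gradient f x 0 j by [].
rewrite /dotp (bigD1 j)//= big1 ?[delta_mx 0 j 0 j]mxE ?eqxx ?mulr1 ?addr0// => i ij.
by rewrite [delta_mx 0 j 0 i]mxE (negbTE ij) andbF mulr0.
Qed.

(** In contrast to the general sum rule, the part of [v] attributed to [f] is prescribed. The
    inequality is tested at [x + (y - x) / (k + 1)], where convexity bounds [r], and the quotients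
    pass to the limit. *)
Lemma smooth_sum_rule (f : Rn -> R) (r : Rn -> \bar R) x v (w : Rn)  :
  (forall q, r q != -oo)%E -> convex_ext r -> r x \is a fin_num ->
  (forall e, diff_quotient f x e @ \oo --> dotp w e) ->
  (forall y, r y \is a fin_num ->
    f x + fine (r x) + dotp v (y - x) <= f y + fine (r y)) ->
  subdiff r x (v - w).
Proof.
move=> rNy cr rx fw Hv; split=> [|y]; first by rewrite -(fineK rx) ltry.
have := rNy y; case ryE : (r y) => [q||]// _; last by rewrite leey.
have ry : r y \is a fin_num by rewrite ryE.
rewrite -(fineK rx) -EFinD lee_fin.
suff : dotp v (y - x) + fine (r x) - fine (r y) <= dotp w (y - x).
  by rewrite ryE /= dotpBl; lra.
apply: (cvgr_to_ge (fw (y - x))); near=> k.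
have k0 : 0 < k.+1%:R :> R by [].
have l01 : 0 <= (k.+1%:R^-1 : R) <= 1.
  by rewrite invr_ge0 ltW//= invf_le1// ler1n.
have := convex_ext_fine rNy cr ry rx l01; set l := _^-1.
have -> : l *: y + (1 - l) *: x = x + l *: (y - x).
  by apply/rowP => j; rewrite !mxE; ring.
move=> [rp Hp]; have := Hv _ rp; rewrite [x + _ - x]addrAC subrr add0r.
rewrite /diff_quotient -/l dotpZr => h.
rewrite -ler_pdivrMl// -/l; lra.
Unshelve. all: by end_near. Qed.

End gradients.

Section integral_bound.
Context {R : realType} {d : measure_display} {T : measurableType d}.
Variable Pr : probability T R.

Import HBNNSimple.

(** Measurability is asked of [q] only. The integral of [f] is the supremum over the simple
    functions below it, and each of these lies below [q] raised to [+oo] on the exceptional null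
    set. *)
Lemma ae_le_integral (f q : T -> \bar R) : (forall w, 0 <= f w)%E ->
  (forall w, 0 <= q w)%E -> measurable_fun [set: T] q ->
  {ae Pr, forall w, (f w <= q w)%E} ->
  (\int[Pr]_w f w <= \int[Pr]_w q w)%E.
Proof.
move=> f0 q0 mq [N [mN N0 fqN]].
pose q' w := if w \in N then +oo%E else q w.
have mq' : measurable_fun [set: T] q'.
  apply: measurable_fun_ifT => //; apply: (measurable_fun_bool true).
  rewrite setTI (_ : _ @^-1` _ = N)//.
  by apply/seteqP; split => w /=; [move/set_mem|move/mem_set].
have q'0 w : (0 <= q' w)%E by rewrite /q'; case: ifP.
have -> : (\int[Pr]_w q w = \int[Pr]_w q' w)%E.
  apply: ge0_ae_eq_integral => //; exists N; split => // w /=.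
  apply: contra_notP => wN _; by rewrite /q' memNset.
rewrite [leLHS]ge0_integralTE//; apply: ub_ereal_sup => _ [k kf <-].
rewrite -integralT_nnsfun.
apply: ge0_le_integral => //; [by move=> w _; rewrite lee_fin|exact/measurable_EFinP|].
move=> w _; apply: le_trans (kf w) _; rewrite /q'; case: ifPn => [_|wN].
  exact: leey.
rewrite notin_setE in wN.
by apply: contrapT => h; apply: wN; exact: fqN.
Qed.

End integral_bound.

(** * The stochastic algorithm *)

Section stochastic.
Context {R : realType} {n : nat}.
Local Notation Rn := 'rV[R]_n.
Context {d : measure_display} {Omega : measurableType d}.
Context {d' : measure_display} {T : measurableType d'}.
Variables (P : probability Omega R) (Pr : probability T R).
Variables (s : nat -> T -> Omega) (F : nat -> set (set T)).
Hypothesis Hs : iid_draws P Pr s.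
Hypothesis HF : history Pr s F.
Variable alpha : nat -> R.
Hypothesis alpha_gt0 : forall k, 0 < alpha k.

Definition convex_integrand (g : Rn -> Omega -> R) :=
  [/\ forall t, real_convex (g ^~ t), forall y, measurable_fun [set: Omega] (g y) &
      forall y, exists B, forall t, `|g y t| <= B].

Lemma convex_integrand_integrable g y : convex_integrand g ->
  P.-integrable setT (EFin \o g y).
Proof.
by move=> [_ mg /(_ y)[B gB]]; exact: bounded_integrable (mg y) gB.
Qed.

Lemma convex_integrand_bounded g r : convex_integrand g ->
  exists2 B, 0 <= B & forall y t, enorm y <= r -> `|g y t| <= B.
Proof.
move=> [cg _ bg].
have [B B0 gB] := real_convex_family_bounded (f := fun t => g ^~ t) cg bg r.
by exists B => // y t; exact: gB.
Qed.

Lemma convex_integrand_lipschitz g r : convex_integrand g ->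
  exists2 M, 0 <= M & forall y y' t, enorm y <= r -> enorm y' <= r ->
    `|g y t - g y' t| <= M * enorm (y - y').
Proof.
move=> [cg _ bg].
have [M M0 gM] := real_convex_family_lipschitz (f := fun t => g ^~ t) cg bg r.
by exists M => // y y' t; exact: gM.
Qed.

Lemma convex_integrand_uniform_law g r : convex_integrand g ->
  exists2 K : R, 0 <= K & exists err : nat -> T -> R,
    [/\ forall k, measurable_fun [set: T] (err k),
        forall k w, 0 <= err k w,
        forall k, (\int[Pr]_w (err k w)%:E <= (K * rate alpha k)%:E)%E &
        forall k w y, enorm y <= r ->
          `|wmean alpha (fun i => g y (s i w) : R^o) k - mean P (g y)|
            <= err k w].
Proof.
move=> cg; have [_ mg _] := cg.
have [B _ gB] := convex_integrand_bounded r cg.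
have [M M0 gM] := convex_integrand_lipschitz r cg.
exact: (uniform_law Hs HF alpha_gt0 (C := [set y | enorm y <= r]) (r := r)
  (fun=> id) (fun y _ => mg y) M0 gB gM).
Qed.

Lemma continuous_mean_diff g h : convex_integrand g -> convex_integrand h ->
  continuous (fun y => mean P (fun t => g y t - h y t)).
Proof.
move=> cg ch; apply: locally_lipschitz_continuous => r.
have [M M0 gM] := convex_integrand_lipschitz r cg.
have [M' M'0 hM] := convex_integrand_lipschitz r ch.
exists (M + M'); first by rewrite addr_ge0.
move=> y y' yr yr'.
have [[_ mg _] [_ mh _]] := (cg, ch).
have I (v : Rn) : P.-integrable setT (EFin \o (fun t => g v t - h v t)).
  have [_ _ /(_ v)[B gB]] := cg; have [_ _ /(_ v)[B' hB]] := ch.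
  apply: (@bounded_integrable _ _ _ P _ (B + B')); first exact: measurable_funB.
  by move=> t; rewrite (le_trans (ler_normB _ _))// lerD.
have lip t : `|g y t - h y t - (g y' t - h y' t)| <= (M + M') * enorm (y - y').
  have -> : g y t - h y t - (g y' t - h y' t) =
    (g y t - g y' t) - (h y t - h y' t) by ring.
  by rewrite (le_trans (ler_normB _ _))// mulrDl lerD ?gM ?hM.
rewrite -meanB//; apply: mean_abs_le => //.
by apply: bounded_integrable lip; apply: measurable_funB; apply: measurable_funB.
Qed.

Variables (g h : Rn -> Omega -> R) (r1 r2 : Rn -> \bar R) (rho1 rho2 : R).
Variables (x z u : nat -> T -> Rn).
Hypothesis cg : convex_integrand g.
Hypothesis ch : convex_integrand h.
Hypothesis r1Ny : forall y, (r1 y != -oo)%E.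
Hypothesis r2Ny : forall y, (r2 y != -oo)%E.
Hypothesis rho1_ge0 : 0 <= rho1.
Hypothesis rho2_ge0 : 0 <= rho2.
Hypothesis rho_gt0 : 0 < rho1 + rho2.
Hypothesis h_rho : forall t, rho_convex rho1 (fun y => (h y t)%:E).
Hypothesis r2_rho : rho_convex rho2 r2.
Hypothesis x_start : exists2 x0 : Rn, (r1 x0 < +oo)%E & forall w, x 0 w = x0.
Hypothesis z_sub : forall k w,
  subdiff (fun y => (h y (s k w))%:E) (x k w) (z k w).
Hypothesis u_sub : forall k w, subdiff r2 (x k w) (u k w).
Hypothesis x_step : forall k w, minimizer (fun y =>
  ((wmean alpha (fun i => g y (s i w) : R^o) k)%:E + r1 y
   - (dotp (slope alpha (z ^~ w) (u ^~ w) k) y)%:E)%E) (x k.+1 w).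
Hypothesis x_known : forall k, known (F k) (x k).
Variable al : R.
Hypothesis al_le : forall y, r1 y \is a fin_num -> r2 y \is a fin_num ->
  al <= mean P (g y) - mean P (h y) + fine (r1 y) - fine (r2 y).
Variable rate_total : R.
Hypothesis rate_summable : forall K,
  \sum_(k < K) alpha k.+1 / weight_sum alpha k.+1 * rate alpha k <= rate_total.

Let a k := alpha k / weight_sum alpha k.

Lemma iterate_measurable_history i k : (i <= k)%N ->
  measurable_coord (x i : g_sigma_algebraType (F k) -> Rn).
Proof.
move=> ik j _ B mB; rewrite (history_measurableE HF) setTI.
exact: (history_le HF ik (x_known i j mB)).
Qed.

Lemma iterate_measurable i : measurable_coord (x i).
Proof.
move=> j; apply: (history_measurable_fun HF (k := i)).
exact: iterate_measurable_history.
Qed.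

(** This event involves the future of the path. Before conditioning on [F k] the larger event
    [in_ball_upto r k], which belongs to [F k], is used in its place. *)
Definition stay_in_ball (r : R) : set T := [set w | forall k, enorm (x k w) <= r].

Let in_ball_upto (r : R) k : set T :=
  [set w | forall i, (i <= k)%N -> enorm (x i w) <= r].

Let in_ball_uptoE r k :
  in_ball_upto r k = \bigcap_(i < k.+1) [set w | enorm (x i w) <= r].
Proof. by apply/seteqP; split => w /= H i ik; apply: H. Qed.

Let ball_measurable d0 (W : measurableType d0) (xi : W -> Rn) r :
  measurable_coord xi -> measurable [set w | enorm (xi w) <= r].
Proof.
move=> /measurable_enorm m.
have -> : [set w | enorm (xi w) <= r] = (fun w => enorm (xi w)) @^-1` `]-oo, r].
  by apply/seteqP; split => w /=; rewrite in_itv.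
by rewrite -[X in measurable X]setTI; exact: m.
Qed.

Let in_ball_upto_measurable r k :
  measurable (in_ball_upto r k : set (g_sigma_algebraType (F k))).
Proof.
rewrite in_ball_uptoE; apply: bigcap_measurable => [|i /= ik].
  by exists 0%N.
by apply: ball_measurable; exact: iterate_measurable_history.
Qed.

Lemma stay_in_ball_measurable r : measurable (stay_in_ball r).
Proof.
have -> : stay_in_ball r = \bigcap_k [set w | enorm (x k w) <= r].
  by apply/seteqP; split => w /= H k; [move=> _|]; exact: H.
by apply: bigcapT_measurable => k; apply: ball_measurable; exact: iterate_measurable.
Qed.

Lemma measurable_spread k :
  measurable_fun [set: T] (fun w => spread alpha (x ^~ w) k).
Proof.
under eq_fun do rewrite /spread wmean_sum.
apply: measurable_sum => i; apply: measurable_funM => //.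
apply: measurable_funX; apply: measurable_enorm.
by apply: measurable_coordB; exact: iterate_measurable.
Qed.

Lemma iterate_r1_fin k w : r1 (x k w) \is a fin_num.
Proof.
have [x0 r1x0 xx0] := x_start.
have r10 : (r1 ((x ^~ w) 0%N) < +oo)%E by rewrite xx0.
exact: (@path_r1_fin R n Omega alpha g r1 (s ^~ w) (x ^~ w) (z ^~ w) (u ^~ w)
  r1Ny r10 (x_step ^~ w)).
Qed.

Lemma iterate_r2_fin k w : r2 (x k w) \is a fin_num.
Proof. exact: (@path_r2_fin R n r2 (x ^~ w) (u ^~ w) r2Ny (u_sub ^~ w)). Qed.

Lemma expected_spread (r : R) : exists c : R, forall K,
  (\sum_(k < K) (a k.+1)%:E *
     \int[Pr]_w (\1_(stay_in_ball r) w * spread alpha (x ^~ w) k)%:E <= c%:E)%E.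
Proof.
have [Bg Bg0 gB] := convex_integrand_bounded r cg.
have [Bh Bh0 hB] := convex_integrand_bounded r ch.
have [Kg Kg0 [errg [merrg errg0 Eerrg lawg]]] := convex_integrand_uniform_law r cg.
have [Kh Kh0 [errh [merrh errh0 Eerrh lawh]]] := convex_integrand_uniform_law r ch.
pose B := Bg + Bh; have B0 : 0 <= B by rewrite addr_ge0.
pose zeta y t := g y t - h y t.
pose Z y := mean P (zeta y).
have [[_ mg _] [_ mh _]] := (cg, ch).
have mzeta y : measurable_fun [set: Omega] (zeta y) by exact: measurable_funB.
have Izeta y : P.-integrable setT (EFin \o zeta y).
  have [_ _ /(_ y)[b gb]] := cg; have [_ _ /(_ y)[b' hb]] := ch.
  apply: (@bounded_integrable _ _ _ P _ (b + b')) => // t.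
  by rewrite (le_trans (ler_normB _ _))// lerD.
have ZE y : Z y = mean P (g y) - mean P (h y).
  by rewrite /Z /zeta meanB//; exact: convex_integrand_integrable.
have zetaB y t : enorm y <= r -> `|zeta y t| <= B.
  by move=> yr; rewrite (le_trans (ler_normB _ _))// lerD ?gB ?hB.
have ZB y : enorm y <= r -> `|Z y| <= B.
  by move=> yr; apply: mean_abs_le => // t; exact: zetaB.
pose err k w := errg k w + errh k w.
have err0 k w : 0 <= err k w by rewrite addr_ge0.
have law k w y : enorm y <= r -> `|wmean alpha (fun i => g y (s i w) : R^o) k -
    wmean alpha (fun i => h y (s i w) : R^o) k - Z y| <= err k w.
  move=> yr; rewrite ZE.
  set p := wmean _ _ _; set q := wmean _ _ _; set p' := mean _ _; set q' := mean _ _.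
  have -> : p - q - (p' - q') = (p - p') - (q - q') by lra.
  by rewrite (le_trans (ler_normB _ _))// lerD ?lawg ?lawh.
pose chi k w : R := \1_(in_ball_upto r k) w.
have chi_in k w : (forall i, (i <= k)%N -> enorm (x i w) <= r) -> chi k w = 1.
  by move=> H; rewrite /chi indicE mem_set.
have chi_out k w : ~ (forall i, (i <= k)%N -> enorm (x i w) <= r) -> chi k w = 0.
  by move=> H; rewrite /chi indicE memNset.
have chi0 k w : 0 <= chi k w by rewrite /chi indicE.
(* Adding [B] makes the truncated term nonnegative, as freezing and additivity of the integrals
   require; it cancels in the difference of [U] and [U']. *)
pose U k (p : T * Omega) := chi k p.1 * (a k * (zeta (x k p.1) p.2 + B)).
pose U' k w := chi k w * (a k * (Z (x k w) + B)).
have a0 k : 0 <= a k by exact: wmean_weight_ge0.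
have U0 k p : 0 <= U k p.
  rewrite /U; have [xr|/chi_out ->] := pselect (forall i, (i <= k)%N -> enorm (x i p.1) <= r).
    apply: mulr_ge0 => //; apply: mulr_ge0 => //; have := zetaB _ p.2 (xr k (leqnn k)).
    by rewrite ler_norml => /andP[h1 _]; lra.
  by rewrite mul0r.
have U'0 k w : 0 <= U' k w.
  rewrite /U'; have [xr|/chi_out ->] := pselect (forall i, (i <= k)%N -> enorm (x i w) <= r).
    apply: mulr_ge0 => //; apply: mulr_ge0 => //; have := ZB _ (xr k (leqnn k)).
    by rewrite ler_norml => /andP[h1 _]; lra.
  by rewrite mul0r.
have U'B k w : U' k w <= 2 * B.
  rewrite /U'; have [xr|/chi_out ->] := pselect (forall i, (i <= k)%N -> enorm (x i w) <= r).
    rewrite chi_in// mul1r; have := ZB _ (xr k (leqnn k)).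
    rewrite ler_norml => /andP[h1 h2].
    rewrite -[leRHS]mul1r ler_pM//; [lra|exact: weight_ratio_le1|lra].
  by rewrite mul0r mulr_ge0.
have mchiF k : measurable_fun [set: g_sigma_algebraType (F k)] (chi k).
  by apply: measurable_indic; exact: in_ball_upto_measurable.
have mchi k : measurable_fun [set: T] (chi k).
  by apply: (history_measurable_fun HF (k := k)).
have czeta t : continuous (zeta ^~ t).
  have [c1 _ _] := cg; have [c2 _ _] := ch.
  by apply: continuous_subr; exact: real_convex_continuous.
have mUF k : measurable_fun [set: g_sigma_algebraType (F k) * Omega] (U k).
  apply: measurable_funM.
    exact: (@measurableT_comp _ _ _ _ _ _ _ _ fst (mchiF k)).
  apply: measurable_funM => //; apply: measurable_funD => //.
  apply: (@caratheodory_measurable R n _ (g_sigma_algebraType (F k)) _ Omega zeta (x k)) => //.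
  exact: iterate_measurable_history.
have mU k : measurable_fun [set: T] (fun w => U k (w, s k w)).
  apply: measurable_funM => //; apply: measurable_funM => //; apply: measurable_funD => //.
  have := @caratheodory_measurable R n _ T _ Omega zeta (x k) czeta mzeta
    (iterate_measurable k).
  move=> /(@measurableT_comp _ _ _ _ _ _ _ _ (fun w => (w, s k w))); apply.
  by apply: measurable_fun_pair => //; exact: draws_measurable Hs k.
have mU' k : measurable_fun [set: T] (U' k).
  apply: measurable_funM => //; apply: measurable_funM => //; apply: measurable_funD => //.
  by apply: continuous_measurable_coord;
    [exact: continuous_mean_diff|exact: iterate_measurable].
have EU k : (\int[Pr]_w (U k (w, s k w))%:E = \int[Pr]_w (U' k w)%:E)%E.
  have := @freezing_draw _ _ _ _ _ P Pr s F Hs HF k (EFin \o U k).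
  move=> -> //; last by move=> p; rewrite lee_fin.
    apply: eq_integral => w _; rewrite /U /U' /=.
    under eq_integral do rewrite mulrA mulrDr.
    by rewrite integral_affine//; congr EFin; rewrite /Z; ring.
  exact/measurable_EFinP.
have EU'fin k : (\int[Pr]_w (U' k w)%:E \is a fin_num)%E.
  rewrite ge0_fin_numE; last by apply: integral_ge0 => w _; rewrite lee_fin.
  apply: (@le_lt_trans _ _ (\int[Pr]_w (2 * B)%:E)%E).
    apply: ge0_le_integral => //.
    + by move=> w _; rewrite lee_fin.
    + exact/measurable_EFinP.
    + by move=> w _; rewrite lee_fin.
  by rewrite integral_cst//= probability_setT mule1 ltry.
have [x0 r1x0 xx0] := x_start.
pose c0 := `|fine (r1 x0) - fine (r2 x0)| + `|al| + 5 * B.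
have c00 : 0 <= c0 by rewrite /c0 !addr_ge0// mulr_ge0.
pose rho := rho1 + rho2.
pose L K w := chi K w * \sum_(k < K.-1) a k.+1 * (rho / 2 * spread alpha (x ^~ w) k).
have L0 K w : 0 <= L K w.
  rewrite mulr_ge0//; apply: sumr_ge0 => i _; rewrite mulr_ge0//.
  by rewrite mulr_ge0 ?spread_ge0// divr_ge0// ltW.
have path K w : L K w + \sum_(k < K) U' k.+1 w <=
    c0 + \sum_(k < K) U k.+1 (w, s k.+1 w) + \sum_(k < K) a k.+1 * err k w.
  have := @truncated_descent R n Omega alpha g h r1 r2 rho1 rho2 (s ^~ w)
    (x ^~ w) (z ^~ w) (u ^~ w) alpha_gt0 r1Ny r2Ny rho1_ge0 rho2_ge0 h_rho r2_rho.
  rewrite /= xx0 => /(_ r1x0 (z_sub ^~ w) (u_sub ^~ w) (x_step ^~ w) Z r B al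
    (err ^~ w) (chi ^~ w) ZB (fun y t => @zetaB y t) (err0 ^~ w)
    (fun k => law k w)).
  move=> /(_ _ (fun k => chi_in k w) (fun k => chi_out k w) B0 K).
  have -> : \sum_(k < K) chi k.+1 w * (alpha k.+1 / weight_sum alpha k.+1 *
      (g (x k.+1 w) (s k.+1 w) - h (x k.+1 w) (s k.+1 w) - Z (x k.+1 w))) =
    \sum_(k < K) U k.+1 (w, s k.+1 w) - \sum_(k < K) U' k.+1 w.
    rewrite -sumrB; apply: eq_bigr => i _.
    by rewrite /U /U' /zeta /a /=; ring.
  rewrite /L /c0 /a /rho => /(_ _)H.
  have Hal k : al <= Z (x k w) + fine (r1 (x k w)) - fine (r2 (x k w)).
    by rewrite ZE al_le// ?iterate_r1_fin ?iterate_r2_fin.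
  have := H Hal; lra.
have mL K : measurable_fun [set: T] (L K).
  apply: measurable_funM => //; apply: measurable_sum => i.
  apply: measurable_funM => //; apply: measurable_funM => //.
  exact: measurable_spread.
have Isum K (f : nat -> T -> R) : (forall k, measurable_fun [set: T] (f k)) ->
    (forall k w, 0 <= f k w) ->
    (\int[Pr]_w (\sum_(k < K) f k w)%:E = \sum_(k < K) \int[Pr]_w (f k w)%:E)%E.
  move=> mf f0; under eq_integral do rewrite -sumEFin.
  rewrite ge0_integral_sum// => [k|k w _]; last by rewrite lee_fin.
  exact/measurable_EFinP.
have merr k : measurable_fun [set: T] (err k) by exact: measurable_funD.
have Eerr k : (\int[Pr]_w (err k w)%:E <= ((Kg + Kh) * rate alpha k)%:E)%E.
  rewrite /err; under eq_integral do rewrite EFinD.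
  rewrite ge0_integralD//; last 4 first.
  - by move=> w _; rewrite lee_fin.
  - exact/measurable_EFinP.
  - by move=> w _; rewrite lee_fin.
  - exact/measurable_EFinP.
  by rewrite mulrDl EFinD leeD.
pose c1 := c0 + (Kg + Kh) * rate_total.
have EL K : (\int[Pr]_w (L K w)%:E <= c1%:E)%E.
  (* The centred terms are never integrated: their compensators stand on the left-hand side, have
     the same expectation as the [U] terms, and are cancelled because it is finite. *)
  pose SU' : \bar R := (\sum_(k < K) \int[Pr]_w (U' k.+1 w)%:E)%E.
  have SU'fin : SU' \is a fin_num by apply/sum_fin_numP => k _ _; exact: EU'fin.
  rewrite -(leeD2rE _ _ SU'fin).
  apply: (@le_trans _ _ (\int[Pr]_w (c0 + \sum_(k < K) U k.+1 (w, s k.+1 w) +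
      \sum_(k < K) a k.+1 * err k w)%:E)%E).
    have SU'E : SU' = (\int[Pr]_w (\sum_(k < K) U' k.+1 w)%:E)%E.
      by rewrite (Isum K (fun k => U' k.+1)).
    rewrite SU'E -ge0_integralD//; last 4 first.
    - by move=> w _; rewrite lee_fin.
    - exact/measurable_EFinP.
    - by move=> w _; rewrite lee_fin sumr_ge0.
    - by apply/measurable_EFinP; apply: measurable_sum.
    apply: ge0_le_integral => //.
    - by move=> w _; rewrite -EFinD lee_fin addr_ge0// sumr_ge0.
    - apply: emeasurable_funD; apply/measurable_EFinP => //.
      exact: measurable_sum.
    - apply/measurable_EFinP; apply: measurable_funD.
        by apply: measurable_funD => //; apply: measurable_sum.
      by apply: measurable_sum => i; apply: measurable_funM.
    - by move=> w _; rewrite -EFinD lee_fin path.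
  under eq_integral do rewrite EFinD EFinD.
  rewrite ge0_integralD//; last 4 first.
  - by move=> w _; rewrite -EFinD lee_fin addr_ge0// sumr_ge0.
  - apply: emeasurable_funD => //; apply/measurable_EFinP; exact: measurable_sum.
  - by move=> w _; rewrite lee_fin sumr_ge0// => i _; rewrite mulr_ge0.
  - by apply/measurable_EFinP; apply: measurable_sum => i; apply: measurable_funM.
  rewrite ge0_integralD//; last 2 first.
  - by move=> w _; rewrite lee_fin sumr_ge0.
  - by apply/measurable_EFinP; exact: measurable_sum.
  rewrite integral_cst//= probability_setT mule1.
  rewrite (Isum K (fun k w => U k.+1 (w, s k.+1 w)))//.
  rewrite (Isum K (fun k w => a k.+1 * err k w)); last 2 first.
  - by move=> k; apply: measurable_funM.
  - by move=> k w; rewrite mulr_ge0.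
  have -> : (\sum_(k < K) \int[Pr]_w (U k.+1 (w, s k.+1 w))%:E)%E = SU'.
    by apply: eq_bigr => k _; exact: EU.
  rewrite addeAC leeD2r//.
  rewrite /c1 (EFinD c0) leeD2l//.
  apply: (@le_trans _ _ (\sum_(k < K) (a k.+1 * ((Kg + Kh) * rate alpha k))%:E)%E).
    apply: lee_sum => k _; under eq_integral do rewrite EFinM.
    rewrite ge0_integralZl//; [|exact/measurable_EFinP|
      by move=> w _; rewrite lee_fin|by rewrite lee_fin].
    by rewrite (EFinM (a k.+1)) lee_wpmul2l// lee_fin.
  rewrite sumEFin lee_fin.
  rewrite (eq_bigr (fun k : 'I_K => (Kg + Kh) * (a k.+1 * rate alpha k))); last first.
    by move=> k _; ring.
  by rewrite -mulr_sumr ler_wpM2l ?addr_ge0//; exact: rate_summable.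
exists (2 / rho * c1) => K.
have rho0 : 0 < rho by exact: rho_gt0.
have rho20 : 0 <= 2 / rho by rewrite divr_ge0// ltW.
pose q k w : R := \1_(stay_in_ball r) w * spread alpha (x ^~ w) k.
have q0 k w : 0 <= q k w by rewrite mulr_ge0 ?spread_ge0// indicE.
have mq k : measurable_fun [set: T] (q k).
  apply: measurable_funM; last exact: measurable_spread.
  by apply: measurable_indic; exact: stay_in_ball_measurable.
rewrite (eq_bigr (fun k : 'I_K => \int[Pr]_w (a k.+1 * q k w)%:E)%E); last first.
  move=> k _; under [in RHS]eq_integral do rewrite EFinM.
  rewrite ge0_integralZl//; [exact/measurable_EFinP|
    by move=> w _; rewrite lee_fin q0|by rewrite lee_fin].
rewrite -(Isum K (fun k w => a k.+1 * q k w)); last 2 first.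
- by move=> k; apply: measurable_funM.
- by move=> k w; rewrite mulr_ge0.
(* [L K.+1] is needed since its inner sum stops one step early. On [stay_in_ball r] the indicator
   [chi] is 1, elsewhere the left-hand side is 0. *)
apply: (@le_trans _ _ (\int[Pr]_w ((2 / rho)%:E * (L K.+1 w)%:E))%E).
  apply: ge0_le_integral => //.
  - by move=> w _; rewrite lee_fin sumr_ge0// => i _; rewrite mulr_ge0.
  - apply/measurable_EFinP; apply: measurable_sum => i; exact: measurable_funM.
  - by under eq_fun do rewrite -EFinM; apply/measurable_EFinP; exact: measurable_funM.
  - move=> w _; rewrite -EFinM lee_fin /L /q /=.
    have [Ew|Ew] := pselect (stay_in_ball r w); last first.
      rewrite indicE memNset//= big1 => [|i _]; last by rewrite mul0r mulr0.
      exact: mulr_ge0 rho20 (L0 K.+1 w).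
    rewrite (chi_in K.+1) ?mul1r => [|i _]; last exact: Ew.
    rewrite mulr_sumr; apply: ler_sum => i _.
    rewrite indicE mem_set// mul1r le_eqVlt; apply/orP; left; apply/eqP.
    by field; rewrite gt_eqF.
rewrite ge0_integralZl//; [|exact/measurable_EFinP|by move=> w _; rewrite lee_fin].
by rewrite (EFinM (2 / rho)) lee_wpmul2l// lee_fin.
Qed.

Lemma expected_spread_fin (r : R) k :
  (\int[Pr]_w (\1_(stay_in_ball r) w * spread alpha (x ^~ w) k)%:E)%E
    \is a fin_num.
Proof.
have q0 i w : 0 <= (\1_(stay_in_ball r) w : R) * spread alpha (x ^~ w) i.
  by rewrite mulr_ge0 ?spread_ge0// indicE.
have I0 i : (0 <= \int[Pr]_w (\1_(stay_in_ball r) w * spread alpha (x ^~ w) i)%:E)%E.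
  by apply: integral_ge0 => w _; rewrite lee_fin.
have [c /(_ k.+1)] := expected_spread r; rewrite big_ord_recr /=.
rewrite ge0_fin_numE// => /le_lt_trans/(_ (ltry c)) H.
have ak : 0 < a k.+1 by rewrite divr_gt0 ?weight_sum_gt0.
rewrite ltNge leye_eq; apply/negP => /eqP Iy; move: H.
rewrite -/(a k.+1) Iy gt0_muley ?lte_fin// addey ?ltxx// -ltNye.
rewrite (lt_le_trans (ltNy0))// sume_ge0// => i _.
by rewrite mule_ge0// lee_fin wmean_weight_ge0.
Qed.

Hypothesis alpha_div : (\sum_(0 <= k <oo) (alpha k)%:E = +oo)%E.
Hypothesis lr1 : lower_semicontinuous r1.
Hypothesis lr2 : lower_semicontinuous r2.

Let ae_subsequence0 (q : nat -> T -> R) (b : nat -> R) (l : nat -> nat) m :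
  (forall k, measurable_fun [set: T] (q k)) -> (forall k w, 0 <= q k w) ->
  (forall k, \int[Pr]_w (q k w)%:E <= (b k)%:E)%E ->
  (forall j, (m <= j)%N -> b (l j) <= 1 / (2 ^ j.+1)%:R) ->
  {ae Pr, forall w, (fun j => q (l j) w) @ \oo --> (0 : R)}.
Proof.
move=> mq q0 qb bl.
have := @ae_cvg0 _ _ _ Pr (fun j => q (l (j + m)%N)) (fun j => mq _) (fun j => q0 _).
move=> /(_ _)H; apply: filterS (H _) => [w|j].
  by rewrite (cvg_shiftn m (fun j => q (l j) w)).
apply: le_trans (qb _) _; rewrite lee_fin (le_trans (bl _ (leq_addl _ _)))//.
rewrite !div1r lef_pV2 ?posrE ?ltr0n ?expn_gt0// ler_nat leq_exp2l//.
by rewrite ltnS leq_addr.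
Qed.

Lemma critical_subsequence :
  {ae Pr, forall w, exists M, forall k, enorm (x k w) <= M} ->
  {ae Pr, forall w, exists M, forall k, enorm (u k w) <= M} ->
  exists2 l : nat -> nat, {homo l : i j / (i < j)%N} &
    {ae Pr, forall w p, cluster ((fun k => x (l k) w) @ \oo) p ->
      exists2 v, subdiff (fun y => (mean P (g y))%:E + r1 y)%E p v &
        subdiff (fun y => (mean P (h y))%:E + r2 y)%E p v}.
Proof.
move=> bx bu.
have lawP (f : Rn -> Omega -> R) : convex_integrand f ->
    forall m : nat, exists Ke : R * (nat -> T -> R), 0 <= Ke.1 /\
    [/\ forall k, measurable_fun [set: T] (Ke.2 k),
        forall k w, 0 <= Ke.2 k w,
        forall k, (\int[Pr]_w (Ke.2 k w)%:E <= (Ke.1 * rate alpha k)%:E)%E &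
        forall k w y, enorm y <= m%:R ->
          `|wmean alpha (fun i => f y (s i w) : R^o) k - mean P (f y)| <= Ke.2 k w].
  move=> cf m; have [K K0 [err errP]] := convex_integrand_uniform_law m%:R cf.
  by exists (K, err).
have [Kg KgP] := choice (lawP g cg); have [Kh KhP] := choice (lawP h ch).
pose q (m : nat) k w : R := \1_(stay_in_ball m%:R) w * spread alpha (x ^~ w) k.
have q0 m k w : 0 <= q m k w by rewrite mulr_ge0 ?spread_ge0// indicE.
have mq m k : measurable_fun [set: T] (q m k).
  apply: measurable_funM; last exact: measurable_spread.
  by apply: measurable_indic; exact: stay_in_ball_measurable.
pose Eq m k := fine (\int[Pr]_w (q m k w)%:E)%E.
have EqE m k : (\int[Pr]_w (q m k w)%:E)%E = (Eq m k)%:E.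
  by rewrite /Eq fineK//; exact: expected_spread_fin.
have Eq0 m k : 0 <= Eq m k.
  by rewrite -lee_fin -EqE; apply: integral_ge0 => w _; rewrite lee_fin.
have rate0 k : 0 <= rate alpha k by exact: rate_ge0.
(* For the radius [m], one number dominates the expectations of the truncated spread and of both law
   errors, so a single selection controls all three. *)
pose b m k := Eq m k + ((Kg m).1 + (Kh m).1) * rate alpha k.
have Kg0 m : 0 <= (Kg m).1 by have [] := KgP m.
have Kh0 m : 0 <= (Kh m).1 by have [] := KhP m.
have b0 m k : 0 <= b m k.
  by apply: addr_ge0 => //; apply: mulr_ge0 => //; exact: addr_ge0.
have bsum m : exists c, forall K, \sum_(k < K) a k.+1 * b m k <= c.
  have [c Hc] := expected_spread m%:R.
  exists (c + ((Kg m).1 + (Kh m).1) * rate_total) => K.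
  under eq_bigr do rewrite mulrDr.
  rewrite big_split /= lerD//.
    rewrite -lee_fin -sumEFin; apply: le_trans (Hc K).
    by apply: lee_sum => k _; rewrite EFinM -EqE.
  rewrite (eq_bigr (fun k : 'I_K => ((Kg m).1 + (Kh m).1) * (a k.+1 * rate alpha k))).
    by rewrite -mulr_sumr ler_wpM2l ?addr_ge0//; exact: rate_summable.
  by move=> k _; ring.
have [l lhomo lb] := select_subsequence alpha_gt0 alpha_div b0 bsum.
(* The spread and the slope of index [k] concern the iterate [k.+1]. *)
exists (fun j => (l j).+1); first by move=> i j ij; rewrite ltnS; exact: lhomo.
have aeq : {ae Pr, forall w, forall m, (fun j => q m (l j) w) @ \oo --> (0 : R)}.
  apply: ae_foralln => m; apply: (@ae_subsequence0 _ (b m) _ m) => //.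
    move=> k; rewrite EqE lee_fin lerDl mulr_ge0//; exact: addr_ge0.
  by move=> j mj; exact: lb.
have aeg : {ae Pr, forall w, forall m, (fun j => (Kg m).2 (l j) w) @ \oo --> (0 : R)}.
  apply: ae_foralln => m; have [_ [merr err0 Eerr _]] := KgP m.
  apply: (@ae_subsequence0 _ (b m) _ m) => //.
    move=> k; apply: le_trans (Eerr k) _; rewrite lee_fin /b mulrDl.
    have h1 := mulr_ge0 (Kh0 m) (rate0 k); have := Eq0 m k; lra.
  by move=> j mj; exact: lb.
have aeh : {ae Pr, forall w, forall m, (fun j => (Kh m).2 (l j) w) @ \oo --> (0 : R)}.
  apply: ae_foralln => m; have [_ [merr err0 Eerr _]] := KhP m.
  apply: (@ae_subsequence0 _ (b m) _ m) => //.
    move=> k; apply: le_trans (Eerr k) _; rewrite lee_fin /b mulrDl.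
    have h1 := mulr_ge0 (Kg0 m) (rate0 k); have := Eq0 m k; lra.
  by move=> j mj; exact: lb.
apply: filterS (filterI (filterI bx bu) (filterI aeq (filterI aeg aeh))) => w.
move=> [[[Mx xM] [Mu uM]] [hq [hg hh]]] p.
have [M M0 hM] := convex_integrand_lipschitz (Mx + 1) ch.
have [x0 r1x0 xx0] := x_start.
have r10 : (r1 ((x ^~ w) 0%N) < +oo)%E by rewrite xx0.
have [[cvg_ _ bg] [cvh_ _ bh]] := (cg, ch).
have contm (f : Rn -> Omega -> R) : convex_integrand f -> continuous (fun y => mean P (f y)).
  move=> cf; have c0 : convex_integrand (fun (_ : Rn) (_ : Omega) => 0 : R).
    split=> [t y y' e _|//|y]; first by rewrite !mulr0 addr0.
    by exists 0 => t; rewrite normr0.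
  have := continuous_mean_diff cf c0.
  by under eq_fun do under eq_fun do rewrite subr0.
apply: (@cluster_critical R n Omega alpha alpha_gt0 g h r1 r2 (s ^~ w) (x ^~ w)
  (z ^~ w) (u ^~ w) r1Ny r2Ny r10 (z_sub ^~ w) (u_sub ^~ w) (x_step ^~ w)
  Mx M Mu M0 xM hM uM (fun y => mean P (g y)) (fun y => mean P (h y)) l
  (fun m k => (Kg m).2 k w) (fun m k => (Kh m).2 k w)) => //.
- exact: contm.
- exact: contm.
- by move=> m k y ym; have [_ [_ _ _]] := KgP m; apply.
- by move=> m k y ym; have [_ [_ _ _]] := KhP m; apply.
(* On a bounded path the indicator of the ball of radius [m] is 1, so the truncated spread is the
   spread itself. *)
- pose m := (Num.truncn `|Mx|).+1.
  have /andP[_ /ltW hm] := truncn_itv (normr_ge0 Mx).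
  have := hq m; rewrite /q indicE mem_set => [|k]; last first.
    by rewrite (le_trans (xM k))// (le_trans (ler_norm _)).
  by under eq_fun do rewrite mul1r.
Qed.

Definition mean_gradient (f : Rn -> Omega -> R) y : Rn :=
  \row_j mean P (fun t => gradient (f ^~ t) y 0 j).

(** The uniform law is applied to each partial derivative, which is bounded because [f] is Lipschitz
    on a larger ball. Integrating the subgradient inequality shows that the mean gradient is a
    subgradient of the mean, without differentiating under the integral. *)
Lemma gradient_law (f : Rn -> Omega -> R) (C : set Rn) (r L : R) :
  convex_integrand f -> 0 <= L -> (forall y, C y -> enorm y <= r) ->
  (forall t y, C y -> differentiable (f ^~ t : Rn -> R^o) y) ->
  (forall t y y', C y -> C y' ->
    enorm (gradient (f ^~ t) y - gradient (f ^~ t) y') <= L * enorm (y - y')) ->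
  (forall y, C y -> subdiff (fun q => (mean P (f q))%:E) y (mean_gradient f y)) /\
  exists2 K : R, 0 <= K & exists err : nat -> T -> R,
    [/\ forall k, measurable_fun [set: T] (err k),
        forall k w, 0 <= err k w,
        forall k, (\int[Pr]_w (err k w)%:E <= (K * rate alpha k)%:E)%E &
        forall k w y, C y ->
          enorm (wmean alpha (fun i => gradient (f ^~ (s i w)) y) k
            - mean_gradient f y) <= err k w].
Proof.
move=> cf L0 Cr df Lf; have [cvx_f mf bf] := cf.
have [M M0 fM] := convex_integrand_lipschitz (r + 1) cf.
pose psi j y t := gradient (f ^~ t) y 0 j.
have gsub y t : C y -> subdiff (EFin \o f ^~ t) y (gradient (f ^~ t) y).
  by move=> Cy; apply: gradient_subdiff => //; exact: df.
have psiM j y t : C y -> `|psi j y t| <= M.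
  move=> Cy; apply: le_trans (enorm_coord _ _) _.
  apply: (@subgradient_enorm_le _ _ (f ^~ t) y _ r M M0) => //.
  - by move=> q q'; exact: fM.
  - exact: Cr.
  - exact: gsub.
have mpsi j y : C y -> measurable_fun [set: Omega] (psi j y).
  move=> Cy; apply: (@measurable_fun_cvg _ _ _ _
    (fun k t => diff_quotient (f ^~ t) y (delta_mx 0 j) k)) => [k|t _].
    apply: measurable_funM => //; exact: measurable_funB.
  exact: gradient_coord_cvg (df t y Cy).
have Ipsi j y : C y -> P.-integrable setT (EFin \o psi j y).
  by move=> Cy; apply: (@bounded_integrable _ _ _ P _ M); [exact: mpsi|move=> t; exact: psiM].
split.
  move=> y Cy; apply/subdiff_EFin => q.
  have Idot : P.-integrable setT (EFin \o (fun t => \sum_(j < n) (q - y) 0 j * psi j y t)) /\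
      mean P (fun t => \sum_(j < n) (q - y) 0 j * psi j y t) =
        \sum_(j < n) (q - y) 0 j * mean P (psi j y).
    by apply: mean_sumM => j; exact: Ipsi.
  have -> : dotp (mean_gradient f y) (q - y) =
      mean P (fun t => \sum_(j < n) (q - y) 0 j * psi j y t).
    by rewrite Idot.2; apply: eq_bigr => j _; rewrite mxE mulrC.
  have If := convex_integrand_integrable _ cf.
  suff : mean P (fun t => \sum_(j < n) (q - y) 0 j * psi j y t) <=
      mean P (fun t => f q t - f y t).
    by rewrite meanB//; lra.
  apply: le_mean => [||t]; first exact: Idot.1.
    have -> : EFin \o (fun t => f q t - f y t) = ((EFin \o f q) \- (EFin \o f y))%E.
      by apply/funext => t /=; rewrite EFinB.
    exact: integrableB.
  have /subdiff_EFin/(_ q) := gsub y t Cy.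
  rewrite /dotp (eq_bigr (fun j => (q - y) 0 j * psi j y t)) => [|j _]; first lra.
  by rewrite mulrC.
have /choice[Ke KeP] : forall j : 'I_n, exists Ke : R * (nat -> T -> R), 0 <= Ke.1 /\
    [/\ forall k, measurable_fun [set: T] (Ke.2 k),
        forall k w, 0 <= Ke.2 k w,
        forall k, (\int[Pr]_w (Ke.2 k w)%:E <= (Ke.1 * rate alpha k)%:E)%E &
        forall k w y, C y ->
          `|wmean alpha (fun i => psi j y (s i w) : R^o) k - mean P (psi j y)| <= Ke.2 k w].
  move=> j; have [|K K0 [err errP]] := @uniform_law R n _ _ _ _ P Pr s F Hs HF
      alpha alpha_gt0 C r M L (psi j) Cr (fun y => mpsi j y) L0 (fun y t => @psiM j y t).
    move=> y y' t Cy Cy'; apply: le_trans (Lf t y y' Cy Cy').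
    by apply: le_trans (enorm_coord _ j); rewrite /psi !mxE.
  by exists (K, err).
exists (\sum_j (Ke j).1); first by apply: sumr_ge0 => j _; have [] := KeP j.
exists (fun k w => \sum_j (Ke j).2 k w); split.
- by move=> k; apply: measurable_sum => j; have [_ []] := KeP j.
- by move=> k w; apply: sumr_ge0 => j _; have [_ []] := KeP j.
- move=> k; under eq_integral do rewrite -sumEFin.
  rewrite ge0_integral_sum//; last 2 first.
  + by move=> j; apply/measurable_EFinP; have [_ []] := KeP j.
  + by move=> j w _; rewrite lee_fin; have [_ []] := KeP j.
  rewrite mulr_suml -sumEFin; apply: lee_sum => j _.
  by have [_ [_ _ H _]] := KeP j; exact: H.
- move=> k w y Cy; apply: le_trans (enorm_le_sum _) _; apply: ler_sum => j _.
  have [_ [_ _ _ H]] := KeP j; apply: le_trans (H k w y Cy).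
  rewrite mxE [X in _ + X]mxE [X in _ - X]mxE !wmean_sum summxE.
  rewrite (eq_bigr (fun i : 'I_k.+1 =>
    (alpha i / weight_sum alpha k) *: (psi j y (s i w) : R^o))) => [|i _].
    exact: lexx.
  by rewrite mxE.
Qed.

Definition residual_set y : set Rn :=
  mdiff (mdiff (msum (subdiff (fun q => (mean P (g q))%:E) y) (subdiff r1 y))
               (subdiff (fun q => (mean P (h q))%:E) y)) (subdiff r2 y).

Lemma dist0_le (A : set Rn) v : A v -> (dist0 A <= (enorm v)%:E)%E.
Proof. by move=> Av; apply: ereal_inf_lbound; exists v. Qed.

Lemma dist0_ge0 (A : set Rn) : (0 <= dist0 A)%E.
Proof. by apply: le_ereal_inf_tmp => _ [v _ <-]; rewrite lee_fin enorm_ge0. Qed.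

(** On [C] the chosen subgradients are gradients, so the averages of [z] and of [u] each differ by
    at most [L / 2] times the mean distance from the same averages taken at [x k.+1]. The element of
    the residual set is built with [a'], [b'], the mean gradient of [h] and [u k.+1]. *)
Lemma residual_le (C : set Rn) (L : R) k w v a' b' (eg eh : R) :
  (forall i, C (x i w)) -> 0 <= L ->
  lipschitz_gradient_on C (L / 2) r2 ->
  (forall t, lipschitz_gradient_on C (L / 2) (fun p => (h p t)%:E)) ->
  v = slope alpha (z ^~ w) (u ^~ w) k ->
  subdiff (fun q => (mean P (g q))%:E) (x k.+1 w) a' ->
  subdiff r1 (x k.+1 w) b' -> enorm (v - a' - b') <= eg ->
  subdiff (fun q => (mean P (h q))%:E) (x k.+1 w) (mean_gradient h (x k.+1 w)) ->
  enorm (wmean alpha (fun i => gradient (h ^~ (s i w)) (x k.+1 w)) k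
            - mean_gradient h (x k.+1 w)) <= eh ->
  (dist0 (residual_set (x k.+1 w)) <=
    (eg + eh + L * mean_dist alpha (x ^~ w) k)%:E)%E.
Proof.
move=> Cx L0 [dr2 Lr2] Lh vE ga rb eab hsub hlaw.
pose y := x k.+1 w; pose gh y t := gradient (h ^~ t) y.
pose g2 := gradient (fine \o r2).
have u_grad i : u i w = g2 (x i w).
  have [near_fin dfr] := dr2 _ (Cx i).
  apply: gradient_unique => //.
  apply: filterS near_fin => q rq /=.
  have [_ /(_ q)] := u_sub i w.
  by rewrite -(fineK rq) -(fineK (iterate_r2_fin i w)) -EFinD lee_fin.
have z_grad i : z i w = gh (x i w) (s i w).
  have [dh _] := Lh (s i w); have [_ dfh] := dh _ (Cx i).
  apply: gradient_unique; first exact: dfh.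
  by near=> q; have /subdiff_EFin/(_ q) := z_sub i w.
have res : residual_set y (a' + b' - mean_gradient h y - u k.+1 w).
  exists (a' + b' - mean_gradient h y); last by exists (u k.+1 w) => //; exact: u_sub.
  exists (a' + b'); last by exists (mean_gradient h y).
  by exists a' => //; exists b'.
apply: le_trans (dist0_le res) _; rewrite lee_fin.
have zb : enorm (wmean alpha (z ^~ w) k - wmean alpha (fun i => gh y (s i w)) k) <=
    L / 2 * mean_dist alpha (x ^~ w) k.
  rewrite -wmeanB -[L / 2 * _](wmeanZ alpha (V := R^o)).
  apply: enorm_wmean_le => // i; rewrite z_grad.
  have [_ H] := Lh (s i w); apply: le_trans (H _ _ (Cx i) (Cx k.+1)) _.
  by rewrite enormB.
have ub : enorm (wmean alpha (u ^~ w) k - u k.+1 w) <=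
    L / 2 * mean_dist alpha (x ^~ w) k.
  rewrite -{1}(wmean_cst alpha_gt0 (u k.+1 w) k) -wmeanB.
  rewrite -[L / 2 * _](wmeanZ alpha (V := R^o)).
  apply: enorm_wmean_le => // i; rewrite !u_grad.
  apply: le_trans (Lr2 _ _ (Cx i) (Cx k.+1)) _.
  by rewrite enormB.
have -> : a' + b' - mean_gradient h y - u k.+1 w =
   - (v - a' - b') + (wmean alpha (fun i => gh y (s i w)) k - mean_gradient h y)
   + (wmean alpha (z ^~ w) k - wmean alpha (fun i => gh y (s i w)) k)
   + (wmean alpha (u ^~ w) k - u k.+1 w).
  by rewrite vE /slope; apply/rowP => j; rewrite !mxE; ring.
apply: le_trans (enormD _ _) _; apply: le_trans (lerD (enormD _ _) (lexx _)) _.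
apply: le_trans (lerD (lerD (enormD _ _) (lexx _)) (lexx _)) _.
rewrite enormN; move: hlaw eab zb ub; rewrite -/y -/(gh _ _); lra.
Unshelve. all: by end_near. Qed.

(* The bound [t <= e / 2 + t ^ 2 / (2 e)] with [e = S ^ (-1/2)], where [S] is
   the total weight, makes the expected residual linear in the expected spread,
   so that the weighted average over the steps can be taken directly. *)
Lemma min_residual_rate (C : set Rn) (L r : R) (Kg : R) (errg : nat -> T -> R) :
  (forall y, C y -> enorm y <= r) -> {ae Pr, forall w, forall k, C (x k w)} ->
  0 <= L -> lipschitz_gradient_on C (L / 2) r2 ->
  (forall t, lipschitz_gradient_on C (L / 2) (fun p => (h p t)%:E)) ->
  0 <= Kg -> (forall k, measurable_fun [set: T] (errg k)) ->
  (forall k w, 0 <= errg k w) ->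
  (forall k, (\int[Pr]_w (errg k w)%:E <= (Kg * rate alpha k)%:E)%E) ->
  (forall k w, (forall i, C (x i w)) -> exists a' b',
    [/\ subdiff (fun q => (mean P (g q))%:E) (x k.+1 w) a',
        subdiff r1 (x k.+1 w) b' &
        enorm (slope alpha (z ^~ w) (u ^~ w) k - a' - b') <= errg k w]) ->
  exists M : R, forall K, 1 <= \sum_(k < K) a k.+1 -> exists2 k, (k < K)%N &
    (\int[Pr]_w dist0 (residual_set (x k.+1 w)) <=
      (M / Num.sqrt (\sum_(k < K) a k.+1))%:E)%E.
Proof.
move=> Cr aeC L0 Lr2 Lh Kg0 merrg errg0 Eerrg split_slope.
have [hsub [Kh Kh0 [errh [merrh errh0 Eerrh lawh]]]] :
    (forall y, C y -> subdiff (fun q => (mean P (h q))%:E) y (mean_gradient h y)) /\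
    exists2 K : R, 0 <= K & exists err : nat -> T -> R,
    [/\ forall k, measurable_fun [set: T] (err k),
        forall k w, 0 <= err k w,
        forall k, (\int[Pr]_w (err k w)%:E <= (K * rate alpha k)%:E)%E &
        forall k w y, C y ->
          enorm (wmean alpha (fun i => gradient (h ^~ (s i w)) y) k
            - mean_gradient h y) <= err k w].
  apply: (@gradient_law h C r (L / 2)) => //; first by rewrite divr_ge0.
  - by move=> t y Cy; have [/(_ y Cy)[_ H] _] := Lh t; exact: H.
  - by move=> t y y' Cy Cy'; have [_ H] := Lh t; exact: H.
pose q k w : R := \1_(stay_in_ball r) w * spread alpha (x ^~ w) k.
have q0 k w : 0 <= q k w by rewrite mulr_ge0 ?spread_ge0// indicE.
have mq k : measurable_fun [set: T] (q k).
  apply: measurable_funM; last exact: measurable_spread.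
  by apply: measurable_indic; exact: stay_in_ball_measurable.
pose Eq k := fine (\int[Pr]_w (q k w)%:E)%E.
have EqE k : (\int[Pr]_w (q k w)%:E)%E = (Eq k)%:E.
  by rewrite /Eq fineK//; exact: expected_spread_fin.
have [c Hc] := expected_spread r.
have sumEq K : \sum_(k < K) a k.+1 * Eq k <= c.
  rewrite -lee_fin -sumEFin; apply: le_trans (Hc K).
  by apply: lee_sum => k _; rewrite EFinM -EqE.
have c0 : 0 <= c by have := sumEq 0%N; rewrite big_ord0.
have rate0 k : 0 <= rate alpha k by exact: rate_ge0.
have rt0 : 0 <= rate_total by have := rate_summable 0; rewrite big_ord0.
pose Kgh := Kg + Kh; have Kgh0 : 0 <= Kgh by rewrite addr_ge0.
have bound (e : R) k : 0 < e ->
    (\int[Pr]_w dist0 (residual_set (x k.+1 w)) <=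
      (Kgh * rate alpha k + L * (e / 2) + L / (2 * e) * Eq k)%:E)%E.
  move=> e0; have Le0 : 0 <= L / (2 * e) by rewrite divr_ge0// mulr_ge0// ltW.
  have Le2 : 0 <= L * (e / 2) by rewrite mulr_ge0// divr_ge0// ltW.
  apply: (@le_trans _ _ (\int[Pr]_w (errg k w + errh k w + L * (e / 2) +
      L / (2 * e) * q k w)%:E)%E).
    apply: ae_le_integral => [w|w||].
    - exact: dist0_ge0.
    - by rewrite lee_fin !addr_ge0// mulr_ge0.
    - apply/measurable_EFinP; apply: measurable_funD; last exact: measurable_funM.
      by apply: measurable_funD => //; exact: measurable_funD.
    apply: filterS aeC => w Cx.
    have [a' [b' [ga rb eab]]] := split_slope k w Cx.
    apply: le_trans (residual_le Cx L0 Lr2 Lh erefl ga rb eab (hsub _ (Cx k.+1))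
      (lawh k w _ (Cx k.+1))) _.
    have -> : q k w = spread alpha (x ^~ w) k.
      by rewrite /q indicE mem_set ?mul1r// => i; exact: Cr.
    have := ler_wpM2l L0 (mean_dist_le alpha_gt0 (x ^~ w) k e0).
    have -> : L / (2 * e) * spread alpha (x ^~ w) k =
        L * (spread alpha (x ^~ w) k / (2 * e)) by ring.
    by rewrite lee_fin; lra.
  under eq_integral do rewrite EFinD EFinD EFinD (EFinM (L / (2 * e))).
  rewrite ge0_integralD//; last 4 first.
  - by move=> w _; rewrite -!EFinD lee_fin !addr_ge0.
  - apply: emeasurable_funD => //; apply: emeasurable_funD; exact/measurable_EFinP.
  - by move=> w _; rewrite -EFinM lee_fin mulr_ge0.
  - by under eq_fun do rewrite -EFinM; apply/measurable_EFinP; exact: measurable_funM.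
  rewrite ge0_integralD//; last 2 first.
  - by move=> w _; rewrite -EFinD lee_fin addr_ge0.
  - apply: emeasurable_funD; exact/measurable_EFinP.
  rewrite ge0_integralD//; last 4 first.
  - by move=> w _; rewrite lee_fin.
  - exact/measurable_EFinP.
  - by move=> w _; rewrite lee_fin.
  - exact/measurable_EFinP.
  rewrite integral_cst//= probability_setT mule1.
  rewrite ge0_integralZl//; [|exact/measurable_EFinP|by move=> w _; rewrite lee_fin].
  rewrite EqE -EFinM EFinD EFinD leeD2r// leeD2r//.
  by rewrite /Kgh mulrDl EFinD leeD.
pose c1 := Kgh * rate_total + L / 2 + L / 2 * c.
have c10 : 0 <= c1.
  have L20 : 0 <= L / 2 by rewrite divr_ge0.
  apply: addr_ge0; last exact: mulr_ge0.
  by apply: addr_ge0 => //; exact: mulr_ge0.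
(* If every step exceeded the bound, the weighted sum would give [(c1 + 1) t <= c1 t] with
   [t = sqrt S]. The assumption [1 <= S] makes [t >= 1], which absorbs the constant term coming from
   the rates. *)
exists (c1 + 1) => K; set S := \sum_(k < K) a k.+1 => S1.
have S0 : 0 < S by lra.
pose t := Num.sqrt S; have t1 : 1 <= t by rewrite -[leLHS]sqrtr1 ler_sqrt// ltW.
have t0 : 0 < t by lra.
have tt : t ^+ 2 = S by rewrite sqr_sqrtr// ltW.
have e0 : 0 < t^-1 by rewrite invr_gt0.
pose ubd k := Kgh * rate alpha k + L * (t^-1 / 2) + L / (2 * t^-1) * Eq k.
suff [k kK ubk] : exists2 k, (k < K)%N & ubd k <= (c1 + 1) / t.
  by exists k => //; apply: le_trans (bound _ _ e0) _; rewrite lee_fin.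
apply: contrapT => H.
have big k : (k < K)%N -> (c1 + 1) / t <= ubd k.
  by move=> kK; rewrite leNgt; apply/negP => /ltW h'; apply: H; exists k.
have : (c1 + 1) / t * S <= \sum_(k < K) a k.+1 * ubd k.
  rewrite /S mulr_sumr; apply: ler_sum => k _; rewrite mulrC.
  by apply: ler_wpM2l; [exact: wmean_weight_ge0|exact: big].
have -> : (c1 + 1) / t * S = (c1 + 1) * t.
  by rewrite -tt; field; rewrite gt_eqF.
have -> : \sum_(k < K) a k.+1 * ubd k = Kgh * (\sum_(k < K) a k.+1 * rate alpha k)
   + L / 2 / t * S + L / 2 * t * (\sum_(k < K) a k.+1 * Eq k).
  rewrite /S !mulr_sumr -!big_split; apply: eq_bigr => k _ /=.
  by rewrite /ubd; field; rewrite gt_eqF.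
have h1 : Kgh * (\sum_(k < K) a k.+1 * rate alpha k) <= Kgh * rate_total * t.
  rewrite -[leLHS]mulr1; apply: ler_pM => //.
    apply: mulr_ge0 => //; apply: sumr_ge0 => i _; apply: mulr_ge0 => //.
    exact: wmean_weight_ge0.
  by rewrite ler_wpM2l//; exact: rate_summable.
have h2 : L / 2 / t * S = L / 2 * t by rewrite -tt; field; rewrite gt_eqF.
have h3 : L / 2 * t * (\sum_(k < K) a k.+1 * Eq k) <= L / 2 * t * c.
  by rewrite ler_wpM2l// mulr_ge0 ?(ltW t0)// divr_ge0.
rewrite h2 /c1 => h4; have := le_trans h4 (lerD (lerD h1 (lexx _)) h3); lra.
Qed.

Hypothesis cr1 : convex_ext r1.

Lemma iterate_subgradient k w y : r1 y \is a fin_num ->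
  wmean alpha (fun i => g (x k.+1 w) (s i w) : R^o) k + fine (r1 (x k.+1 w))
    + dotp (slope alpha (z ^~ w) (u ^~ w) k) (y - x k.+1 w)
    <= wmean alpha (fun i => g y (s i w) : R^o) k + fine (r1 y).
Proof.
have [x0 r1x0 xx0] := x_start.
have r10 : (r1 ((x ^~ w) 0%N) < +oo)%E by rewrite xx0.
exact: (@step_subgradient R n Omega alpha g r1 (s ^~ w) (x ^~ w) (z ^~ w)
  (u ^~ w) r1Ny r10 (x_step ^~ w) k).
Qed.

(** The model does not involve the draws, so the optimality condition at [x k.+1] concerns [G + r1]
    itself and the sum rule splits the slope without error. *)
Lemma slope_split_deterministic (G : Rn -> R) k w : real_convex G ->
  (forall y t, g y t = G y) -> exists a' b',
    [/\ subdiff (fun q => (mean P (g q))%:E) (x k.+1 w) a',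
        subdiff r1 (x k.+1 w) b' &
        enorm (slope alpha (z ^~ w) (u ^~ w) k - a' - b') <= 0].
Proof.
move=> cG gG.
have gE y : wmean alpha (fun i => g y (s i w) : R^o) k = G y.
  rewrite (_ : (fun i => _) = fun=> G y); last by apply/funext.
  by rewrite (wmean_cst alpha_gt0 (V := R^o)).
have [y ry|a' [ga rb]] := subgradient_sum_rule cG r1Ny cr1 (iterate_r1_fin k.+1 w)
    (v := slope alpha (z ^~ w) (u ^~ w) k).
  by have := iterate_subgradient k w ry; rewrite !gE.
exists a', (slope alpha (z ^~ w) (u ^~ w) k - a'); split => //.
  have -> : (fun q => (mean P (g q))%:E) = EFin \o G; last by [].
  apply/funext => q /=; rewrite -[in RHS](mean_cst P (G q)); congr (mean P _)%:E.
  exact/funext.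
by rewrite subrr enorm0.
Qed.

(** The optimality condition concerns the empirical mean of [g]. Its gradient is split off exactly,
    leaving a subgradient of [r1], and is then replaced by the mean gradient at the price [eg]. *)
Lemma slope_split_smooth (C : set Rn) (eg : R) k w :
  (forall t y, C y -> differentiable (g ^~ t : Rn -> R^o) y) ->
  (forall y, C y -> subdiff (fun q => (mean P (g q))%:E) y (mean_gradient g y)) ->
  C (x k.+1 w) ->
  enorm (wmean alpha (fun i => gradient (g ^~ (s i w)) (x k.+1 w)) k
            - mean_gradient g (x k.+1 w)) <= eg ->
  exists a' b',
    [/\ subdiff (fun q => (mean P (g q))%:E) (x k.+1 w) a',
        subdiff r1 (x k.+1 w) b' &
        enorm (slope alpha (z ^~ w) (u ^~ w) k - a' - b') <= eg].
Proof.
move=> dg gsub Cx gerr; set y := x k.+1 w in Cx gerr *.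
set v := slope _ _ _ _.
pose gw := wmean alpha (fun i => gradient (g ^~ (s i w)) y) k.
exists (mean_gradient g y), (v - gw); split; first exact: gsub.
  apply: (@smooth_sum_rule _ _ (fun q => wmean alpha (fun i => g q (s i w) : R^o) k)
    r1 y v gw r1Ny cr1 (iterate_r1_fin _ _)).
    move=> e.
    have -> : diff_quotient (fun q => wmean alpha (fun i => g q (s i w) : R^o) k) y e =
      (fun j => \sum_(i < k.+1) alpha i / weight_sum alpha k *
         diff_quotient (g ^~ (s i w)) y e j).
      apply/funext => j; rewrite /diff_quotient -(wmeanB alpha (V := R^o)).
      rewrite wmean_sum mulr_sumr; apply: eq_bigr => i _.
      by rewrite /GRing.scale /=; ring.
    rewrite /gw wmean_sum dotp_suml.
    elim: (index_enum _) => [|i l IH].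
      by rewrite big_nil; under eq_fun do rewrite big_nil; exact: cvg_cst.
    rewrite big_cons; under eq_fun do rewrite big_cons.
    apply: cvgD IH; rewrite dotpZl; apply: cvgM; first exact: cvg_cst.
    exact: diff_quotient_cvg (dg _ _ Cx).
  by move=> q rq; exact: iterate_subgradient.
have -> : v - mean_gradient g y - (v - gw) = gw - mean_gradient g y.
  by apply/rowP => j; rewrite !mxE; ring.
exact: gerr.
Qed.

End stochastic.

(** * From the assumptions of the theorem to those of the analysis *)

Section reductions.
Context {R : realType} {n : nat}.
Local Notation Rn := 'rV[R]_n.

(** The moduli are suprema in [\bar R]. If that of [r2] is positive, [rho1 = 0] suffices; otherwise
    a positive real strictly below the infimum lies below some admissible modulus of every [h i]. *)
Lemma common_moduli (I : Type) (h : I -> Rn -> \bar R) (r2 : Rn -> \bar R) :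
  (forall i y, h i y != -oo)%E -> (forall y, r2 y != -oo)%E ->
  (forall i, convex_ext (h i)) -> convex_ext r2 ->
  (0 < ereal_inf (range (fun i => rho_modulus (h i))) + rho_modulus r2)%E ->
  exists rho1 rho2 : R, [/\ 0 <= rho1, 0 <= rho2, 0 < rho1 + rho2,
    forall i, rho_convex rho1 (h i) & rho_convex rho2 r2].
Proof.
move=> hNy r2Ny ch cr2 pos.
have [/ereal_sup_gt[_ [rho [rho0 crho] <-]]|r2le] := ltP 0%E (rho_modulus r2).
  by rewrite lte_fin => rho_gt0; exists 0, rho; split => //; rewrite add0r.
have infpos : (0 < ereal_inf (range (fun i => rho_modulus (h i))))%E.
  rewrite ltNge; apply/negP => infle; move: pos; apply/negP; rewrite -leNgt.
  by rewrite (le_trans (leeD infle r2le))// adde0.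
have [e e0 einf] : exists2 e : R, 0 < e &
    (e%:E < ereal_inf (range (fun i => rho_modulus (h i))))%E.
  case: (ereal_inf _) infpos => [t||]//; last by exists 1; rewrite ?ltry.
  by rewrite lte_fin => t0; exists (t / 2); rewrite ?lte_fin; lra.
exists e, 0; split => //; [exact: ltW|by rewrite addr0|] => i.
have : (e%:E < rho_modulus (h i))%E.
  by apply: lt_le_trans einf _; apply: ereal_inf_lbound; exists i.
move=> /ereal_sup_gt[_ [rho [rho0 crho] <-]]; rewrite lte_fin => /ltW erho.
exact: rho_convex_le erho (hNy i) crho.
Qed.

Lemma real_convex_ext (f : Rn -> R) : real_convex f -> convex_ext (EFin \o f).
Proof.
move=> cf x y l l01 /=.
by rewrite !mul0r -!EFinM -!EFinD lee_fin subr0 cf.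
Qed.

Lemma compact_enorm_bounded (C : set Rn) : compact C ->
  exists r : R, forall y, C y -> enorm y <= r.
Proof.
move=> /compact_bounded[M [_ HM]]; exists (n%:R * (M + 1)) => y Cy.
apply: le_trans (enorm_le_norm y) _; rewrite ler_wpM2l//.
by apply: HM => //; rewrite ltrDl.
Qed.

Context {d : measure_display} {Omega : measurableType d}.
Variable P : probability Omega R.

Lemma bounded_in_s_le (g : Rn -> Omega -> R) y : bounded_in_s g ->
  exists B, forall t, `|g y t| <= B.
Proof.
move=> /(_ y)[M [_ HM]]; exists (M + 1) => t.
by apply: HM => //; rewrite ltrDl.
Qed.

Lemma integrable_measurable (f : Omega -> R) :
  P.-integrable setT (EFin \o f) -> measurable_fun [set: Omega] f.
Proof. by move=> /measurable_int/measurable_EFinP. Qed.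

Lemma mean_fun_convex (g : Rn -> Omega -> R) :
  (forall t, real_convex (g ^~ t)) ->
  (forall y, P.-integrable setT (EFin \o g y)) -> real_convex (mean_fun P g).
Proof.
move=> cg Ig x y l l01; rewrite !mean_funE.
have [Is Es] := @mean_sumM _ _ _ P _ [:: true; false]
  (fun b => if b then l else 1 - l) (fun b => if b then g x else g y)
  (fun b => if b as b return P.-integrable setT (EFin \o (if b then g x else g y))
            then Ig x else Ig y).
move: Es; rewrite big_cons big_seq1 => <-; apply: le_mean => // t.
by rewrite big_cons big_seq1; exact: cg.
Qed.

Lemma optimal_value_le (g h : Rn -> Omega -> R) (r1 r2 : Rn -> \bar R) y :
  (forall y, P.-integrable setT (EFin \o g y)) ->
  (forall y, P.-integrable setT (EFin \o h y)) ->
  optimal_value P g h r1 r2 \is a fin_num -> r1 y \is a fin_num ->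
  r2 y \is a fin_num ->
  fine (optimal_value P g h r1 r2) <=
    mean P (g y) - mean P (h y) + fine (r1 y) - fine (r2 y).
Proof.
move=> Ig Ih fo f1 f2.
have : (optimal_value P g h r1 r2 <= objective P g h r1 r2 y)%E.
  by apply: ereal_inf_lbound; exists y.
rewrite -(fineK fo) /objective /ext_diff -(fineK f1) -(fineK f2).
rewrite /Phi expectation.unlock -/(mean P _) meanB// lee_fin.
by rewrite addrA.
Qed.

Lemma rate_partial_sums (alpha : nat -> R) : (forall k, 0 < alpha k) ->
  (\sum_(1 <= k <oo)
     (alpha k * (1 + Num.sqrt (ln (beta alpha k.-1)))
      / (beta alpha k.-1 * weight_sum alpha k))%:E < +oo)%E ->
  exists c, forall K,
    \sum_(k < K) alpha k.+1 / weight_sum alpha k.+1 * rate alpha k <= c.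
Proof.
move=> a0; set S := (X in (X < _)%E) => Sfin.
pose u k := alpha k * (1 + Num.sqrt (ln (beta alpha k.-1))) /
  (beta alpha k.-1 * weight_sum alpha k).
have u0 k : 0 <= u k.
  apply: divr_ge0; apply: mulr_ge0; [exact: ltW|by rewrite addr_ge0 ?sqrtr_ge0|
    by rewrite (le_trans _ (beta_ge1 a0 _))|exact: ltW (weight_sum_gt0 a0 _)].
have S0 : (0 <= S)%E.
  by rewrite /S; apply: nneseries_ge0 => k _ _; rewrite lee_fin; exact: (u0 k).
exists (fine S) => K; rewrite -lee_fin fineK ?ge0_fin_numE//.
apply: le_trans (nneseries_lim_ge (u_ := fun k => (u k)%:E) (m := 1) K.+1 _); last first.
  by move=> k _ _; rewrite lee_fin.
rewrite big_add1 big_mkord sumEFin lee_fin; apply: ler_sum => k _.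
have b0 : beta alpha k != 0 by rewrite gt_eqF// (lt_le_trans _ (beta_ge1 a0 _)).
have w0 : weight_sum alpha k.+1 != 0 by rewrite gt_eqF// weight_sum_gt0.
by rewrite /u /rate /= le_eqVlt; apply/orP; left; apply/eqP; field; rewrite b0 w0.
Qed.

(** The descent sums start at index 1, while the claimed rate includes the ratio of index 0, which
    equals 1. Once [S >= 1], [sqrt (1 + S) <= 2 sqrt S], which explains the factor 2; the absolute
    value covers a negative [M]. *)
Lemma residual_rate_eventually (alpha : nat -> R) (D : nat -> \bar R) (M : R) :
  (forall k, 0 < alpha k) -> (\sum_(0 <= k <oo) (alpha k)%:E = +oo)%E ->
  (forall K, 1 <= \sum_(k < K) alpha k.+1 / weight_sum alpha k.+1 ->
    exists2 k, (k < K)%N & (D k.+1 <=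
      (M / Num.sqrt (\sum_(k < K) alpha k.+1 / weight_sum alpha k.+1))%:E)%E) ->
  \forall K \near \oo, (\big[mine/+oo%E]_(1 <= i < K.+1) D i <=
    (2 * `|M| / Num.sqrt (\sum_(i < K.+1) alpha i / weight_sum alpha i))%:E)%E.
Proof.
move=> a0 adiv H.
have [K0 HK0] := weight_ratio_unbounded a0 adiv 1.
exists K0 => // K /= K0K.
pose a k := alpha k.+1 / weight_sum alpha k.+1; pose S := \sum_(k < K) a k.
have S1 : 1 <= S.
  apply: le_trans HK0 _; rewrite /S -!(big_mkord xpredT a) [leRHS](big_cat_nat (n := K0))//=.
  by rewrite lerDl sumr_ge0// => k _; exact: wmean_weight_ge0.
have [k kK Dk] := H K S1.
have -> : \sum_(i < K.+1) alpha i / weight_sum alpha i = 1 + S.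
  rewrite big_ord_recl /=; congr (_ + _).
  by rewrite /weight_sum big_ord1 divff// gt_eqF.
apply: (@le_trans _ _ (D k.+1)).
  by apply: (ge_bigmin_seq _ k.+1) => //; rewrite mem_index_iota.
apply: le_trans Dk _; rewrite lee_fin.
have S0 : 0 < S by lra.
have sS0 : 0 < Num.sqrt S by rewrite sqrtr_gt0.
have sS : Num.sqrt (1 + S) <= 2 * Num.sqrt S.
  have -> : 2 * Num.sqrt S = Num.sqrt (4 * S).
    rewrite sqrtrM//; congr (_ * _).
    by rewrite (_ : 4 = 2 ^+ 2) ?sqrtr_sqr ?ger0_norm//; ring.
  by rewrite ler_sqrt; lra.
have s1S0 : 0 < Num.sqrt (1 + S) by rewrite sqrtr_gt0; lra.
apply: (@le_trans _ _ (`|M| / Num.sqrt S)).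
  by rewrite ler_wpM2r ?ler_norm// invr_ge0 ltW.
rewrite ler_pdivrMr// mulrAC ler_pdivlMr//.
have := ler_wpM2l (normr_ge0 M) sS; lra.
Qed.

End reductions.

Theorem theorem3p4 (R : realType) (n : nat)
    (d : measure_display) (Omega : measurableType d) (P : probability Omega R)
    (d' : measure_display) (T : measurableType d') (Pr : probability T R)
    (g h : 'rV[R]_n -> Omega -> R) (r1 r2 : 'rV[R]_n -> \bar R)
    (alpha : nat -> R) (N gamma : R) (alg : sdca_variant)
    (F : nat -> set (set T)) (s : nat -> T -> Omega)
    (x z u : nat -> T -> 'rV[R]_n) :
  measure_is_complete P ->
  (forall t, convex_function (E := 'rV[R]_n) setT (g ^~ t)) ->
  (forall t, continuous (g ^~ t)) ->
  (forall t, convex_function (E := 'rV[R]_n) setT (h ^~ t)) ->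
  (forall t, continuous (h ^~ t)) ->
  (forall p, P.-integrable setT (EFin \o g p)) ->
  (forall p, P.-integrable setT (EFin \o h p)) ->
  (forall p, r1 p != -oo%E) -> convex_ext r1 -> lower_semicontinuous r1 ->
  (forall p, r2 p != -oo%E) -> convex_ext r2 -> lower_semicontinuous r2 ->
  (forall p, ext_diff r1 r2 p != -oo%E) ->
  lower_semicontinuous (ext_diff r1 r2) ->
  (forall k, 0 < alpha k) ->
  (\sum_(0 <= k <oo) (alpha k)%:E = +oo)%E ->
  0 < N -> 0 < gamma ->
  (forall k, (0 < k)%N ->
     sq_weight_sum alpha k / weight_sum alpha k ^+ 2 <= N / k%:R `^ gamma) ->
  (\sum_(1 <= k <oo)
     (alpha k * (1 + Num.sqrt (ln (beta alpha k.-1)))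
      / (beta alpha k.-1 * weight_sum alpha k))%:E < +oo)%E ->
  (1 / 2 < gamma \/ slowly_growing_weights alpha) ->
  iid_draws P Pr s -> history Pr s F ->
  generated_by_sdca P alpha g h r1 r2 alg F s x z u ->
  match alg with
  | SDCA1 => bounded_in_s h /\ equicontinuous_in_x h
  | SDCA2 => [/\ bounded_in_s g, bounded_in_s h,
                 equicontinuous_in_x g & equicontinuous_in_x h]
  end ->
  (0 < ereal_inf (range (fun t => rho_modulus (fun p => (h p t)%:E)))
       + rho_modulus r2)%E ->
  optimal_value P g h r1 r2 \is a fin_num ->
  {ae Pr, forall w, (limn_esup (fun k => (enorm (x k w))%:E) < +oo)%E} ->
  {ae Pr, forall w, (limn_esup (fun k => (enorm (u k w))%:E) < +oo)%E} ->
  (exists2 l : nat -> nat, {homo l : i j / (i < j)%N} &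
     {ae Pr, forall w, forall p,
        cluster ((fun k => x (l k) w) @ \oo) p ->
        critical_point P g h r1 r2 p})
  /\
  (forall (C : set 'rV[R]_n) (L : R),
     compact C ->
     {ae Pr, forall w, forall k, C (x k w)} ->
     0 <= L ->
     lipschitz_gradient_on C (L / 2) r2 ->
     (forall t, lipschitz_gradient_on C (L / 2) (fun p => (h p t)%:E)) ->
     (if alg is SDCA2 then
        forall t, lipschitz_gradient_on C (L / 2) (fun p => (g p t)%:E)
      else True) ->
     exists M : R, \forall k \near \oo,
       (min_residual P Pr g h r1 r2 x k
          <= (M / Num.sqrt (\sum_(i < k.+1) alpha i / weight_sum alpha i))%:E)%E).
Proof.
move=> _ cg0 _ ch0 _ Ig Ih r1Ny cr1 lr1 r2Ny cr2 lr2 _ _ alpha_gt0 alpha_div _ _ _.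
move=> rate_sum _ Hs HF [x_start z_sub u_sub x_step x_known _ _] HA rho_pos.
move=> opt_fin bx bu.
have cvx_g t : real_convex (g ^~ t) by exact: convex_function_real_convex (cg0 t).
have cvx_h t : real_convex (h ^~ t) by exact: convex_function_real_convex (ch0 t).
pose G := mean_fun P g.
have cG : real_convex G by exact: mean_fun_convex.
(* Both algorithms are SDCA2 for this integrand. *)
pose gh y t := if alg is SDCA1 then G y else g y t.
have ch : convex_integrand h.
  split=> [//|y|y]; first exact: integrable_measurable (Ih y).
  by apply: bounded_in_s_le; case: (alg) HA => [[]|[]].
have cgh : convex_integrand gh.
  rewrite /gh; case: (alg) HA => [_|[bg _ _ _]]; split=> //.
  - by move=> y; exists `|G y|.
  - by move=> y; exact: integrable_measurable (Ig y).
  - by move=> y; exact: bounded_in_s_le.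
have mean_gh y : mean P (gh y) = mean_fun P g y.
  by rewrite /gh; case: (alg); rewrite ?mean_cst// mean_funE.
have [rho1 [rho2 [rho1_ge0 rho2_ge0 rho_gt0 h_rho r2_rho]]] :=
  @common_moduli R n Omega (fun t y => (h y t)%:E) r2 (fun _ _ => isT) r2Ny
    (fun t => real_convex_ext (cvx_h t)) cr2 rho_pos.
have step k w : minimizer (fun y =>
    ((wmean alpha (fun i => gh y (s i w) : R^o) k)%:E + r1 y
     - (dotp (slope alpha (z ^~ w) (u ^~ w) k) y)%:E)%E) (x k.+1 w).
  move=> y; have := x_step k w y; rewrite /sdca_subproblem /sdca_model /gh.
  by case: (alg) => //; rewrite !(wmean_cst alpha_gt0 (V := R^o)).
have al_le y : r1 y \is a fin_num -> r2 y \is a fin_num ->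
    fine (optimal_value P g h r1 r2) <=
    mean P (gh y) - mean P (h y) + fine (r1 y) - fine (r2 y).
  by rewrite mean_gh mean_funE; exact: optimal_value_le.
have [rt rtP] := rate_partial_sums alpha_gt0 rate_sum.
split.
  have bounded_ae (v : nat -> T -> 'rV[R]_n) :
      {ae Pr, forall w, (limn_esup (fun k => (enorm (v k w))%:E) < +oo)%E} ->
      {ae Pr, forall w, exists M, forall k, enorm (v k w) <= M}.
    by apply: filterS => w; exact: limn_esup_lty_bounded.
  have [l lhomo lcrit] := critical_subsequence Hs HF alpha_gt0 cgh ch r1Ny r2Ny
    rho1_ge0 rho2_ge0 rho_gt0 h_rho r2_rho x_start z_sub u_sub step x_known al_le
    rtP alpha_div lr1 lr2 (bounded_ae _ bx) (bounded_ae _ bu).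
  exists l => //; apply: filterS lcrit => w H p /H[v v1 v2].
  exists v.
    by move: v1; under eq_fun do rewrite mean_gh.
  exists v; last by rewrite subrr.
  by move: v2; under eq_fun do rewrite -mean_funE.
move=> C L cC aeC L0 Lr2 Lh Lg.
have [r Cr] := compact_enorm_bounded cC.
have [Kg Kg0 [errg [merrg errg0 Eerrg splitg]]] : exists2 K : R, 0 <= K &
    exists err : nat -> T -> R,
    [/\ forall k, measurable_fun [set: T] (err k),
        forall k w, 0 <= err k w,
        forall k, (\int[Pr]_w (err k w)%:E <= (K * rate alpha k)%:E)%E &
        forall k w, (forall i, C (x i w)) -> exists a' b',
          [/\ subdiff (fun q => (mean P (gh q))%:E) (x k.+1 w) a',
            subdiff r1 (x k.+1 w) b' &
            enorm (slope alpha (z ^~ w) (u ^~ w) k - a' - b') <= err k w]].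
  have [algE|algE] : alg = SDCA1 \/ alg = SDCA2 by case: (alg); [left|right].
    exists 0 => //; exists (fun _ _ => 0); split => //.
      by move=> k; rewrite mul0r integral0.
    move=> k w Cx.
    apply: (slope_split_deterministic P alpha_gt0 r1Ny x_start step cr1 k w cG).
    by rewrite /gh algE.
  rewrite algE in Lg; have ghE : gh = g by rewrite /gh algE.
  rewrite ghE in cgh step *.
  have dg t y : C y -> differentiable (g ^~ t : 'rV[R]_n -> R^o) y.
    by move=> Cy; have [/(_ y Cy)[_ H] _] := Lg t; exact: H.
  have [gsub [K K0 [err [merr err0 Eerr law]]]] := @gradient_law R n _ _ _ _ P Pr s F
    Hs HF alpha alpha_gt0 g C r (L / 2) cgh (divr_ge0 L0 (ler0n _ _)) Cr dg
    (fun t y y' => (Lg t).2 y y').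
  exists K => //; exists err; split => // k w Cx.
  exact: (slope_split_smooth r1Ny x_start step cr1 dg gsub (Cx k.+1)
    (law k w _ (Cx k.+1))).
have [M HM] := min_residual_rate Hs HF alpha_gt0 cgh ch r1Ny r2Ny
    rho1_ge0 rho2_ge0 rho_gt0 h_rho r2_rho x_start z_sub u_sub step x_known al_le
    rtP Cr aeC L0 Lr2 Lh Kg0 merrg errg0 Eerrg splitg.
exists (2 * `|M|).
apply: (residual_rate_eventually alpha_gt0 alpha_div) => K /HM[k kK Dk].
exists k => //; apply: le_trans Dk; rewrite le_eqVlt; apply/orP; left; apply/eqP.
apply: eq_integral => w _; congr dist0; rewrite /criticality_set /residual_set.
have -> : EFin \o mean_fun P g = (fun q => (mean P (gh q))%:E).
  by apply/funext => q /=; rewrite mean_gh.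
have -> : EFin \o mean_fun P h = (fun q => (mean P (h q))%:E).
  by apply/funext => q /=; rewrite mean_funE.
by [].
Qed.
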